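(* For ${\rm APP}=\{{\rm APP}_d\}_{d\in\mathbb N}$ in the average case setting: with the absolute error criterion, ${\rm APP}$ is EXP-QPT for $\Lambda^{\rm all}$ iff it is EXP-QPT for $\Lambda^{\rm std}$. Moreover, for $\star\in\{{\rm ABS},{\rm NOR}\}$, if ${\rm APP}$ is EXP-QPT for $\Lambda^{\rm all}$ with criterion $\star$, then it is EXP-QPT for $\Lambda^{\rm std}$ with criterion $\star$ and ${\rm EXP}\text{-}t^{\star}(\Lambda^{\rm all})={\rm EXP}\text{-}t^{\star}(\Lambda^{\rm std})$.
   Context: Setting (average case approximation). For each $d\in\mathbb N$: $D_d\subset\mathbb R^d$ is a Borel set of positive Lebesgue measure, $\rho_d$ is a probability density on $D_d$, and $G_d=L_2(D_d,\rho_d(x)\,dx)$. $F_d$ is a separable Banach space of real-valued functions on $D_d$, continuously embedded in $G_d$, such that every point evaluation $f\mapsto f(x)$, $x\in D_d$, is a continuous linear functional on $F_d$; $F_d$ carries a zero-mean Gaussian measure $\mu_d$. ${\rm APP}_d:F_d\to G_d$, ${\rm APP}_d f=f$. $\Lambda^{\rm all}$ is the class of all continuous linear functionals on $F_d$, $\Lambda^{\rm std}$ the class of point evaluations. For $\Lambda\in\{\Lambda^{\rm all},\Lambda^{\rm std}\}$, an algorithm is $A_{n,d}f=\phi_{n,d}(L_1(f),\dots,L_n(f))$ with $L_i\in\Lambda$ and $\phi_{n,d}:\mathbb R^n\to G_d$ measurable; its average case error is $e^{\rm avg}(A_{n,d})=\big(\int_{F_d}\|f-A_{n,d}f\|_{G_d}^2\,\mu_d(df)\big)^{1/2}$,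 and $e^{\rm avg}(n,d;\Lambda)$ is the infimum of $e^{\rm avg}(A_{n,d})$ over all such algorithms using $n$ functionals from $\Lambda$ (for $n=0$, $A_{0,d}=0$). Set $\Gamma_d=(e^{\rm avg}(0,d;\Lambda))^2$ (same for both classes). Information complexity: $n^{\star}(\varepsilon,d;\Lambda)=\min\{n\ge0:\ e^{\rm avg}(n,d;\Lambda)\le\varepsilon\,{\rm CRI}_d\}$, with ${\rm CRI}_d=1$ for $\star={\rm ABS}$ and ${\rm CRI}_d=\sqrt{\Gamma_d}$ for $\star={\rm NOR}$. EXP-QPT for $\Lambda$ (criterion $\star$): there exist $C>0$, $t\ge0$ with $n^{\star}(\varepsilon,d;\Lambda)\le C\exp\big(t(1+\ln d)(1+\ln(1+\ln\varepsilon^{-1}))\big)$ for all $d\in\mathbb N$, $\varepsilon\in(0,1)$; the exponent ${\rm EXP}\text{-}t^{\star}(\Lambda)$ is the infimum of all such $t$. *)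

(* Defs.v *)
From HB Require Import structures.
From mathcomp Require Import all_boot all_order all_algebra.
From mathcomp Require Import all_classical all_reals all_analysis.
Set Implicit Arguments.
Unset Strict Implicit.
Unset Printing Implicit Defensive.
Import Order.TTheory GRing.Theory Num.Def Num.Theory.
Import numFieldNormedType.Exports.
Local Open Scope classical_set_scope.
Local Open Scope ring_scope.

Section AvgApp.
Context {R : realType}.

(** R^n is represented by [n.-tuple R] with its product (= Borel) sigma-algebra.
    Lebesgue integral over R^n of a function with values in [0,+oo] (extended
    reals), computed as iterated one-dimensional Lebesgue integrals (Tonelli). *)
Fixpoint intRn (n : nat) : (n.-tuple R -> \bar R) -> \bar R :=
  match n return (n.-tuple R -> \bar R) -> \bar R with
  | 0 => fun g => g [tuple]
  | n'.+1 => fun g =>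
      (\int[@lebesgue_measure R]_x intRn (fun t : n'.-tuple R => g (cons_tuple x t)))%E
  end.

Definition sqnormG (d : nat) (D : set (d.-tuple R)) (rho : d.-tuple R -> R)
    (g : d.-tuple R -> R) : \bar R :=
  intRn (fun x => (\1_D x * rho x * g x ^+ 2)%:E).

Definition esqrt (x : \bar R) : \bar R :=
  match x with
  | EFin r => (Num.sqrt r)%:E
  | +oo%E => +oo%E
  | -oo%E => 0%E
  end.

Definition borel_type (F : completeNormedModType R) := g_sigma_algebraType (@open F).

Definition linear_functional (F : completeNormedModType R) (L : F -> R) :=
  forall (a : R) (f g : F), L (a *: f + g) = a * L f + L g.

Definition centered_gaussian (F : completeNormedModType R)
    (mu : set (borel_type F) -> \bar R) :=
  forall L : F -> R, linear_functional L -> continuous L ->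
    exists s : R, 0 <= s /\
      forall B : set R, measurable B ->
        mu (L @^-1` B) = if s == 0 then \d_(0:R) B else normal_prob 0 s B.

Definition separable (T : topologicalType) :=
  exists S : set T, countable S /\ closure S = setT.

(** The average case approximation setting, for all d (the data for d = 0
    is irrelevant: only d >= 1 enters the tractability notions below). *)
Unset Implicit Arguments.
Record avg_app_setting := AvgAppSetting {
  Dom : forall d : nat, set (d.-tuple R);
  rho : forall d : nat, d.-tuple R -> R;
  Fsp : nat -> completeNormedModType R;
  emb : forall d : nat, Fsp d -> d.-tuple R -> R;   (* f |-> f as a function on D_d *)
  mu : forall d : nat, probability (borel_type (Fsp d)) R;
  Dom_measurable : forall d, measurable (Dom d);
  Dom_pos : forall d, (0 < intRn (fun x => (\1_(Dom d) x)%:E))%E;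
  rho_measurable : forall d, measurable_fun (Dom d) (rho d);
  rho_ge0 : forall d x, Dom d x -> 0 <= rho d x;
  rho_int1 : forall d, intRn (fun x => (\1_(Dom d) x * rho d x)%:E) = 1%E;
  Fsp_separable : forall d, separable (Fsp d);
  emb_linear : forall d (a : R) (f g : Fsp d) x,
      emb d (a *: f + g) x = a * emb d f x + emb d g x;
  emb_inj : forall d (f g : Fsp d),
      (forall x, Dom d x -> emb d f x = emb d g x) -> f = g;
  emb_measurable : forall d (f : Fsp d), measurable_fun (Dom d) (emb d f);
  emb_continuous : forall d, exists C : R, forall f : Fsp d,
      (sqnormG (Dom d) (rho d) (emb d f) <= (C * `|f| ^+ 2)%:E)%E;
  eval_continuous : forall d x, Dom d x -> continuous (fun f : Fsp d => emb d f x);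
  mu_gaussian : forall d, centered_gaussian (mu d)
}.
Set Implicit Arguments.

Inductive info_class := Lall | Lstd.
Inductive criterion := ABS | NOR.

Variable S : avg_app_setting.

Definition in_class (cl : info_class) (d : nat) (L : Fsp S d -> R) : Prop :=
  match cl with
  | Lall => linear_functional L /\ continuous L
  | Lstd => exists x, Dom S d x /\ L = (fun f => emb S d f x)
  end.

Definition infovec (d n : nat) (L : n.-tuple (Fsp S d -> R)) (f : Fsp S d) :
  n.-tuple R := map_tuple (fun l => l f) L.

Definition err_alg (d n : nat) (L : n.-tuple (Fsp S d -> R))
    (phi : n.-tuple R -> d.-tuple R -> R) : \bar R :=
  esqrt (\int[mu S d]_(f in [set: borel_type (Fsp S d)])
           sqnormG (Dom S d) (rho S d)
             (fun x => (emb S d (f : Fsp S d) x - phi (infovec L f) x)%R))%E.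

(** admissible algorithms: L_i in the class, phi : R^n -> G_d measurable
    (jointly measurable representative) *)
Definition admissible (cl : info_class) (d n : nat) (L : n.-tuple (Fsp S d -> R))
    (phi : n.-tuple R -> d.-tuple R -> R) : Prop :=
  (forall i : 'I_n, in_class cl (tnth L i)) /\
  measurable_fun [set: (n.-tuple R * d.-tuple R)%type] (fun p => phi p.1 p.2).

Definition e_avg (cl : info_class) (n d : nat) : \bar R :=
  if n is 0 then @err_alg d 0 [tuple] (fun _ _ => 0)
  else ereal_inf [set e : \bar R | exists (L : n.-tuple (Fsp S d -> R))
                     (phi : n.-tuple R -> d.-tuple R -> R),
                     admissible cl L phi /\ e = err_alg L phi].

Definition Gamma (d : nat) : \bar R := (e_avg Lall 0 d * e_avg Lall 0 d)%E.

Definition CRI (cr : criterion) (d : nat) : \bar R :=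
  match cr with ABS => 1%E | NOR => esqrt (Gamma d) end.

(** information complexity (= +oo if no n works) *)
Definition n_info (cl : info_class) (cr : criterion) (eps : R) (d : nat) : \bar R :=
  ereal_inf [set (n%:R)%:E | n in
             [set n : nat | (e_avg cl n d <= eps%:E * CRI cr d)%E]].

Definition exp_qpt_bound (cl : info_class) (cr : criterion) (C t : R) : Prop :=
  forall d : nat, (0 < d)%N -> forall eps : R, 0 < eps < 1 ->
    (n_info cl cr eps d <=
       (C * expR (t * (1 + ln d%:R) * (1 + ln (1 + ln eps^-1))))%:E)%E.

Definition EXP_QPT (cl : info_class) (cr : criterion) : Prop :=
  exists C t : R, 0 < C /\ 0 <= t /\ exp_qpt_bound cl cr C t.

Definition EXP_t (cl : info_class) (cr : criterion) : \bar R :=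
  ereal_inf [set t%:E | t in
             [set t : R | 0 <= t /\ exists C : R, 0 < C /\ exp_qpt_bound cl cr C t]].

End AvgApp.

(* Main.v *)
(** Only the passage from [Lall] to [Lstd] is not immediate. By Gaussianity the best
    use of [m] functionals is linear, so an optimal approximation lies in the span of
    an orthonormal family [e_1, ..., e_k] of the weighted [L_2] space, [k <= m]. Its
    coefficients can be computed from function values alone, to within any factor
    [c > 1] of the error: a first pass of [k] samples, each chosen where the value is
    at most the mean under the density [dot (e x) (Q e x) / tr Q] and deflating the
    projection [Q], brings the squared error down to [k + 1] times the optimum [G];
    then [j] relaxed Kaczmarz steps contract the excess geometrically, so that [k + j]
    values achieve [G * (1 + (k + 1) * (1 - al / k) ^ j + al)].
    With [al] of order [1 / (1 + ln d)] the number of samples is [m] times a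
    polynomial in [X = (1 + ln d) (1 + ln (1 + ln (1 / eps)))]; asking the [Lall]
    algorithm for accuracy [eps * exp (- 1 / (1 + ln d))] costs only a constant factor,
    and the polynomial is absorbed by [exp (s X)] for every [s > 0]. *)

Require Import Defs.
From HB Require Import structures.
From mathcomp Require Import all_boot all_order all_algebra.
From mathcomp Require Import all_classical all_reals all_analysis.
From mathcomp Require Import measurable_realfun normal_distribution random_variable ring lra.
Set Implicit Arguments.
Unset Strict Implicit.
Unset Printing Implicit Defensive.
Import Order.TTheory GRing.Theory Num.Def Num.Theory.
Import numFieldNormedType.Exports.
Local Open Scope classical_set_scope.
Local Open Scope ring_scope.

(** * Densities and the normal distribution *)

(** [centered_gaussian] gives only the laws of single functionals, so joint independence has to be
    derived: linear combinations have explicit cosine integrals, these factor when the functionals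
    are uncorrelated, and Fourier uniqueness turns the factorisation into independence. The second
    moment of the whole random function is not assumed finite; that the coefficient functions are
    square integrable is extracted from the finite error of the given algorithm.

    Each sampling phase repairs a defect of the other. Kaczmarz steps from zero would start at the
    full variance, which is not bounded in terms of [G]; deflation alone loses the factor [k + 1].

    The order of [al] is dictated by the exponent: a factor [c] in the error turns
    [1 + ln (1 / eps)] into [1 + ln (1 / eps) + ln c], and for [eps] near 1 this adds about
    [t (1 + ln d) ln (1 + ln c)], which stays bounded in [d] when [ln c] is of order
    [1 / (1 + ln d)]. *)

Section density.
Context d (T : measurableType d) (R : realType).
Variables (m n : {measure set T -> \bar R}) (p : T -> R).
Hypothesis p0 : forall x, 0 <= p x.
Hypothesis mp : measurable_fun setT p.
Hypothesis nE : forall A, measurable A -> n A = (\int[m]_(x in A) (p x)%:E)%E.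
Import HBNNSimple.
Local Open Scope ereal_scope.

Let indicE (E : set T) : measurable E ->
  \int[n]_x (\1_E x)%:E = \int[m]_x ((\1_E x)%:E * (p x)%:E).
Proof.
move=> mE; rewrite integral_indic//= setIT nE// [LHS]integral_mkcond/=.
apply: eq_integral => x _; rewrite patchE indicE.
by case: ifPn => _; rewrite ?mul1e ?mul0e.
Qed.

Let nnsfunE (f : {nnsfun T >-> R}) :
  \int[n]_x (f x)%:E = \int[m]_x ((f x)%:E * (p x)%:E).
Proof.
under [LHS]eq_integral do rewrite fimfunE -fsumEFin//.
rewrite [LHS]ge0_integral_fsum//; last 2 first.
  - by move=> r; exact/measurable_EFinP/measurableT_comp.
  - by move=> r x _; rewrite EFinM nnfun_muleindic_ge0.
under [RHS]eq_integral.
  move=> x xD; rewrite fimfunE -fsumEFin// ge0_mule_fsuml; last first.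
    by move=> r; rewrite EFinM nnfun_muleindic_ge0.
  over.
rewrite [RHS]ge0_integral_fsum//; last 2 first.
  - move=> r; apply: emeasurable_funM; last exact/measurable_EFinP.
    by apply/measurable_EFinP; do 2 apply/measurableT_comp => //.
  - move=> r x _; rewrite mule_ge0//; last by rewrite lee_fin.
    by rewrite EFinM nnfun_muleindic_ge0.
apply: eq_fsbigr => r _.
rewrite integralZl_indic_nnsfun//=.
under [RHS]eq_integral do rewrite EFinM -muleA.
have [r0|r0] := leP 0%R r.
  rewrite ge0_integralZl//.
  - by rewrite indicE.
  - apply: emeasurable_funM; last exact/measurable_EFinP.
    by apply/measurable_EFinP; exact: measurable_indic.
  - by move=> x _; rewrite mule_ge0// lee_fin.
(* A negative [r] is not a value of [f], so both sides vanish. *)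
have -> : f @^-1` [set r] = set0 by rewrite preimage_nnfun0.
by rewrite indic0 integral0 mule0 integral0_eq// => x _; rewrite mul0e mule0.
Qed.

Lemma ge0_integral_density (f : T -> \bar R) :
  measurable_fun setT f -> (forall x, 0 <= f x) ->
  \int[n]_x f x = \int[m]_x (f x * (p x)%:E).
Proof.
move=> mf f0.
pose f_ := nnsfun_approx measurableT mf.
transitivity (lim (\int[n]_x (f_ k x)%:E @[k --> \oo])).
  rewrite -monotone_convergence//=.
  - apply: eq_integral => ? /[!inE] xD; apply/esym/cvg_lim => //=.
    exact: cvg_nnsfun_approx.
  - by move=> k; exact/measurable_EFinP/measurable_funTS.
  - by move=> k ? _; rewrite lee_fin.
  - by move=> ? _ ? ? mn; rewrite lee_fin; exact/lefP/nd_nnsfun_approx.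
under eq_fun do rewrite nnsfunE.
rewrite -monotone_convergence//=.
- apply: eq_integral => x /[!inE] xD.
  apply/cvg_lim => //=; apply: cvgeZr => //.
  by exact: cvg_nnsfun_approx.
- move=> k; apply: emeasurable_funM; last exact/measurable_EFinP.
  exact/measurable_EFinP/measurable_funTS.
- by move=> k x _; rewrite mule_ge0// lee_fin.
- move=> x _ a b ab; apply: lee_wpmul2r; first by rewrite lee_fin.
  by rewrite lee_fin; exact/lefP/nd_nnsfun_approx.
Qed.

Lemma integral_density (f : T -> \bar R) :
  measurable_fun setT f -> \int[n]_x f x = \int[m]_x (f x * (p x)%:E).
Proof.
move=> mf; rewrite integralE [RHS]integralE; congr (_ - _).
  rewrite ge0_integral_density//; last exact: measurable_funepos.
  by apply: eq_integral => x _; rewrite !funeposE maxe_pMl ?lee_fin// mul0e.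
rewrite ge0_integral_density//; last exact: measurable_funeneg.
by apply: eq_integral => x _; rewrite !funenegE maxe_pMl ?lee_fin// mul0e mulNe.
Qed.

End density.

(** * Integrals of derivatives over the whole line *)

Section integral_derive.
Context (R : realType).
Notation leb := (@lebesgue_measure R).

(** The fundamental theorem on growing symmetric intervals, then dominated convergence. The Gaussian
    identities below all come from it by exhibiting an antiderivative that vanishes at infinity. *)
Lemma integral_derive_eq0 (v w : R -> R) :
  (forall x : R, is_derive x 1 v (w x)) -> continuous w ->
  leb.-integrable setT (EFin \o w) ->
  v n%:R @[n --> \oo] --> (0 : R) -> v (- n%:R) @[n --> \oo] --> (0 : R) ->
  (\int[leb]_x (w x)%:E)%E = 0%E.
Proof.
move=> vw cw iw v0 v0'.
have mw : measurable_fun setT w by exact: continuous_measurable_fun.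
(* The shift to [n.+1] keeps the interval nondegenerate, as the fundamental theorem requires. *)
pose I n := `[- n.+1%:R, n.+1%:R]%classic : set R.
pose f n := (EFin \o w) \_ (I n).
have h1 : (\int[leb]_x f n x)%E @[n --> \oo] --> (\int[leb]_x (w x)%:E)%E.
  apply: (@dominated_cvg _ _ _ leb setT measurableT f _ (abse \o (EFin \o w))).
  - by move=> n; apply/(measurable_restrictT _ (measurable_itv _)); apply: measurable_funTS; exact/measurable_EFinP.
  - move=> x _; apply: cvg_near_cst; near=> n.
    rewrite /f patchE mem_set// /I/= in_itv/= -ler_norml.
    near: n; exists (truncn `|x|) => // n /= xn.
    apply/ltW/(lt_le_trans (truncnS_gt _)).
    by rewrite ler_nat ltnS.
  - by move=> x _.
  - exact: integrable_abse.
  - move=> n x _; rewrite /f patchE; case: ifPn => //= _.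
    by rewrite normr0 lee_fin.
have h2 n : (\int[leb]_x f n x)%E = (v n.+1%:R - v (- n.+1%:R))%:E.
  rewrite /f -integral_mkcond EFinB.
  have dv (x : R) : derivable v x 1 by case: (vw x).
  have vc (x : R) : {for x, continuous v}.
    by apply: differentiable_continuous; exact/derivable1_diffP.
  apply: continuous_FTC2 => //.
  - by rewrite (@lt_le_trans _ _ 0)// ltrNl oppr0 ltr0n.
  - exact: continuous_subspaceT.
  - split => [x _| |].
    + exact: dv.
    + by apply: cvg_at_right_filter; exact: vc.
    + by apply: cvg_at_left_filter; exact: vc.
  - by move=> x _; rewrite derive1E; exact: derive_val.
have h3 : (\int[leb]_x f n x)%E @[n --> \oo] --> (0 : \bar R)%E.
  under eq_fun do rewrite h2.
  apply: cvg_EFin; first exact: nearW.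
  rewrite -(subr0 (0 : R)) /comp/=.
  apply: cvgB.
    by move: v0; rewrite -(cvg_shiftS (fun n => v n%:R)).
  by move: v0'; rewrite -(cvg_shiftS (fun n => v (- n%:R))).
exact: cvg_unique h1 h3.
Unshelve. all: end_near. Qed.

Lemma cvg_div_natr (v : R -> R) (m C : R) : (forall x, `|v x| * `|x - m| <= C) ->
  v n%:R @[n --> \oo] --> (0 : R) /\ v (- n%:R) @[n --> \oo] --> (0 : R).
Proof.
move=> vC.
have key (u : R -> R) (k : R) : (forall x, `|u x| * `|x - k| <= C) ->
    u n%:R @[n --> \oo] --> (0 : R).
  move=> uC; apply/cvgrPdist_le => e e0; near=> n.
  rewrite sub0r normrN.
  have nk : k + 1 + C / e < n%:R.
    near: n; exists (truncn `|k + 1 + C / e|).+1 => // n /= hn.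
    apply: (le_lt_trans (ler_norm _)).
    apply: (lt_le_trans (truncnS_gt _)).
    by rewrite ler_nat.
  have C0 : 0 <= C by rewrite (le_trans _ (uC 0))// mulr_ge0.
  have Ce : 0 <= C / e by rewrite divr_ge0// ltW.
  have nk0 : 0 < `|n%:R - k| by rewrite normr_gt0 gt_eqF//; lra.
  rewrite -(ler_pM2r nk0); apply: (le_trans (uC _)).
  rewrite -ler_pdivrMl//.
  by apply: (le_trans _ (ler_norm _)); rewrite mulrC; lra.
split; first exact: (key _ m).
apply: (key (fun x => v (- x)) (- m)) => x.
by rewrite (_ : x - - m = - (- x - m)) ?normrN//; ring.
Unshelve. all: end_near. Qed.

End integral_derive.

Section normal_integrals.
Context (R : realType).
Notation leb := (@lebesgue_measure R).
Variables (m s : R).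
Hypothesis s0 : 0 < s.
Let sn0 : s != 0. Proof. by rewrite gt_eqF. Qed.

Lemma is_derive_normal_pdf (x : R) :
  is_derive x 1 (normal_pdf m s) (- (x - m) / s ^+ 2 * normal_pdf m s x).
Proof.
rewrite normal_pdfE// /normal_fun.
pose c := - (s ^+ 2 *+ 2)^-1.
rewrite (_ : (fun x => _) = (fun x => normal_peak s *: expR (c * ((x - m) ^+ 2)))); last first.
  by apply/funext => y; rewrite /c /GRing.scale /=; congr (_ * expR _); ring.
have d1 : is_derive x 1 (fun y : R => y - m) 1.
  by apply: is_derive_eq; rewrite subr0.
have d2 : is_derive x 1 (fun y : R => c * (y - m) ^+ 2) (c * (2 * (x - m))).
  apply: is_derive_eq.
  by rewrite /GRing.scale /= mulr1; ring.
have d3 : is_derive x 1 (fun y : R => expR (c * (y - m) ^+ 2)) (c * (2 * (x - m)) * expR (c * (x - m) ^+ 2)).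
  by apply: is_derive_eq; rewrite mulrC.
apply: is_derive_eq; rewrite /GRing.scale /= /c.
have -> : - (x - m) ^+ 2 / (s ^+ 2 *+ 2) = - (s ^+ 2 *+ 2)^-1 * (x - m) ^+ 2 by ring.
by field.
Qed.

(** Doubling the variance halves the exponent, so a quadratic factor is absorbed by a wider normal
    density: with [z = (x - m) ^+ 2 / (4 * s ^+ 2)] the comparison reads
    [z * expR (- 2 z) <= expR (- z)]. Integrability and boundedness follow together. *)
Let S := s * Num.sqrt 2.
Let S0 : S != 0.
Proof. by rewrite mulf_neq0// gt_eqF// sqrtr_gt0. Qed.
Let S2 : S ^+ 2 = 2 * s ^+ 2.
Proof. by rewrite /S exprMn sqr_sqrtr// mulrC. Qed.
Let C := 4 * s ^+ 2 * normal_peak s / normal_peak S.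
Let C0 : 0 <= C.
Proof. by apply: divr_ge0; [do ?apply: mulr_ge0|]; rewrite ?normal_peak_ge0 ?(ltW s0). Qed.

Let sqr_normal_pdf_le x : (x - m) ^+ 2 * normal_pdf m s x <= C * normal_pdf m S x.
Proof.
rewrite !normal_pdfE//= /C.
have pS : normal_peak S != 0 by rewrite gt_eqF// normal_peak_gt0.
have -> : 4 * s ^+ 2 * normal_peak s / normal_peak S * (normal_peak S * normal_fun m S x)
  = normal_peak s * (4 * s ^+ 2 * normal_fun m S x) by field.
rewrite mulrCA ler_wpM2l ?normal_peak_ge0//.
rewrite /normal_fun S2; set y := (x - m) ^+ 2.
set z := y / (4 * s ^+ 2).
have s2 : 0 < s ^+ 2 by rewrite exprn_gt0.
have -> : - y / (2 * s ^+ 2 *+ 2) = - z by rewrite /z; field.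
have -> : - y / (s ^+ 2 *+ 2) = - z - z by rewrite /z; field.
have -> : y = (4 * s ^+ 2) * z by rewrite /z; field.
rewrite -[leLHS]mulrA ler_pM2l ?mulr_gt0// expRD mulrA ler_piMl ?expR_ge0//.
rewrite expRN ler_pdivrMr ?expR_gt0// mul1r.
by apply: le_trans (expR_ge1Dx z); rewrite lerDr.
Qed.

Let integrableC : leb.-integrable setT (fun x => (C * normal_pdf m S x)%:E).
Proof.
under eq_fun do rewrite EFinM.
by apply: integrableZl => //; exact: integrable_normal_pdf.
Qed.

Lemma integrable_sqr_normal_pdf :
  leb.-integrable setT (fun x => ((x - m) ^+ 2 * normal_pdf m s x)%:E).
Proof.
apply: le_integrable integrableC => //.
  apply/measurable_EFinP; apply: measurable_funM; last exact: measurable_normal_pdf.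
  by apply: measurable_funX; exact: measurable_funB.
move=> x _; rewrite lee_fin ger0_norm; last first.
  by apply: mulr_ge0; [exact: sqr_ge0|exact: normal_pdf_ge0].
exact: le_trans (sqr_normal_pdf_le x) (ler_norm _).
Qed.

Lemma integrable_le_normal_pdf (w : R -> R) (A B : R) : measurable_fun setT w ->
  (forall x, `|w x| <= (A + B * (x - m) ^+ 2) * normal_pdf m s x) ->
  leb.-integrable setT (EFin \o w).
Proof.
move=> mw wle.
have ig : leb.-integrable setT (fun x => (A%:E * (normal_pdf m s x)%:E +
    B%:E * ((x - m) ^+ 2 * normal_pdf m s x)%:E)%E).
  apply: integrableD => //; apply: integrableZl => //.
    exact: integrable_normal_pdf.
  exact: integrable_sqr_normal_pdf.
apply: le_integrable ig => //.
  exact/measurable_EFinP.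
move=> x _; rewrite -!EFinM -EFinD lee_fin.
by apply: (le_trans (wle x)); apply: (le_trans _ (ler_norm _)); rewrite mulrDl -mulrA.
Qed.

Lemma sqr_normal_pdf_ub : exists K : R, forall x, (x - m) ^+ 2 * normal_pdf m s x <= K.
Proof.
exists (C * normal_peak S) => x; apply: (le_trans (sqr_normal_pdf_le x)).
by apply: ler_wpM2l => //; exact: normal_pdf_ub.
Qed.

Lemma normal_second_moment :
  (\int[leb]_x ((x - m) ^+ 2 * normal_pdf m s x)%:E = (s ^+ 2)%:E)%E.
Proof.
have s2 : 0 < s ^+ 2 by rewrite exprn_gt0.
(* [w] is the derivative of [v]; its vanishing integral equates the second moment with [s ^+ 2]
   times the total mass. *)
pose w x := (s ^+ 2 - (x - m) ^+ 2) * normal_pdf m s x.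
pose v x := s ^+ 2 * (x - m) * normal_pdf m s x.
have vw (x : R) : is_derive x 1 v (w x).
  have d1 : is_derive x 1 (fun y : R => s ^+ 2 * (y - m)) (s ^+ 2).
    by apply: is_derive_eq; rewrite subr0 /GRing.scale /= mulr1.
  have d2 := is_derive_normal_pdf x.
  by apply: is_derive_eq; rewrite /GRing.scale /= /w; field.
have cw : continuous w.
  move=> x; apply: cvgM; last exact: continuous_normal_pdf.
  apply: cvgB; first exact: cvg_cst.
  apply: (@cvg_comp _ _ _ (fun x => x - m) (fun x => x ^+ 2)); last exact: sqr_continuous.
  by apply: cvgB; [exact: cvg_id|exact: cvg_cst].
have mw : measurable_fun setT w by exact: continuous_measurable_fun.
have iw : leb.-integrable setT (EFin \o w).
  apply: (@integrable_le_normal_pdf _ (s ^+ 2) 1) => // x.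
  rewrite /w normrM (ger0_norm (normal_pdf_ge0 _ _ _)) ler_wpM2r ?normal_pdf_ge0//.
  rewrite mul1r (le_trans (ler_normB _ _))// !ger0_norm ?sqr_ge0//.
have [K HK] := sqr_normal_pdf_ub.
have [v0 v0'] : v n%:R @[n --> \oo] --> (0 : R) /\ v (- n%:R) @[n --> \oo] --> (0 : R).
  apply: (@cvg_div_natr _ v m (s ^+ 2 * K)) => x.
  rewrite /v normrM (ger0_norm (normal_pdf_ge0 _ _ _)) normrM (ger0_norm (ltW s2)).
  have -> : s ^+ 2 * `|x - m| * normal_pdf m s x * `|x - m| =
    s ^+ 2 * (`|x - m| ^+ 2 * normal_pdf m s x) by ring.
  by rewrite ler_pM2l// real_normK ?num_real.
have := integral_derive_eq0 vw cw iw v0 v0'.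
under eq_integral do rewrite /w mulrBl EFinB.
rewrite integralB//=; last 2 first.
- under eq_fun do rewrite EFinM.
  by apply: integrableZl => //; exact: integrable_normal_pdf.
- exact: integrable_sqr_normal_pdf.
have -> : (\int[leb]_x (s ^+ 2 * normal_pdf m s x)%:E = (s ^+ 2)%:E)%E.
  under eq_integral do rewrite EFinM.
  by rewrite integralZl//= ?integral_normal_pdf ?mule1//; exact: integrable_normal_pdf.
have := integrable_fin_num measurableT integrable_sqr_normal_pdf => /=.
case: (integral _ _ _) => // r _ /=; rewrite -EFinB => -[] /eqP.
by rewrite subr_eq0 => /eqP <-.
Qed.

Lemma normal_mean :
  (\int[leb]_x ((x - m) * normal_pdf m s x)%:E = 0)%E.
Proof.
have s2 : 0 < s ^+ 2 by rewrite exprn_gt0.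
pose w x := (x - m) * normal_pdf m s x.
pose v x := - s ^+ 2 * normal_pdf m s x.
have p0 x : 0 <= normal_pdf m s x by exact: normal_pdf_ge0.
have vw (x : R) : is_derive x 1 v (w x).
  have d2 := is_derive_normal_pdf x.
  by apply: is_derive_eq; rewrite /GRing.scale /= /w; field.
have cw : continuous w.
  move=> x; apply: cvgM; last exact: continuous_normal_pdf.
  by apply: cvgB; [exact: cvg_id|exact: cvg_cst].
have le1 (x : R) : `|x - m| <= 1 + 1 * (x - m) ^+ 2.
  rewrite mul1r -(@real_normK _ (x - m)) ?num_real// -subr_ge0.
  by have := sqr_ge0 (`|x - m| - 1); nra.
have iw : leb.-integrable setT (EFin \o w).
  apply: (@integrable_le_normal_pdf _ 1 1); first exact: continuous_measurable_fun.
  by move=> x; rewrite normrM (ger0_norm (p0 x)) ler_wpM2r.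
have [K HK] := sqr_normal_pdf_ub.
have [v0 v0'] : v n%:R @[n --> \oo] --> (0 : R) /\ v (- n%:R) @[n --> \oo] --> (0 : R).
  apply: (@cvg_div_natr _ v m (s ^+ 2 * (normal_peak s + K))) => x.
  rewrite normrM normrN (ger0_norm (p0 x)) (ger0_norm (ltW s2)) -mulrA ler_pM2l//.
  apply: (@le_trans _ _ (normal_pdf m s x * (1 + 1 * (x - m) ^+ 2))).
    by apply: ler_wpM2l.
  rewrite mulrDr mulr1 mul1r; apply: lerD; first exact: normal_pdf_ub.
  by rewrite mulrC.
exact: integral_derive_eq0 vw cw iw v0 v0'.
Qed.

End normal_integrals.

(** * Characteristic function of the centered normal law, in real form *)

Section normal_cos.
Context (R : realType).
Notation leb := (@lebesgue_measure R).
Variable s : R.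
Hypothesis s0 : 0 < s.
Let sn0 : s != 0. Proof. by rewrite gt_eqF. Qed.
Let s2 : 0 < s ^+ 2. Proof. by rewrite exprn_gt0. Qed.
Local Notation p := (normal_pdf 0 s).

(** The phase [c] covers cosine and sine at once, so no complex exponentials are required. *)
Let cosp c (t x : R) := cos (t * x + c) * p x.
Let sinp c (t x : R) := x * sin (t * x + c) * p x.

Let cts_lin (t c : R) : continuous (fun x : R => t * x + c).
Proof.
move=> x; apply: cvgD; last exact: cvg_cst.
by apply: cvgM; [exact: cvg_cst|exact: cvg_id].
Qed.

Let cts_cos (t c : R) : continuous (fun x : R => cos (t * x + c)).
Proof. by move=> x; apply: (cvg_comp _ cos); [exact: cts_lin|exact: continuous_cos]. Qed.

Let cts_sin (t c : R) : continuous (fun x : R => sin (t * x + c)).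
Proof. by move=> x; apply: (cvg_comp _ sin); [exact: cts_lin|exact: continuous_sin]. Qed.

Let ctsp : continuous p. Proof. exact: continuous_normal_pdf. Qed.

Let p0 (x : R) : 0 <= p x. Proof. exact: normal_pdf_ge0. Qed.

Let cts_cosp c t : continuous (cosp c t).
Proof. by move=> x; apply: cvgM; [exact: cts_cos|exact: ctsp]. Qed.

Let cts_sinp c t : continuous (sinp c t).
Proof.
move=> x; apply: cvgM; last exact: ctsp.
by apply: cvgM; [exact: cvg_id|exact: cts_sin].
Qed.

Let le_norm (x : R) : `|x| <= 1 + 1 * (x - 0) ^+ 2.
Proof.
rewrite subr0 mul1r -(@real_normK _ x) ?num_real//.
have := sqr_ge0 (`|x| - 1); rewrite -subr_ge0 => h.
rewrite -subr_ge0; nra.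
Qed.

Let int_cosp c t : leb.-integrable setT (EFin \o cosp c t).
Proof.
apply: (@integrable_le_normal_pdf _ 0 s s0 _ 1 0).
  exact: continuous_measurable_fun.
move=> x; rewrite /cosp mul0r addr0 normrM (ger0_norm (p0 x)).
by apply: ler_wpM2r => //; rewrite ler_norml cos_geN1 cos_le1.
Qed.

Let norm_sinp c t x : `|sinp c t x| <= `|x| * p x.
Proof.
rewrite /sinp !normrM (ger0_norm (p0 x)); apply: ler_wpM2r => //.
by rewrite ler_piMr// ler_norml sin_geN1 sin_le1.
Qed.

Let int_xp : leb.-integrable setT (fun x => (`|x| * p x)%:E).
Proof.
apply: (@integrable_le_normal_pdf _ 0 s s0 (fun x => `|x| * p x) 1 1).
  apply: measurable_funM; last exact: measurable_normal_pdf.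
  exact: normr_measurable.
move=> x; rewrite ger0_norm; last by rewrite mulr_ge0.
by apply: ler_wpM2r.
Qed.

Let int_sinp c t : leb.-integrable setT (EFin \o sinp c t).
Proof.
apply: le_integrable int_xp => //.
  by apply/measurable_EFinP; exact: continuous_measurable_fun.
move=> x _; rewrite lee_fin; apply: (le_trans (norm_sinp _ _ _)).
by rewrite ler_norm.
Qed.

Let F c t := (\int[leb]_x cosp c t x)%R.

(** Integration by parts, with antiderivative [sin (t * x + c) * p x]. It closes the differential
    equation that [F c] satisfies. *)
Let stein c t : (\int[leb]_x sinp c t x = s ^+ 2 * t * F c t)%R.
Proof.
pose v x := sin (t * x + c) * p x.
pose w x := t * cosp c t x - (s ^+ 2)^-1 * sinp c t x.
have vw (x : R) : is_derive x 1 v (w x).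
  have d1 : is_derive x 1 (fun y : R => t * y + c) t.
    by apply: is_derive_eq; rewrite addr0 /GRing.scale /= mulr1.
  have d2 : is_derive x 1 (fun y : R => sin (t * y + c)) (t * cos (t * x + c)).
    by apply: is_derive_eq; rewrite mulrC.
  have d3 := is_derive_normal_pdf 0 s0 x.
  by apply: is_derive_eq; rewrite /GRing.scale /= /w /cosp /sinp subr0; field.
have cw : continuous w.
  move=> x; apply: cvgB.
    by apply: cvgM; [exact: cvg_cst|exact: cts_cosp].
  by apply: cvgM; [exact: cvg_cst|exact: cts_sinp].
have i1 : leb.-integrable setT (fun x => (t * cosp c t x)%:E).
  by under eq_fun do rewrite EFinM; exact: (integrableZl measurableT t (int_cosp c t)).
have i2 : leb.-integrable setT (fun x => ((s ^+ 2)^-1 * sinp c t x)%:E).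
  by under eq_fun do rewrite EFinM; exact: (integrableZl measurableT _ (int_sinp c t)).
have iw : leb.-integrable setT (EFin \o w).
  rewrite /comp; under eq_fun do rewrite /w EFinB.
  by apply: integrableB.
have [K HK] := sqr_normal_pdf_ub 0 s0.
have [v0 v0'] : v n%:R @[n --> \oo] --> (0 : R) /\ v (- n%:R) @[n --> \oo] --> (0 : R).
  apply: (@cvg_div_natr _ v 0 (normal_peak s + K)) => x.
  rewrite /v normrM (ger0_norm (p0 x)) subr0.
  apply: (@le_trans _ _ (p x * `|x|)).
    apply: ler_wpM2r => //; apply: ler_piMl => //.
    by rewrite ler_norml sin_geN1 sin_le1.
  apply: (@le_trans _ _ (p x * (1 + 1 * (x - 0) ^+ 2))).
    by apply: ler_wpM2l.
  rewrite mulrDr mulr1 mul1r; apply: lerD; first exact: normal_pdf_ub.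
  by rewrite mulrC.
have h := integral_derive_eq0 vw cw iw v0 v0'.
have : (\int[leb]_x w x = 0)%R by rewrite /Rintegral h.
rewrite /w RintegralB//.
rewrite (RintegralZl _ measurableT (int_cosp c t)) (RintegralZl _ measurableT (int_sinp c t)).
rewrite -/(F c t) => /eqP; rewrite subr_eq0 => /eqP h'.
by rewrite -mulrA h' mulVKf// gt_eqF.
Qed.

Let dF c (t : R) : is_derive t 1 (F c) (- (s ^+ 2 * t * F c t)).
Proof.
have d1 (u x : R) : is_derive u 1 (cosp c ^~ x) (- sinp c u x).
  have d1 : is_derive u 1 (fun y : R => y * x + c) x.
    by apply: is_derive_eq; rewrite /GRing.scale /=; ring.
  have d2 : is_derive u 1 (fun y : R => cos (y * x + c)) (- (x * sin (u * x + c))).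
    by apply: is_derive_eq; rewrite mulrC mulrN.
  rewrite /cosp; apply: is_derive_eq; rewrite /GRing.scale /= /sinp.
  by ring.
have pE u x : partial1of2 (cosp c) u x = - sinp c u x.
  by rewrite partial1of2E; exact: derive_val.
have Ia : `]t - 1, t + 1[%classic t by rewrite /= in_itv/= ltrBlDr !ltrDl ltr01.
have H1 x : `]t - 1, t + 1[%classic x -> leb.-integrable setT (EFin \o cosp c x).
  by move=> _; exact: int_cosp.
have H2 (x y : R) : `]t - 1, t + 1[%classic x -> [set: R] y -> derivable ((cosp c)^~ y) x 1.
  by move=> _ _; case: (d1 x y).
have H3 y : 0 <= `|y| * p y by rewrite mulr_ge0.
have H4 (x y : R) : `]t - 1, t + 1[%classic x -> [set: R] y ->
    `|partial1of2 (cosp c) x y| <= `|y| * p y.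
  by move=> _ _; rewrite pE normrN.
apply: DeriveDef.
  exact: (derivable_under_integral measurableT Ia H1 H2 H3 int_xp H4).
rewrite -derive1E (differentiation_under_integral measurableT Ia H1 H2 H3 int_xp H4).
rewrite -stein.
under eq_Rintegral do rewrite pE -mulN1r.
by rewrite (RintegralZl _ measurableT (int_sinp c t)) mulN1r.
Qed.

Lemma Rintegral_cos_normal_pdf c t :
  (\int[leb]_x (cos (t * x + c) * p x) = cos c * expR (- (s ^+ 2 * t ^+ 2 / 2)))%R.
Proof.
(* Integrating factor: [F' = - s ^+ 2 * t * F] makes [F c * E] constant, with value [cos c] at 0. *)
pose E (u : R) := expR (s ^+ 2 * u ^+ 2 / 2).
have dE (u : R) : is_derive u 1 E (s ^+ 2 * u * E u).
  have d1 : is_derive u 1 (fun y : R => s ^+ 2 / 2 * y ^+ 2) (s ^+ 2 * u).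
    by apply: is_derive_eq; rewrite /GRing.scale /= mulr1; field.
  have -> : E = (fun y => expR (s ^+ 2 / 2 * y ^+ 2)).
    by apply/funext => y; rewrite /E; congr expR; ring.
  by apply: is_derive_eq; rewrite mulrC.
have dFE (u : R) : is_derive u 1 (fun y => F c y * E y) 0.
  have d2 := dF c u.
  by apply: is_derive_eq; rewrite /GRing.scale /=; ring.
have := is_derive_0_is_cst t 0 dFE.
have -> : F c 0 * E 0 = cos c.
  rewrite /E expr0n/= mulr0 mul0r expR0 mulr1 /F /cosp.
  under eq_Rintegral do rewrite mul0r add0r.
  rewrite RintegralZl//; last exact: integrable_normal_pdf.
  by rewrite /Rintegral integral_normal_pdf mulr1.
by move=> <-; rewrite /E expRN mulfK// gt_eqF// expR_gt0.
Qed.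

Lemma integrable_cos_normal_pdf c t :
  leb.-integrable setT (fun x => (cos (t * x + c) * p x)%:E).
Proof. exact: int_cosp. Qed.

Lemma integral_cos_normal_pdf c t :
  (\int[leb]_x (cos (t * x + c) * p x)%:E =
   (cos c * expR (- (s ^+ 2 * t ^+ 2 / 2)))%:E)%E.
Proof.
rewrite -Rintegral_cos_normal_pdf /Rintegral fineK//.
exact: (integrable_fin_num measurableT (integrable_cos_normal_pdf c t)).
Qed.

End normal_cos.

(** * Fourier uniqueness and independence *)

Section fourier_uniqueness.
Context d (T : measurableType d) (R : realType) (P : probability T R).
Notation leb := (@lebesgue_measure R).

Lemma integrable_le_cst (f : T -> R) (M : R) : measurable_fun setT f ->
  (forall x, `|f x| <= M) -> P.-integrable setT (EFin \o f).
Proof.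
move=> mf fM; apply: measurable_bounded_integrable => //.
  exact: fin_num_fun_lty.
exists M; split => [|y My x _]; first exact: num_real.
exact: le_trans (fM x) (ltW My).
Qed.

(** Sets annihilated by the signed weight [W] form a Dynkin system: complements use that [W] has
    mean zero, disjoint unions use dominated convergence. *)
Lemma integral_dynkin d' (U : measurableType d') (G : set_system U)
    (W : T -> R) (M : R) (V : T -> U) :
  measurable_fun setT W -> (forall x, `|W x| <= M) -> measurable_fun setT V ->
  @measurable _ U = <<s G >> -> setI_closed G ->
  (\int[P]_x (W x)%:E = 0)%E ->
  (forall B, G B -> \int[P]_x (W x * \1_B (V x))%:E = 0)%E ->
  forall B, measurable B -> (\int[P]_x (W x * \1_B (V x))%:E = 0)%E.
Proof.
move=> mW WM mV mG GI W0 WG B; rewrite mG.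
have M0 : 0 <= M by rewrite (le_trans _ (WM point)).
have mWV A : measurable A -> measurable_fun setT (fun x => W x * \1_A (V x)).
  move=> mA; apply: measurable_funM => //.
  by apply: (measurableT_comp _ mV); exact: measurable_indic.
have bnd A x : `|W x * \1_A (V x)| <= M.
  rewrite normrM -[leRHS]mulr1; apply: ler_pM => //.
  by rewrite ger0_norm ?indicE ?ler0n// lern1 leq_b1.
have iWV A : measurable A -> P.-integrable setT (fun x => (W x * \1_A (V x))%:E).
  by move=> mA; apply: (@integrable_le_cst _ M) => //; exact: mWV.
have iW : P.-integrable setT (EFin \o W) by apply: integrable_le_cst WM.
move: B; apply: (@dynkin_induction _ U G) => //.
- by under eq_integral do rewrite indicT mulr1.
- move=> A mA A0.
  under eq_integral.
    move=> x _; rewrite (_ : _ * _ = W x - W x * \1_A (V x)); last first.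
      rewrite !indicE in_setC; case: (_ \in _) => /=.
        by rewrite mulr0 mulr1 subrr.
      by rewrite mulr0 mulr1 subr0.
    rewrite EFinB; over.
  by rewrite integralB//= ?W0 ?A0 ?sube0//; exact: iWV.
- move=> F mF tF F0.
  have : (\int[P]_x (\sum_(k < n) (W x * \1_(F k) (V x)))%:E)%E @[n --> \oo]
      --> (\int[P]_x (W x * \1_(\bigcup_k F k) (V x))%:E)%E.
    apply: (@dominated_cvg _ _ _ P setT measurableT
      (fun n x => (\sum_(k < n) (W x * \1_(F k) (V x)))%:E) _ (fun=> M%:E)) => //.
    + move=> n; apply/measurable_EFinP; apply: measurable_sum => k.
      exact: mWV.
    + move=> x _; apply: cvg_EFin; first exact: nearW.
      rewrite /comp/=.
      (* By disjointness at most one term is nonzero at [x], so the partial sums are eventually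
         constant. *)
      have [[k _ Fk]|nF] := pselect ((\bigcup_k F k) (V x)).
        apply: cvg_near_cst; exists k.+1 => // n /= kn.
        rewrite (bigD1 (Ordinal kn))//= big1 ?addr0; last first.
          move=> i ik; rewrite indicE memNset ?mulr0// => Fi.
          move/negP: ik; apply; apply/eqP/val_inj => /=.
          by apply: tF => //; exists (V x).
        by rewrite !indicE !mem_set//; exists k.
      apply: cvg_near_cst; apply: nearW => n.
      rewrite big1 ?indicE ?memNset ?mulr0// => i _.
      by rewrite indicE memNset ?mulr0// => Fi; apply: nF; exists i.
    + by apply: (@integrable_le_cst (fun=> M) M) => // x; rewrite ger0_norm.
    + move=> n x _; rewrite lee_fin -mulr_sumr.
      rewrite normrM -[leRHS]mulr1; apply: ler_pM => //.
      have [[k _ Fk]|nF] := pselect (exists2 k : 'I_n, True & F k (V x)).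
        rewrite (bigD1 k)//= big1 ?addr0; last first.
          move=> i ik; rewrite indicE memNset// => Fi.
          move/negP: ik; apply; apply/eqP/val_inj => /=.
          by apply: tF => //; exists (V x).
        by rewrite ger0_norm ?indicE ?ler0n// lern1 leq_b1.
      rewrite big1 ?normr0// => i _.
      by rewrite indicE memNset// => Fi; apply: nF; exists i.
  move=> h; apply: cvg_unique h _ => //.
  apply: cvg_near_cst; apply: nearW => n.
  under eq_integral do rewrite -sumEFin.
  rewrite integral_sum//; last by move=> k; exact: iWV.
  by rewrite big1.
Qed.

(** The kernel [q] has mass 1 in its second variable, so [M * q] is integrable for the product and
    [f] with it; the order of integration may then be exchanged. *)
Lemma Fubini_eq0 (f q : T * R -> R) (M : R) :
  measurable_fun setT f -> measurable_fun setT q -> (forall z, 0 <= q z) ->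
  (forall z, `|f z| <= M * q z) ->
  (forall x, \int[leb]_y (q (x, y))%:E = 1)%E ->
  (forall y, \int[P]_x (f (x, y))%:E = 0)%E ->
  (\int[P]_x \int[leb]_y (f (x, y))%:E = 0)%E.
Proof.
move=> mf mq q0 fq q1 f0.
have mEf : measurable_fun setT (EFin \o f) by exact/measurable_EFinP.
have fi : (P \x leb)%E.-integrable setT (EFin \o f).
  have qi : (P \x leb)%E.-integrable setT (EFin \o q).
    apply/integrable12ltyP; first exact/measurable_EFinP.
    under eq_integral.
      move=> x _; under eq_integral do rewrite /= ger0_norm//.
      rewrite q1; over.
    by rewrite integral_cst//= probability_setT mul1e ltry.
  have Mqi := integrableZl measurableT M qi.
  apply: le_integrable Mqi => //.
  move=> z _; rewrite /= lee_fin; apply: (le_trans (fq z)).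
  exact: ler_norm.
rewrite (Fubini fi) integral0_eq// => y _.
exact: f0.
Qed.

End fourier_uniqueness.

(** * A weight orthogonal to all cosines of [X] is orthogonal to all events of [X] *)

Section fourier1.
Context d (T : measurableType d) (R : realType) (P : probability T R).
Notation leb := (@lebesgue_measure R).
Variables (W X : T -> R) (M : R).
Hypotheses (mW : measurable_fun setT W) (mX : measurable_fun setT X).
Hypothesis WM : forall x, `|W x| <= M.
Hypothesis WX : forall b c, (\int[P]_x (W x * cos (b * X x + c))%:E = 0)%E.

Let M0 : 0 <= M. Proof. by rewrite (le_trans _ (WM point)). Qed.

Let normal_fourier (s m y : R) : 0 < s ->
  ((normal_pdf m s y)%:E =
  (normal_peak s)%:E * \int[leb]_b (cos ((m - y) * b + 0) * normal_pdf 0 s^-1 b)%:E)%E.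
Proof.
move=> s0; rewrite integral_cos_normal_pdf ?invr_gt0// cos0 mul1r -EFinM.
rewrite normal_pdfE ?gt_eqF// /normal_fun; congr (_ * expR _)%:E.
by field; rewrite gt_eqF.
Qed.

Let mcos2 (g : T -> R) (h k : R -> R) : measurable_fun setT g -> measurable_fun setT h ->
  measurable_fun setT k ->
  measurable_fun setT (fun z : T * R => cos (g z.1 * h z.2 + k z.2)).
Proof.
move=> mg mh mk; apply: measurableT_comp; first by apply: continuous_measurable_fun; exact: continuous_cos.
apply: measurable_funD; last by apply: measurableT_comp.
by apply: measurable_funM; apply: measurableT_comp.
Qed.

(* A Gaussian bump is a superposition of cosines, by the Fourier transform of the normal
   density. *)
Let fourier_bump (s y : R) : 0 < s ->
  (\int[P]_x (W x * normal_pdf (X x) s y)%:E = 0)%E.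
Proof.
move=> s0; have si0 : 0 < s^-1 by rewrite invr_gt0.
pose p := normal_pdf 0 s^-1.
have p0 b : 0 <= p b by exact: normal_pdf_ge0.
have mp : measurable_fun setT p by exact: measurable_normal_pdf.
have pk0 : 0 <= normal_peak s by exact: normal_peak_ge0.
pose f (z : T * R) := W z.1 * normal_peak s * (cos ((X z.1 - y) * z.2 + 0) * p z.2).
have mf : measurable_fun setT f.
  apply: measurable_funM.
    by apply: measurable_funM => //; exact: measurableT_comp.
  apply: measurable_funM; last exact: measurableT_comp.
  by apply: (@mcos2 (fun x => X x - y) id (cst 0)) => //; exact: measurable_funB.
transitivity (\int[P]_x \int[leb]_b (f (x, b))%:E)%E.
  apply: eq_integral => x _; rewrite /f /=.
  under [RHS]eq_integral do rewrite EFinM.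
  rewrite integralZl//; last exact: integrable_cos_normal_pdf.
  by rewrite EFinM normal_fourier// muleA -EFinM.
apply: (@Fubini_eq0 _ _ _ P f (p \o snd) (M * normal_peak s)) => //.
- exact: measurableT_comp.
- by move=> z; exact: p0.
- move=> [x b]; rewrite /f /= !normrM (ger0_norm pk0) (ger0_norm (p0 b)) mulrA.
  apply: ler_wpM2r => //; rewrite -[leRHS]mulr1; apply: ler_pM => //.
  + by rewrite mulr_ge0.
  + by apply: ler_wpM2r.
  + by rewrite ler_norml cos_geN1 cos_le1.
- by move=> x /=; rewrite integral_normal_pdf.
- move=> b; rewrite /f /=.
  under eq_integral.
    move=> x _.
    have -> : W x * normal_peak s * (cos ((X x - y) * b + 0) * p b) =
      normal_peak s * p b * (W x * cos (b * X x + - (b * y))).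
      have -> : (X x - y) * b + 0 = b * X x + - (b * y) by ring.
      by ring.
    rewrite EFinM; over.
  rewrite integralZl// ?WX ?mule0//.
  apply: (@integrable_le_cst _ _ _ _ _ M).
    apply: measurable_funM => //.
    apply: measurableT_comp; first by apply: continuous_measurable_fun; exact: continuous_cos.
    by apply: measurable_funD => //; exact: measurable_funM.
  move=> x; rewrite normrM -[leRHS]mulr1; apply: ler_pM => //.
  by rewrite ler_norml cos_geN1 cos_le1.
Qed.

Let measurable_npdf (s : R) : 0 < s ->
  measurable_fun setT (fun z : T * R => normal_pdf (X z.1) s z.2).
Proof.
move=> s0; rewrite (_ : (fun _ => _) = (fun z => normal_pdf 0 s (z.2 - X z.1))).
  apply: measurableT_comp; first exact: measurable_normal_pdf.
  by apply: measurable_funB => //; exact: measurableT_comp.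
apply/funext => z; rewrite !normal_pdfE ?gt_eqF// /normal_fun.
by rewrite subr0.
Qed.

(** Superposing the bumps with density [v] yields orthogonality to the normal smoothing of [v] at
    [X]. *)
Let fourier_smooth (s : R) (v : R -> R) : 0 < s -> measurable_fun setT v ->
  (forall y, 0 <= v y <= 1) ->
  (\int[P]_x \int[leb]_y (W x * v y * normal_pdf (X x) s y)%:E = 0)%E.
Proof.
move=> s0 mv v01.
pose f (z : T * R) := W z.1 * v z.2 * normal_pdf (X z.1) s z.2.
have mf : measurable_fun setT f.
  apply: measurable_funM; last exact: measurable_npdf.
  by apply: measurable_funM; exact: measurableT_comp.
apply: (@Fubini_eq0 _ _ _ P f (fun z => normal_pdf (X z.1) s z.2) M) => //.
- exact: measurable_npdf.
- by move=> z; exact: normal_pdf_ge0.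
- move=> [x y]; rewrite /f /= normrM (ger0_norm (normal_pdf_ge0 _ _ _)).
  apply: ler_wpM2r; first exact: normal_pdf_ge0.
  rewrite normrM -[leRHS]mulr1; apply: ler_pM => //.
  by rewrite ger0_norm; case/andP: (v01 y).
- by move=> x /=; rewrite integral_normal_pdf.
- move=> y; rewrite /f /=.
  under eq_integral do rewrite -mulrA mulrCA EFinM.
  rewrite integralZl// ?fourier_bump ?mule0//.
  apply: (@integrable_le_cst _ _ _ _ _ (M * normal_peak s)).
    apply: measurable_funM => //.
    rewrite (_ : (fun _ => _) = (fun z => normal_pdf 0 s (y - X z))).
      apply: measurableT_comp; first exact: measurable_normal_pdf.
      exact: measurable_funB.
    by apply/funext => z; rewrite !normal_pdfE ?gt_eqF// /normal_fun subr0.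
  move=> x; rewrite normrM; apply: ler_pM => //.
  rewrite ger0_norm; last exact: normal_pdf_ge0.
  by apply: normal_pdf_ub; rewrite gt_eqF.
Qed.

Let integrable_mul_npdf (s m : R) (v : R -> R) : measurable_fun setT v ->
  (forall y, 0 <= v y <= 1) -> leb.-integrable setT (fun y => (v y * normal_pdf m s y)%:E).
Proof.
move=> mv v01; apply: le_integrable (integrable_normal_pdf m s) => //.
  apply/measurable_EFinP; apply: measurable_funM => //.
  exact: measurable_normal_pdf.
move=> y _; rewrite lee_fin normrM; apply: ler_piMl => //.
by rewrite ger0_norm; case/andP: (v01 y).
Qed.

(** The inequality [|y - m| <= s / 2 + (y - m) ^+ 2 / (2 * s)] replaces the first absolute moment by
    the second, which is [s ^+ 2]. *)
Let normal_smooth (s m : R) (v : R -> R) (L : R) : 0 < s -> 0 <= L -> measurable_fun setT v ->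
  (forall y, 0 <= v y <= 1) -> (forall y, `|v y - v m| <= L * `|y - m|) ->
  `|\int[leb]_y (v y * normal_pdf m s y) - v m| <= L * s.
Proof.
move=> s0 L0 mv v01 vL.
have p0 y : 0 <= normal_pdf m s y by exact: normal_pdf_ge0.
have ip := integrable_normal_pdf m s.
have i2 := integrable_sqr_normal_pdf m s0.
have iv : leb.-integrable setT (EFin \o (fun y => v y * normal_pdf m s y)).
  exact: integrable_mul_npdf.
have iw : leb.-integrable setT (EFin \o (fun y => v m * normal_pdf m s y)).
  by rewrite /comp; under eq_fun do rewrite EFinM; exact: integrableZl.
have -> : v m = (\int[leb]_y (v m * normal_pdf m s y))%R.
  by rewrite RintegralZl// /Rintegral integral_normal_pdf mulr1.
rewrite -RintegralB//.
apply: (le_trans (le_normr_Rintegral _ _)) => //.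
  by rewrite /comp; under eq_fun do rewrite EFinB; exact: integrableB.
have ib : leb.-integrable setT (EFin \o (fun y => L * s / 2 * normal_pdf m s y +
    L / (2 * s) * ((y - m) ^+ 2 * normal_pdf m s y))).
  rewrite /comp; under eq_fun do rewrite EFinD !(EFinM (_ / _)).
  by apply: integrableD => //; exact: integrableZl.
apply: (@le_trans _ _ (\int[leb]_y (L * s / 2 * normal_pdf m s y +
    L / (2 * s) * ((y - m) ^+ 2 * normal_pdf m s y)))%R).
  apply: le_Rintegral => //.
    apply: (@integrable_norm _ _ _ leb setT (fun y => v y * normal_pdf m s y - v m * normal_pdf m s y)).
    by rewrite /comp; under eq_fun do rewrite EFinB; exact: integrableB.
  move=> y _; rewrite -mulrBl normrM (ger0_norm (p0 y)) mulrA -mulrDl.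
  apply: ler_wpM2r => //; apply: (le_trans (vL y)).
  have -> : L * s / 2 + L / (2 * s) * (y - m) ^+ 2 = L * (s / 2 + (y - m) ^+ 2 / (2 * s)).
    by field; rewrite gt_eqF.
  apply: ler_wpM2l => //; rewrite -(@real_normK _ (y - m)) ?num_real//.
  rewrite -subr_ge0.
  have -> : s / 2 + `|y - m| ^+ 2 / (2 * s) - `|y - m| = (`|y - m| - s) ^+ 2 / (2 * s).
    by field; rewrite gt_eqF.
  by rewrite divr_ge0 ?sqr_ge0// mulr_ge0// ltW.
rewrite RintegralD//; last 2 first.
- by rewrite /comp; under eq_fun do rewrite EFinM; exact: integrableZl.
- by rewrite /comp; under eq_fun do rewrite EFinM; exact: integrableZl.
rewrite RintegralZl// RintegralZl// /Rintegral integral_normal_pdf normal_second_moment//=.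
by rewrite le_eqVlt; apply/orP; left; apply/eqP; field; rewrite gt_eqF.
Qed.

Let fourier_lipschitz (v : R -> R) (L : R) : 0 <= L -> measurable_fun setT v ->
  (forall y, 0 <= v y <= 1) -> (forall y m, `|v y - v m| <= L * `|y - m|) ->
  (\int[P]_x (W x * v (X x))%:E = 0)%E.
Proof.
move=> L0 mv v01 vL.
have mvX : measurable_fun setT (fun x => W x * v (X x)).
  by apply: measurable_funM => //; exact: measurableT_comp.
have WvM x : `|W x * v (X x)| <= M.
  rewrite normrM -[leRHS]mulr1; apply: ler_pM => //.
  by rewrite ger0_norm; case/andP: (v01 (X x)).
have iWv : P.-integrable setT (EFin \o (fun x => W x * v (X x))).
  exact: integrable_le_cst WvM.
suff key s : 0 < s -> `|\int[P]_x (W x * v (X x))| <= M * (L * s).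
  have h : (\int[P]_x (W x * v (X x)) = 0)%R.
    apply/eqP; rewrite -normr_eq0 eq_le normr_ge0 andbT; apply/ler_addgt0Pl => e e0.
    rewrite addr0.
    have ML : 0 < M * L + 1 by rewrite ltr_wpDl// mulr_ge0.
    apply: (le_trans (key (e / (M * L + 1)) (divr_gt0 e0 ML))).
    rewrite mulrA mulrCA ler_piMr ?(ltW e0)//.
    by rewrite ler_pdivrMr// mul1r lerDl.
  by have := congr1 EFin h; rewrite /Rintegral fineK//; exact: integrable_fin_num iWv.
move=> s0.
pose S x := (\int[leb]_y (v y * normal_pdf (X x) s y))%R.
have mS : measurable_fun setT S.
  apply: measurableT_comp => //.
  apply: (@measurable_fun_fubini_tonelli_F _ _ _ _ _ leb
    (fun z : T * R => (v z.2 * normal_pdf (X z.1) s z.2)%:E)).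
    apply/measurable_EFinP; apply: measurable_funM; last exact: measurable_npdf.
    exact: measurableT_comp.
  move=> z; rewrite lee_fin mulr_ge0 ?normal_pdf_ge0//.
  by case/andP: (v01 z.2).
have SL x : `|S x - v (X x)| <= L * s by exact: normal_smooth.
have iWS : P.-integrable setT (EFin \o (fun x => W x * S x)).
  apply: (@integrable_le_cst _ _ _ _ _ (M * (1 + L * s))).
    exact: measurable_funM.
  move=> x; rewrite normrM; apply: ler_pM => //.
  rewrite -(subrK (v (X x)) (S x)) addrC (le_trans (ler_normD _ _))//.
  apply: lerD => //.
  by rewrite ger0_norm; case/andP: (v01 (X x)).
have WS0 : (\int[P]_x (W x * S x) = 0)%R.
  have := fourier_smooth s0 mv v01.
  under eq_integral => x _.
    under eq_integral do rewrite -mulrA EFinM.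
    rewrite integralZl//; last exact: integrable_mul_npdf.
    rewrite (_ : (_ * _)%E = (W x * S x)%:E); last first.
      rewrite EFinM /S /Rintegral fineK//.
      exact: (integrable_fin_num measurableT (integrable_mul_npdf s (X x) mv v01)).
    over.
  by rewrite /Rintegral => ->.
have -> : (\int[P]_x (W x * v (X x)) = \int[P]_x (W x * v (X x) - W x * S x))%R.
  by rewrite RintegralB// WS0 subr0.
apply: (le_trans (le_normr_Rintegral _ _)) => //.
  by rewrite /comp; under eq_fun do rewrite EFinB; exact: integrableB.
apply: (@le_trans _ _ (\int[P]_x (M * (L * s)))%R).
  apply: le_Rintegral => //.
  - apply: (@integrable_norm _ _ _ P setT (fun x => W x * v (X x) - W x * S x)).
    by rewrite /comp; under eq_fun do rewrite EFinB; exact: integrableB.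
  - by apply: (@integrable_le_cst _ _ _ _ _ `|M * (L * s)|).
  - move=> x _; rewrite -mulrBr normrM; apply: ler_pM => //.
    by rewrite distrC.
by rewrite /Rintegral integral_cst//= probability_setT mule1.
Qed.

(** The indicator of the open half-line is the limit of ramps [v n] of slope [n], which are
    Lipschitz with values in the unit interval. *)
Let fourier_itv (p : R) : (\int[P]_x (W x * \1_`]p, +oo[ (X x))%:E = 0)%E.
Proof.
pose v (n : nat) (y : R) := Num.min 1 (Num.max 0 (n%:R * (y - p))).
have v01 n y : 0 <= v n y <= 1.
  by rewrite /v le_min ler01 le_max lexx /= ge_min lexx.
have mv n : measurable_fun setT (v n).
  apply: measurable_minr => //; apply: measurable_maxr => //.
  by apply: measurable_funM => //; exact: measurable_funB.
have clip (a b : R) : `|Num.min 1 (Num.max 0 a) - Num.min 1 (Num.max 0 b)| <= `|a - b|.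
  have [h|h] := lerP 0 (a - b); [rewrite [leRHS]ger0_norm//|rewrite [leRHS]ltr0_norm//];
    case: (leP 0 a) => ha; case: (leP 0 b) => hb;
    case: (leP 1 a) => h1; case: (leP 1 b) => h2;
    rewrite ?[Num.min 1 0]min_r ?ler01 // ler_norml; lra.
have vL n y m : `|v n y - v n m| <= n%:R * `|y - m|.
  apply: (le_trans (clip _ _)).
  rewrite (_ : _ - _ = n%:R * (y - m)); last ring.
  by rewrite normrM ger0_norm.
have h0 n : (\int[P]_x (W x * v n (X x))%:E = 0)%E.
  by apply: (@fourier_lipschitz (v n) n%:R).
have h : (\int[P]_x (W x * v n (X x))%:E)%E @[n --> \oo] -->
    (\int[P]_x (W x * \1_`]p, +oo[ (X x))%:E)%E.
  apply: (@dominated_cvg _ _ _ P setT measurableT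
      (fun n x => (W x * v n (X x))%:E) _ (fun=> M%:E)) => //.
  - move=> n; apply/measurable_EFinP; apply: measurable_funM => //.
    exact: measurableT_comp.
  - move=> x _; apply: cvg_EFin; first exact: nearW.
    apply: cvg_near_cst; rewrite indicE.
    have [px|xp] := ltP p (X x); last first.
      apply: nearW => n /=; rewrite memNset /=; last by rewrite in_itv/= andbT; apply/negP; rewrite -leNgt.
      congr (_ * _); rewrite /v max_l ?min_r// mulr_ge0_le0// subr_le0//.
    exists (truncn (X x - p)^-1).+1 => // n /= hn.
    rewrite mem_set /=; last by rewrite in_itv/= px.
    congr (_ * _); rewrite /v max_r ?min_l//.
      rewrite -ler_pdivrMr ?subr_gt0// mul1r.
      apply: ltW; apply: (lt_le_trans (truncnS_gt _)).
      by rewrite ler_nat.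
    by rewrite mulr_ge0// subr_ge0 ltW.
  - by apply: (@integrable_le_cst _ _ _ _ (fun=> M) `|M|).
  - move=> n x _; rewrite lee_fin normrM -[leRHS]mulr1; apply: ler_pM => //.
    by rewrite ger0_norm; case/andP: (v01 n (X x)).
apply: cvg_unique h _ => //.
by apply: cvg_near_cst; apply: nearW => n; exact: h0.
Qed.

Lemma fourier_uniqueness (B : set R) : measurable B ->
  (\int[P]_x (W x * \1_B (X x))%:E = 0)%E.
Proof.
apply: (@integral_dynkin _ _ _ _ _ _ [set B | exists p : R, B = `]p, +oo[%classic] W M) => //.
- exact: RGenOInfty.measurableE.
- move=> A1 A2 [p ->] [q ->]; exists (Num.max p q).
  apply/seteqP; split => y /=; rewrite !in_itv/= !andbT gt_max; first by move=> [-> ->].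
  by move/andP.
- have := WX 0 0; under eq_integral do rewrite mul0r add0r cos0 mulr1.
  by [].
- by move=> A [p ->]; exact: fourier_itv.
Qed.

End fourier1.

Section fourier_vector.
Context d (T : measurableType d) (R : realType) (P : probability T R).

Let cosM (a b : R) : cos a * cos b = 2^-1 * cos (a + b) + 2^-1 * cos (a - b).
Proof. by rewrite cosD cosB; field. Qed.

Let measurable_cos_comp (f : T -> R) : measurable_fun setT f ->
  measurable_fun setT (fun x => cos (f x)).
Proof.
move=> mf; apply: measurableT_comp => //.
by apply: continuous_measurable_fun; exact: continuous_cos.
Qed.

Let cos_norm (a : R) : `|cos a| <= 1.
Proof. by rewrite ler_norml cos_geN1 cos_le1. Qed.

(** Induction on the number of variables, the weight absorbing the indicator of the last one; hence
    [W] is quantified after [X]. The new weight is orthogonal to cosines of the first [n] variables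
    by the one-variable result with weight [W] times such a cosine. *)
Lemma fourier_uniqueness_prod (n : nat) (X : nat -> T -> R) :
  (forall i, measurable_fun setT (X i)) ->
  forall (W : T -> R) (M : R), measurable_fun setT W -> (forall x, `|W x| <= M) ->
  (forall (b : nat -> R) c,
    \int[P]_x (W x * cos (\sum_(i < n) b i * X i x + c))%:E = 0)%E ->
  forall B : nat -> set R, (forall i, measurable (B i)) ->
  (\int[P]_x (W x * \prod_(i < n) \1_(B i) (X i x))%:E = 0)%E.
Proof.
move=> mX; elim: n => [|n IHn] W M mW WM WX B mB.
  have := WX (fun=> 0) 0.
  under eq_integral do rewrite big_ord0 addr0 cos0 mulr1.
  by under [in X in _ -> X]eq_integral do rewrite big_ord0 mulr1.
under eq_integral do rewrite big_ord_recr/= (mulrC (\prod_(_ < _) _)) mulrA.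
have m1 : measurable_fun setT (fun x => \1_(B n) (X n x) : R).
  by apply: measurableT_comp => //; exact: measurable_indic.
have M0 : 0 <= M by rewrite (le_trans _ (WM point)).
apply: (IHn _ M) => //.
- exact: measurable_funM.
- move=> x; rewrite normrM -[leRHS]mulr1; apply: ler_pM => //.
  by rewrite ger0_norm ?indicE ?ler0n// lern1 leq_b1.
- move=> b c; under eq_integral do rewrite mulrAC.
  have mS : measurable_fun setT (fun x => \sum_(i < n) b i * X i x + c).
    apply: measurable_funD => //; apply: measurable_sum => i.
    exact: measurable_funM.
  apply: (@fourier_uniqueness _ _ _ P _ (X n) M) => //.
  + by apply: measurable_funM => //; exact: measurable_cos_comp.
  + by move=> x; rewrite normrM -[leRHS]mulr1; apply: ler_pM.
  + move=> b' c'.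
    (* A product of two cosines is a half-sum of cosines of the sum and the difference; [s] is the
       sign 1 or -1 of the last coefficient. *)
    pose b2 (s : R) (i : nat) := if i == n then s * b' else b i.
    have b2E s x e : \sum_(i < n.+1) b2 s i * X i x + e =
        \sum_(i < n) b i * X i x + s * b' * X n x + e.
      rewrite big_ord_recr/= /b2 eqxx; congr (_ + _ + _).
      by apply: eq_bigr => i _; rewrite ltn_eqF.
    have ic s e : P.-integrable setT (fun x => (W x * cos (\sum_(i < n.+1) b2 s i * X i x + e))%:E).
      apply: (@integrable_le_cst _ _ _ _ _ M) => [|x].
        apply: measurable_funM => //; apply: measurable_cos_comp.
        apply: measurable_funD => //; apply: measurable_sum => i.
        exact: measurable_funM.
      by rewrite normrM -[leRHS]mulr1; apply: ler_pM.
    under eq_integral.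
      move=> x _; rewrite -mulrA cosM.
      have -> : \sum_(i < n) b i * X i x + c + (b' * X n x + c') =
        \sum_(i < n.+1) b2 1 i * X i x + (c + c') by rewrite b2E; ring.
      have -> : \sum_(i < n) b i * X i x + c - (b' * X n x + c') =
        \sum_(i < n.+1) b2 (-1) i * X i x + (c - c') by rewrite b2E; ring.
      rewrite mulrDr !(mulrCA (W x)) EFinD !(EFinM 2^-1); over.
    rewrite integralD//; [|exact: integrableZl|exact: integrableZl].
    by rewrite !integralZl// !WX !mule0 adde0.
Qed.

(** The generating one-coordinate cylinders are not closed under intersection, as the Dynkin
    argument demands; boxes are. *)
Lemma measurable_tuple_boxes n : @measurable _ (n.-tuple R) =
  <<s [set A | exists2 B : nat -> set R, (forall i, measurable (B i)) &
    A = [set t : n.-tuple R | forall i : 'I_n, B i (tnth t i)]] >>.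
Proof.
apply/seteqP; split.
  apply: sub_smallest2r; first exact: smallest_sigma_algebra.
  move=> A; rewrite -bigcup_seq /=.
  move=> [i _ [B mB <-]].
  exists (fun k : nat => if k == i then B else setT).
    by move=> k; case: ifP.
  apply/seteqP; split => t /=.
    move=> [_ Bt] j; case: ifP => // /eqP/val_inj ->; exact: Bt.
  by move=> /(_ i); rewrite eqxx.
apply: smallest_sub; first exact: sigma_algebra_measurable.
move=> _ [B mB ->].
rewrite (_ : [set t : n.-tuple R | _] = \bigcap_(i in [set: 'I_n]) ((@tnth n R) ^~ i @^-1` B i)).
  apply: fin_bigcap_measurable => // i _.
  rewrite -[X in measurable X]setTI; exact: measurable_tnth.
by apply/seteqP; split => t h i; [move=> _; exact: h|exact: (h i)].
Qed.

End fourier_vector.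

(** * Independence from a factorised characteristic function *)

Section independence.
Context d (T : measurableType d) (R : realType) (P : probability T R) (n : nat).
Variables (Z : T -> R) (V : T -> n.-tuple R).
Hypotheses (mZ : measurable_fun setT Z) (mV : measurable_fun setT V).
Variables (g : R -> R) (h : (nat -> R) -> R).
Hypothesis chE : forall a (b : nat -> R) c, (\int[P]_x
  (cos (a * Z x + \sum_(i < n) b i * tnth (V x) i + c))%:E = (cos c * g a * h b)%:E)%E.
Hypotheses (g0 : g 0 = 1) (h0 : h (fun=> 0) = 1) (gN : forall a, g (- a) = g a).

Let measurable_cos_comp (f : T -> R) : measurable_fun setT f ->
  measurable_fun setT (fun x => cos (f x)).
Proof.
move=> mf; apply: measurableT_comp => //.
by apply: continuous_measurable_fun; exact: continuous_cos.
Qed.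

Let cos_norm (a : R) : `|cos a| <= 1.
Proof. by rewrite ler_norml cos_geN1 cos_le1. Qed.

Let X (i : nat) (x : T) : R := nth 0 (V x) i.

Let tnthX x (i : 'I_n) : tnth (V x) i = X i x.
Proof. by rewrite (tnth_nth 0). Qed.

Let mX i : measurable_fun setT (X i).
Proof.
have [ni|ni] := ltnP i n.
  rewrite (_ : X i = fun x => tnth (V x) (Ordinal ni)).
    exact/(measurable_fun_tnthP _).1.
  by apply/funext => x; rewrite tnthX.
rewrite (_ : X i = cst 0)//; apply/funext => x.
by rewrite /X nth_default// size_tuple.
Qed.

Let chZ a c : (\int[P]_x (cos (a * Z x + c))%:E = (cos c * g a)%:E)%E.
Proof.
have := chE a (fun=> 0) c; rewrite h0 mulr1 => <-; apply: eq_integral => x _.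
by rewrite big1 ?addr0// => i _; rewrite mul0r.
Qed.

Let chX (b : nat -> R) c : (\int[P]_x (cos (\sum_(i < n) b i * X i x + c))%:E = (cos c * h b)%:E)%E.
Proof.
have := chE 0 b c; rewrite g0 mulr1 => <-; apply: eq_integral => x _.
rewrite mul0r add0r; congr (cos (_ + _))%:E.
by apply: eq_bigr => i _; rewrite tnthX.
Qed.

Let mlin a c : measurable_fun setT (fun x => a * Z x + c).
Proof. by apply: measurable_funD => //; exact: measurable_funM. Qed.

Let msum (b : nat -> R) c : measurable_fun setT (fun x => \sum_(i < n) b i * X i x + c).
Proof.
apply: measurable_funD => //; apply: measurable_sum => i.
exact: measurable_funM.
Qed.

Let icos (f : T -> R) (r : R) : measurable_fun setT f -> P.-integrable setT (fun x => (r * cos (f x))%:E).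
Proof.
move=> mf; apply: (@integrable_le_cst _ _ _ _ _ `|r|).
  by apply: measurable_funM => //; exact: measurable_cos_comp.
by move=> x; rewrite normrM ler_piMr.
Qed.

Let W1 a c x := cos (a * Z x + c) - cos c * g a.

(** The product of [cos (a * Z + c)] with a cosine in [V] has phases [c + c'] and [c' - c] and
    frequencies [a] and [- a]; evenness of [g] recombines the two integrals into [cos c * g a] times
    the integral of the cosine in [V]. *)
Let W1_tuple a c (C : set (n.-tuple R)) : measurable C ->
  (\int[P]_x (W1 a c x * \1_C (V x))%:E = 0)%E.
Proof.
pose M := 1 + `|cos c * g a|.
have mW : measurable_fun setT (W1 a c).
  by apply: measurable_funB => //; exact: measurable_cos_comp.
have WM x : `|W1 a c x| <= M by rewrite (le_trans (ler_normB _ _))// lerD2r.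
have WX (b : nat -> R) c' : (\int[P]_x (W1 a c x * cos (\sum_(i < n) b i * X i x + c'))%:E = 0)%E.
  pose f1 x := a * Z x + \sum_(i < n) b i * tnth (V x) i + (c + c').
  pose f2 x := - a * Z x + \sum_(i < n) b i * tnth (V x) i + (c' - c).
  have mf1 : measurable_fun setT f1.
    apply: measurable_funD => //; apply: measurable_funD; first exact: measurable_funM.
    under eq_fun do under eq_bigr do rewrite tnthX.
    by apply: measurable_sum => i; exact: measurable_funM.
  have mf2 : measurable_fun setT f2.
    apply: measurable_funD => //; apply: measurable_funD; first exact: measurable_funM.
    under eq_fun do under eq_bigr do rewrite tnthX.
    by apply: measurable_sum => i; exact: measurable_funM.
  under eq_integral.
    move=> x _.
    have -> : W1 a c x * cos (\sum_(i < n) b i * X i x + c') =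
      2^-1 * cos (f1 x) + 2^-1 * cos (f2 x) -
      (cos c * g a) * cos (\sum_(i < n) b i * X i x + c').
      rewrite /f1 /f2; under eq_bigr do rewrite -tnthX.
      set s := \sum_(i < n) _.
      have -> : a * Z x + s + (c + c') = (s + c') + (a * Z x + c) by ring.
      have -> : - a * Z x + s + (c' - c) = (s + c') - (a * Z x + c) by ring.
      rewrite /W1; move: (a * Z x + c) (s + c') => u v.
      by rewrite cosD cosB; field.
    rewrite EFinB EFinD; over.
  rewrite integralB//; [|by apply: integrableD => //; exact: icos|exact: icos].
  rewrite integralD//; [|exact: icos|exact: icos].
  under [X in (X + _ - _)%E]eq_integral do rewrite EFinM.
  under [X in (_ + X - _)%E]eq_integral do rewrite EFinM.
  under [X in (_ - X)%E]eq_integral do rewrite EFinM.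
  have ic f : measurable_fun setT f -> P.-integrable setT (fun x => (cos (f x))%:E).
    by move=> mf; have := icos 1 mf; apply: eq_integrable => // x _; rewrite mul1r.
  rewrite !integralZl//; [|exact: ic|exact: ic|exact: ic].
  rewrite chX (chE a b (c + c')) (chE (- a) b (c' - c)) gN.
  rewrite -!EFinM -!EFinD; congr EFin.
  by rewrite cosD cosB; field.
apply: (@integral_dynkin _ _ _ P _ _ _ (W1 a c) M V mW WM mV (measurable_tuple_boxes R n)).
- move=> _ _ [B1 mB1 ->] [B2 mB2 ->]; exists (fun i => B1 i `&` B2 i).
    by move=> i; exact: measurableI.
  apply/seteqP; split => t /=; first by move=> [h1 h2] i; split; [exact: h1|exact: h2].
  by move=> hh; split => i; case: (hh i).
- have := WX (fun=> 0) 0.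
  under eq_integral.
    move=> x _; rewrite big1; last by move=> i _; rewrite mul0r.
    rewrite add0r cos0 mulr1; over.
  by [].
- move=> _ [B mB ->].
  rewrite -[RHS](@fourier_uniqueness_prod _ _ _ P n X mX (W1 a c) M mW WM WX B mB).
  apply: eq_integral => x _; congr (_ * _)%:E.
  rewrite indicE; have [/set_mem/= hh|hh] := boolP (_ \in _).
    by rewrite big1// => i _; rewrite indicE mem_set// -tnthX; exact: hh.
  have [i Bi] : exists i : 'I_n, ~ B i (X i x).
    apply/existsNP => hB; move/negP: hh; apply; apply/mem_set => /= i.
    by rewrite tnthX; exact: hB.
  by rewrite (bigD1 i)//= indicE memNset// mul0r.
Qed.

(** Fourier uniqueness is used twice: in [V] with the centered weight [W1 a c], then in [Z] with the
    centered indicator of [V] in [C]. *)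
Lemma independent_cos (A : set R) (C : set (n.-tuple R)) :
  measurable A -> measurable C ->
  (P (Z @^-1` A `&` V @^-1` C) = P (Z @^-1` A) * P (V @^-1` C))%E.
Proof.
move=> mA mC.
have mVC : measurable (V @^-1` C) by rewrite -[X in measurable X]setTI; exact: mV.
have mZA : measurable (Z @^-1` A) by rewrite -[X in measurable X]setTI; exact: mZ.
pose p := fine (P (V @^-1` C)).
have pE : P (V @^-1` C) = p%:E by rewrite fineK// fin_num_measure.
have iC (D : set T) : measurable D -> (\int[P]_x (\1_D x)%:E = P D)%E.
  by move=> mD; rewrite integral_indic// setIT.
pose W x := \1_C (V x) - p.
have m1C : measurable_fun setT (fun x => \1_C (V x) : R).
  by apply: measurableT_comp => //; exact: measurable_indic.
have n1 (x : T) : `|\1_C (V x) : R| <= 1.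
  by rewrite ger0_norm ?indicE ?ler0n// lern1 leq_b1.
have mW : measurable_fun setT W by exact: measurable_funB.
have WM x : `|W x| <= 1 + `|p| by rewrite (le_trans (ler_normB _ _))// lerD2r.
have ic f : measurable_fun setT f -> P.-integrable setT (fun x => (cos (f x))%:E).
  by move=> mf; have := icos 1 mf; apply: eq_integrable => // x _; rewrite mul1r.
have i1 (f : T -> R) : measurable_fun setT f ->
    P.-integrable setT (fun x => (cos (f x) * \1_C (V x))%:E).
  move=> mf; apply: (@integrable_le_cst _ _ _ _ _ 1).
    by apply: measurable_funM => //; exact: measurable_cos_comp.
  by move=> x; rewrite normrM -[leRHS]mulr1; apply: ler_pM.
have iV : P.-integrable setT (fun x => (\1_C (V x) : R)%:E).
  exact: (@integrable_le_cst _ _ _ _ _ 1).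
have V1 : (\int[P]_x (\1_C (V x))%:E = p%:E)%E by rewrite -pE -iC.
have WZ b c : (\int[P]_x (W x * cos (b * Z x + c))%:E = 0)%E.
  have := W1_tuple b c mC.
  under eq_integral do rewrite /W1 mulrBl EFinB (EFinM (cos c * g b)).
  rewrite integralB//; [|exact: i1|exact: integrableZl].
  rewrite integralZl// V1 => h1.
  under eq_integral do rewrite /W mulrBl mulrC EFinB (EFinM p).
  rewrite integralB//; [|exact: i1|by apply: integrableZl => //; exact: ic].
  rewrite integralZl//; last exact: ic.
  by rewrite chZ; move: h1; rewrite -!EFinM (mulrC p).
have := fourier_uniqueness mW mZ WM WZ mA.
have iZ : P.-integrable setT (fun x => (\1_A (Z x) : R)%:E).
  apply: (@integrable_le_cst _ _ _ _ _ 1).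
    by apply: measurableT_comp => //; exact: measurable_indic.
  by move=> x; rewrite ger0_norm ?indicE ?ler0n// lern1 leq_b1.
under eq_integral.
  move=> x _.
  have -> : W x * \1_A (Z x) = \1_(Z @^-1` A `&` V @^-1` C) x - p * \1_(Z @^-1` A) x.
    by rewrite /W mulrBl mulrC indicI.
  rewrite EFinB EFinM; over.
have mI : measurable (Z @^-1` A `&` V @^-1` C) by exact: measurableI.
rewrite integralB//; last 2 first.
- exact: integrable_indic.
- by apply: integrableZl => //; exact: integrable_indic.
rewrite integralZl//.
rewrite !iC// pE.
have : P (Z @^-1` A `&` V @^-1` C) \is a fin_num by rewrite fin_num_measure.
have : P (Z @^-1` A) \is a fin_num by rewrite fin_num_measure.
case: (P (Z @^-1` A)) => // r _; case: (P _) => // q _.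
by rewrite -!EFinM -EFinB => -[] /eqP; rewrite subr_eq0 => /eqP ->; rewrite mulrC.
Qed.

End independence.

Section independent_sum.
Context d (T : measurableType d) (R : realType) (P : probability T R).
Context d' (U : measurableType d').
Variables (Z : T -> R) (V : T -> U).
Hypotheses (mZ : measurable_fun setT Z) (mV : measurable_fun setT V).
Hypothesis ZV : forall A C, measurable A -> measurable C ->
  (P (Z @^-1` A `&` V @^-1` C) = P (Z @^-1` A) * P (V @^-1` C))%E.
Hypothesis Zc : forall c, (\int[P]_x (Z x ^+ 2)%:E <= \int[P]_x ((Z x + c) ^+ 2)%:E)%E.

HB.instance Definition _ := isMeasurableFun.Build _ _ _ _ Z mZ.
HB.instance Definition _ := isMeasurableFun.Build _ _ _ _ V mV.
Let ZVf x := (Z x, V x).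
Let mZVf : measurable_fun setT ZVf.
Proof. exact: measurable_fun_pair. Qed.
HB.instance Definition _ := isMeasurableFun.Build _ _ _ _ ZVf mZVf.

(** The joint law agrees with the product law on rectangles, hence is equal to it; once [V] is
    fixed, [y] is a constant and [Zc] applies. The integrals take values in the extended reals, so
    [y] may fail to be square integrable. *)
Lemma le_integral_sqrD_indep (y : U -> R) : measurable_fun setT y ->
  (\int[P]_x (Z x ^+ 2)%:E <= \int[P]_x ((Z x + y (V x)) ^+ 2)%:E)%E.
Proof.
move=> my.
pose dZ := distribution P (Z : {mfun T >-> R}).
pose dV := distribution P (V : {mfun T >-> U}).
pose dJ := distribution P (ZVf : {mfun T >-> (R * U)%type}).
pose f (z : R * U) := ((z.1 + y z.2) ^+ 2)%:E.
have mf : measurable_fun setT f.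
  apply/measurable_EFinP; apply: measurable_funX.
  by apply: measurable_funD; last exact: measurableT_comp.
have f0 z : (0 <= f z)%E by rewrite lee_fin sqr_ge0.
have -> : (\int[P]_x ((Z x + y (V x)) ^+ 2)%:E = \int[dJ]_z f z)%E.
  by rewrite ge0_integral_distribution.
have -> : (\int[dJ]_z f z = \int[(dZ \x dV)%E]_z f z)%E.
  apply: eq_measure_integral => A mA _.
  apply/esym; apply: product_measure_unique; last exact: mA.
  move=> B C mB mC.
  exact: (ZV mB mC).
rewrite fubini_tonelli2//.
have h c : (\int[P]_x (Z x ^+ 2)%:E <= \int[dZ]_z ((z + c) ^+ 2)%:E)%E.
  rewrite ge0_integral_distribution.
  - exact: Zc.
  - by apply/measurable_EFinP; apply: measurable_funX; exact: measurable_funD.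
  - by move=> z; rewrite lee_fin sqr_ge0.
apply: (@le_trans _ _ (\int[dV]__ \int[P]_x (Z x ^+ 2)%:E)%E).
  rewrite integral_cst//= probability_setT mule1//.
apply: ge0_le_integral => //.
- by move=> _ _; apply: integral_ge0 => x _; rewrite lee_fin sqr_ge0.
- exact: measurable_fun_fubini_tonelli_G.
- by move=> u _; exact: (h (y u)).
Qed.

End independent_sum.

(** * Square integrable functions *)

Section square_integrable.
Context d (T : measurableType d) (R : realType) (m : {measure set T -> \bar R}).
Implicit Types f g h : T -> R.

Definition sqint f := measurable_fun setT f /\
  m.-integrable setT (EFin \o (fun x => f x ^+ 2)).

Definition ip f g := (\int[m]_x (f x * g x))%R.

Lemma integrable_mul f g : sqint f -> sqint g ->
  m.-integrable setT (EFin \o (fun x => f x * g x)).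
Proof.
move=> [mf f2] [mg g2].
have fg : m.-integrable setT (fun x => ((f x ^+ 2)%:E + (g x ^+ 2)%:E)%E).
  exact: integrableD.
apply: le_integrable fg => //.
  by apply/measurable_EFinP; exact: measurable_funM.
move=> x _; rewrite -EFinD lee_fin.
apply: le_trans (ler_norm _); rewrite -subr_ge0.
rewrite -(@real_normK _ (f x)) ?num_real// -(@real_normK _ (g x)) ?num_real// normrM.
have := sqr_ge0 (`|f x| - `|g x|); have := normr_ge0 (f x); have := normr_ge0 (g x).
by nra.
Qed.

Lemma sqint_ltP f : measurable_fun setT f ->
  (\int[m]_x (f x ^+ 2)%:E < +oo)%E -> sqint f.
Proof.
move=> mf foo; split => //; apply/integrableP; split.
  by apply/measurable_EFinP; exact: measurable_funX.
by under eq_integral do rewrite /= ger0_norm ?sqr_ge0//.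
Qed.

Lemma sqint0 : sqint (fun=> 0).
Proof.
split => //; rewrite (_ : EFin \o _ = cst 0%E); first exact: integrable0.
by apply/funext => x; rewrite /= expr0n.
Qed.

Lemma sqintZ c f : sqint f -> sqint (fun x => c * f x).
Proof.
move=> [mf f2]; split; first exact: measurable_funM.
rewrite /comp; under eq_fun do rewrite exprMn EFinM.
exact: integrableZl.
Qed.

Lemma sqintD f g : sqint f -> sqint g -> sqint (fun x => f x + g x).
Proof.
move=> sf sg; have [mf f2] := sf; have [mg g2] := sg.
split; first exact: measurable_funD.
have fg := integrable_mul sf sg.
rewrite /comp; under eq_fun do rewrite sqrrD mulr2n !EFinD.
by apply: integrableD => //; apply: integrableD => //; exact: integrableD.
Qed.

Lemma sqintB f g : sqint f -> sqint g -> sqint (fun x => f x - g x).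
Proof.
move=> sf sg.
rewrite (_ : (fun x => _) = (fun x => f x + (-1) * g x)); last first.
  by apply/funext => x; rewrite mulN1r.
by apply: sqintD => //; exact: sqintZ.
Qed.

Lemma sqint_sum n (F : nat -> T -> R) : (forall i, (i < n)%N -> sqint (F i)) ->
  sqint (fun x => \sum_(i < n) F i x).
Proof.
elim: n => [_|n IH HF].
  by under eq_fun do rewrite big_ord0; exact: sqint0.
under eq_fun do rewrite big_ord_recr/=.
by apply: sqintD; [apply: IH => i ni; apply: HF; exact: ltnW|exact: HF].
Qed.

Lemma ipC f g : ip f g = ip g f.
Proof. by apply: eq_Rintegral => x _; rewrite mulrC. Qed.

Lemma ipDl f g h : sqint f -> sqint g -> sqint h ->
  ip (fun x => f x + g x) h = ip f h + ip g h.
Proof.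
move=> sf sg sh; rewrite /ip -RintegralD//; try exact: integrable_mul.
by apply: eq_Rintegral => x _; rewrite mulrDl.
Qed.

Lemma ipZl c f h : sqint f -> sqint h -> ip (fun x => c * f x) h = c * ip f h.
Proof.
move=> sf sh; rewrite /ip -RintegralZl//; try exact: integrable_mul.
by apply: eq_Rintegral => x _; rewrite mulrA.
Qed.

Lemma ipBl f g h : sqint f -> sqint g -> sqint h ->
  ip (fun x => f x - g x) h = ip f h - ip g h.
Proof.
move=> sf sg sh; rewrite /ip -RintegralB//; try exact: integrable_mul.
by apply: eq_Rintegral => x _; rewrite mulrBl.
Qed.

Lemma ip_suml n (F : nat -> T -> R) h : (forall i, (i < n)%N -> sqint (F i)) -> sqint h ->
  ip (fun x => \sum_(i < n) F i x) h = \sum_(i < n) ip (F i) h.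
Proof.
move=> + sh; elim: n => [_|n IH HF].
  rewrite big_ord0 /ip; under eq_Rintegral do rewrite big_ord0 mul0r.
  by rewrite /Rintegral integral0.
rewrite big_ord_recr/= -IH; last by move=> i ni; apply: HF; exact: ltnW.
rewrite -ipDl//; last exact: HF.
  by apply: eq_Rintegral => x _; rewrite big_ord_recr.
by apply: sqint_sum => i ni; apply: HF; exact: ltnW.
Qed.

Lemma ipDr f g h : sqint f -> sqint g -> sqint h ->
  ip h (fun x => f x + g x) = ip h f + ip h g.
Proof. by move=> *; rewrite ipC ipDl// !(ipC h). Qed.

Lemma ipBr f g h : sqint f -> sqint g -> sqint h ->
  ip h (fun x => f x - g x) = ip h f - ip h g.
Proof. by move=> *; rewrite ipC ipBl// !(ipC h). Qed.

Lemma ipZr c f h : sqint f -> sqint h -> ip h (fun x => c * f x) = c * ip h f.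
Proof. by move=> *; rewrite ipC ipZl// (ipC h). Qed.

Lemma ip_sumr n (F : nat -> T -> R) h : (forall i, (i < n)%N -> sqint (F i)) -> sqint h ->
  ip h (fun x => \sum_(i < n) F i x) = \sum_(i < n) ip h (F i).
Proof.
by move=> *; rewrite ipC ip_suml//; apply: eq_bigr => i _; rewrite ipC.
Qed.

Lemma ip_ge0 f : 0 <= ip f f.
Proof. by apply: Rintegral_ge0 => x _; rewrite -expr2 sqr_ge0. Qed.

Lemma integral_sqr f : sqint f -> (\int[m]_x (f x ^+ 2)%:E)%E = (ip f f)%:E.
Proof.
move=> [mf f2]; rewrite /ip /Rintegral fineK; last exact: (integrable_fin_num measurableT f2).
by apply: eq_integral.
Qed.

(** Functions are not identified almost everywhere, so null functions are handled through [ip]. Here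
    the squared norm of [g + t * f] is affine in [t] and nonnegative, so its slope vanishes. *)
Lemma ip_eq0 f g : sqint f -> sqint g -> ip f f = 0 -> ip f g = 0.
Proof.
move=> sf sg f0.
have key t : 0 <= ip g g + 2 * t * ip f g.
  have := ip_ge0 (fun x => g x + t * f x).
  rewrite ipDl ?ipDr ?ipZl ?ipZr ?f0 ?(ipC g f)//; try (exact: sqintZ);
    try (exact: sqintD (sqintZ _ _)).
  by move=> h; apply: (le_trans h); rewrite le_eqVlt; apply/orP; left; apply/eqP; ring.
apply/eqP/negPn/negP => fg0.
(* This [t] makes the affine function equal to -1. *)
have := key (- (ip g g + 1) / (2 * ip f g)).
have -> : 2 * (- (ip g g + 1) / (2 * ip f g)) * ip f g = - (ip g g + 1) by field.
by rewrite opprD addNKr oppr_ge0 leNgt ltr01.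
Qed.

Definition orthonormal k (e : nat -> T -> R) :=
  (forall i, (i < k)%N -> sqint (e i)) /\
  (forall i j, (i < k)%N -> (j < k)%N -> ip (e i) (e j) = (i == j)%:R).

Definition orth_res k (e : nat -> T -> R) f x := f x - \sum_(j < k) ip f (e j) * e j x.

Lemma sqint_orth_res k e f : orthonormal k e -> sqint f -> sqint (orth_res k e f).
Proof.
move=> [se _] sf; apply: sqintB => //.
by apply: (@sqint_sum k (fun j x => ip f (e j) * e j x)) => i ik; apply: sqintZ; exact: se.
Qed.

Lemma ip_sum_orthonormal k e (a : nat -> R) j : orthonormal k e -> (j < k)%N ->
  ip (fun x => \sum_(i < k) a i * e i x) (e j) = a j.
Proof.
move=> [se oe] jk.
rewrite (@ip_suml k (fun i x => a i * e i x)) //; last 2 first.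
- by move=> i ik; apply: sqintZ; exact: se.
- exact: se.
rewrite (bigD1 (Ordinal jk))//= ipZl ?oe ?eqxx ?mulr1//; try exact: se.
rewrite big1 ?addr0// => i ij.
rewrite ipZl ?oe//; try exact: se.
by rewrite (negbTE (_ : (i : nat) != j)) ?mulr0.
Qed.

Lemma ip_orth_res k e f j : orthonormal k e -> sqint f -> (j < k)%N ->
  ip (orth_res k e f) (e j) = 0.
Proof.
move=> oe sf jk; have [se _] := oe.
rewrite ipBl//; last 2 first.
- by apply: (@sqint_sum k (fun j x => ip f (e j) * e j x)) => i ik; apply: sqintZ; exact: se.
- exact: se.
by rewrite (@ip_sum_orthonormal k e (fun j => ip f (e j)))// subrr.
Qed.

Lemma sqint_lincomb k e (a : nat -> R) : orthonormal k e ->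
  sqint (fun x => \sum_(i < k) a i * e i x).
Proof.
by move=> [se _]; apply: (@sqint_sum k (fun i x => a i * e i x)) => i ik; apply: sqintZ; exact: se.
Qed.

Lemma ip_lincomb_orth k e (a : nat -> R) g : orthonormal k e -> sqint g ->
  (forall j, (j < k)%N -> ip g (e j) = 0) ->
  ip g (fun x => \sum_(i < k) a i * e i x) = 0.
Proof.
move=> [se _] sg ge; rewrite (@ip_sumr k (fun i x => a i * e i x))//; last first.
  by move=> i ik; apply: sqintZ; exact: se.
rewrite big1// => i _; rewrite ipZr ?ge ?mulr0//; exact: se.
Qed.

Lemma ip_lincomb k e (a b : nat -> R) : orthonormal k e ->
  ip (fun x => \sum_(i < k) a i * e i x) (fun x => \sum_(i < k) b i * e i x) =
  \sum_(i < k) a i * b i.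
Proof.
move=> oe; have [se _] := oe; rewrite (@ip_sumr k (fun i x => b i * e i x))//; last 2 first.
- by move=> i ik; apply: sqintZ; exact: se.
- exact: sqint_lincomb.
apply: eq_bigr => i _; rewrite ipZr ?(ip_sum_orthonormal _ oe) 1?mulrC//; first exact: se.
exact: sqint_lincomb.
Qed.

Lemma pythagoras k e (a : nat -> R) g : orthonormal k e -> sqint g ->
  (forall j, (j < k)%N -> ip g (e j) = 0) ->
  ip (fun x => g x + \sum_(i < k) a i * e i x) (fun x => g x + \sum_(i < k) a i * e i x) =
  ip g g + \sum_(i < k) a i ^+ 2.
Proof.
move=> oe sg ge; have sl := sqint_lincomb a oe.
rewrite ipDl//; last exact: sqintD.
rewrite ipDr// [in X in _ + X]ipDr// (ipC _ g) (ip_lincomb_orth a oe sg ge) ip_lincomb//.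
by rewrite addr0 add0r.
Qed.

Lemma ip_orth_resl k e f r : orthonormal k e -> sqint f -> sqint r ->
  (forall j, (j < k)%N -> ip r (e j) = 0) -> ip (orth_res k e f) r = ip f r.
Proof.
move=> oe sf sr re.
rewrite ipBl//; last exact: (sqint_lincomb (fun j => ip f (e j))).
by rewrite [X in _ - X]ipC (ip_lincomb_orth (fun j => ip f (e j)) oe sr re) subr0.
Qed.

(** A residual of norm zero is dropped, which is why [k] may be less than [n]. The span clause is an
    identity at every point, so that zeros common to all [psi i] pass to [e]; the converse holds
    only up to null functions. *)
Lemma gram_schmidt n (psi : nat -> T -> R) : (forall i, (i < n)%N -> sqint (psi i)) ->
  exists k (e : nat -> T -> R), [/\ (k <= n)%N, orthonormal k e,
    (forall j, (j < k)%N -> exists c : nat -> R, forall x, e j x = \sum_(i < n) c i * psi i x) &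
    (forall i, (i < n)%N -> ip (orth_res k e (psi i)) (orth_res k e (psi i)) = 0)].
Proof.
elim: n => [_|n IH spsi].
  by exists 0%N, (fun _ _ => 0); split.
have [k [e [kn oe ec er]]] := IH (fun i ni => spsi i (ltnW ni)).
have [se oij] := oe.
have spn : sqint (psi n) by exact: spsi.
pose r := orth_res k e (psi n).
have sr : sqint r by exact: sqint_orth_res.
have ec' j : (j < k)%N -> exists c : nat -> R, forall x, e j x = \sum_(i < n.+1) c i * psi i x.
  move=> /ec[c cE]; exists (fun i => if i == n then 0 else c i) => x.
  rewrite big_ord_recr/= eqxx mul0r addr0 cE; apply: eq_bigr => i _.
  by rewrite ltn_eqF.
have [r0|r0] := eqVneq (ip r r) 0.
  exists k, e; split => //; first exact: leqW.
  by move=> i; rewrite ltnS leq_eqVlt => /predU1P[->//|]; exact: er.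
have r1 : 0 < ip r r by rewrite lt_neqAle eq_sym r0 ip_ge0.
pose s := (Num.sqrt (ip r r))^-1.
have s2 : s * s * ip r r = 1.
  by rewrite -expr2 exprVn sqr_sqrtr ?mulVf// ltW.
pose e' j := if j == k then (fun x => s * r x) else e j.
have re j : (j < k)%N -> ip r (e j) = 0 by move=> jk; exact: ip_orth_res.
have se' i : (i < k.+1)%N -> sqint (e' i).
  rewrite /e'; case: eqP => [_ _|/eqP ik]; first exact: sqintZ.
  by rewrite ltnS leq_eqVlt (negbTE ik) => /se.
have oe' : orthonormal k.+1 e'.
  split => // i j; rewrite /e' !ltnS.
  case: eqP => [->|/eqP ik]; case: eqP => [->|/eqP jk] //.
  - by rewrite eqxx ipZl ?ipZr ?mulrA ?s2//; exact: sqintZ.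
  - rewrite [(j <= k)%N]leq_eqVlt (negbTE jk) /= => _ jk'.
    by rewrite ipZl ?re ?mulr0 1?eq_sym ?(negbTE jk)//; exact: se.
  - rewrite [(i <= k)%N]leq_eqVlt (negbTE ik) /= => ik' _.
    by rewrite ipC ipZl ?re ?mulr0 ?(negbTE ik)//; exact: se.
  - rewrite [(j <= k)%N]leq_eqVlt (negbTE jk) [(i <= k)%N]leq_eqVlt (negbTE ik) /=.
    by move=> *; exact: oij.
have resE f : sqint f -> orth_res k.+1 e' f = fun x => orth_res k e f x - ip f r * (s ^+ 2 * r x).
  move=> sf; apply/funext => x; rewrite /orth_res big_ord_recr/=.
  rewrite (eq_bigr (fun i : 'I_k => ip f (e i) * e i x)); last first.
    by move=> i _; rewrite /e' ltn_eqF.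
  by rewrite /e' eqxx ipZr//; ring.
exists k.+1, e'; split => //.
- move=> j; rewrite ltnS /e'; case: eqP => [_ _|/eqP jk]; last first.
    by rewrite leq_eqVlt (negbTE jk); exact: ec'.
  have /choice[c cE] : forall j : nat, exists c : nat -> R, (j < k)%N -> forall x, e j x = \sum_(i < n.+1) c i * psi i x.
    move=> i; case: (ltnP i k) => [/ec'[c cE]|_]; last by exists (fun=> 0).
    by exists c.
  exists (fun i => s * ((i == n)%:R - \sum_(j < k) ip (psi n) (e j) * c j i)) => x.
  rewrite /r /orth_res.
  under [RHS]eq_bigr do rewrite -mulrA.
  rewrite -mulr_sumr; congr (_ * _).
  under [RHS]eq_bigr do rewrite mulrBl.
  rewrite sumrB; congr (_ - _).
    rewrite big_ord_recr/= eqxx mul1r big1 ?add0r// => i _.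
    by rewrite ltn_eqF ?mul0r.
  under [RHS]eq_bigr do rewrite mulr_suml.
  rewrite exchange_big/=; apply: eq_bigr => i _.
  rewrite (cE i (ltn_ord i)) mulr_sumr; apply: eq_bigr => l _.
  by rewrite mulrA.
- move=> i; rewrite ltnS leq_eqVlt => /predU1P[->|ni].
    rewrite resE//.
    have -> : ip (psi n) r = ip r r by rewrite {2}/r ip_orth_resl.
    rewrite (_ : (fun x => _) = (fun=> 0)).
      by rewrite /ip /Rintegral; under eq_integral do rewrite mul0r; rewrite integral0.
    apply/funext => x; rewrite -/r expr2.
    have -> : ip r r * (s * s * r x) = (s * s * ip r r) * r x by ring.
    by rewrite s2 mul1r subrr.
  rewrite resE; last by apply: spsi; rewrite ltnS ltnW.
  set q := orth_res k e (psi i).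
  have spi : sqint (psi i) by apply: spsi; rewrite ltnS ltnW.
  have sq : sqint q by exact: sqint_orth_res.
  have q0 : ip q q = 0 by exact: er.
  have -> : ip (psi i) r = 0.
    have qr : ip q r = 0 by exact: ip_eq0.
    by rewrite -(ip_orth_resl oe spi sr re).
  by under [in LHS]eq_fun do rewrite mul0r subr0.
Qed.

End square_integrable.

Lemma measurable_fine_integral d1 d2 (T1 : measurableType d1) (T2 : measurableType d2)
    (R : realType) (m : {sigma_finite_measure set T2 -> \bar R}) (f : T1 * T2 -> R) :
  measurable_fun setT f ->
  measurable_fun setT (fun x => fine (\int[m]_y (f (x, y))%:E)).
Proof.
move=> mf; apply: measurableT_comp => //.
under eq_fun do rewrite integralE.
have mEf : measurable_fun setT (EFin \o f) by exact/measurable_EFinP.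
apply: emeasurable_funB.
- under eq_fun do under eq_integral do rewrite funeposE.
  apply: (@measurable_fun_fubini_tonelli_F _ _ _ _ _ m (fun z => maxe (f z)%:E 0)).
    by have := measurable_funepos mEf; congr measurable_fun; apply/funext => z; rewrite funeposE.
  by move=> z; rewrite le_max lexx orbT.
- under eq_fun do under eq_integral do rewrite funenegE.
  apply: (@measurable_fun_fubini_tonelli_F _ _ _ _ _ m (fun z => maxe (- (f z)%:E) 0)%E).
    by have := measurable_funeneg mEf; congr measurable_fun; apply/funext => z; rewrite funenegE.
  by move=> z; rewrite le_max lexx orbT.
Qed.

(** * Prediction from Gaussian functionals *)

Section gaussian.
Context d (T : measurableType d) (R : realType) (P : probability T R).
Notation leb := (@lebesgue_measure R).

Definition gaussian_rv (L : T -> R) := measurable_fun setT L /\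
  exists s : R, 0 <= s /\ forall B : set R, measurable B ->
    P (L @^-1` B) = if s == 0 then \d_(0 : R) B else normal_prob 0 s B.

Let law (L : T -> R) (s : R) (f : R -> R) : 0 < s -> measurable_fun setT L ->
  (forall B : set R, measurable B -> P (L @^-1` B) = normal_prob 0 s B) ->
  measurable_fun setT f ->
  (forall x, 0 <= f x) \/ P.-integrable setT (EFin \o (f \o L)) ->
  (\int[P]_x (f (L x))%:E = \int[leb]_y (f y * normal_pdf 0 s y)%:E)%E.
Proof.
move=> s0 mL PL mf fi.
have mL' : @measurable_fun _ _ T (measurableTypeR R) setT L by exact: mL.
pose X : {mfun T >-> measurableTypeR R} := HB.pack_for {mfun T >-> measurableTypeR R} L (isMeasurableFun.Build _ _ T (measurableTypeR R) L mL').
have mEf : measurable_fun setT (EFin \o f) by exact/measurable_EFinP.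
transitivity (\int[distribution P X]_y (f y)%:E)%E.
  case: fi => [f0|fi]; apply/esym.
    by rewrite ge0_integral_distribution//= => y; rewrite lee_fin.
  by rewrite integral_distribution.
transitivity (\int[normal_prob 0 s]_y (f y)%:E)%E.
  apply: (@eq_measure_integral _ _ _ _ (normal_prob 0 s) (distribution P X)) => A mA _.
  exact: (PL A mA).
rewrite (@integral_density _ _ _ leb (normal_prob 0 s) (normal_pdf 0 s))//.
- by move=> y; exact: normal_pdf_ge0.
- exact: measurable_normal_pdf.
Qed.

(** The parameter [s] is eliminated in favour of [ip P L L], so that cosine integrals of linear
    combinations can be read off from inner products. *)
Let gaussian_cases L : gaussian_rv L ->
  [/\ sqint P L, ip P L (fun=> 1) = 0 &
    forall a c, (\int[P]_x (cos (a * L x + c))%:E =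
      (cos c * expR (- (ip P L L * a ^+ 2 / 2)))%:E)%E].
Proof.
move=> [mL [s [s0 PL]]].
have mcos (a c : R) : measurable_fun setT (fun y : R => cos (a * y + c)).
  apply: measurableT_comp; first by apply: continuous_measurable_fun; exact: continuous_cos.
  by apply: measurable_funD => //; exact: measurable_funM.
have msqr : measurable_fun setT (fun y : R => y ^+ 2) by exact: measurable_funX.
have [s00|sn0] := eqVneq s 0.
  have L0 : {ae P, forall x, L x = 0}.
    exists (L @^-1` (~` [set 0])); split.
    - by rewrite -[X in measurable X]setTI; apply: mL => //; exact: measurableC.
    - rewrite PL; last exact: measurableC.
      by rewrite s00 eqxx diracE memNset//= => h; exact: h.
    - by move=> x /=.
  have E (f : R -> R) : measurable_fun setT f -> (\int[P]_x (f (L x))%:E = (f 0)%:E)%E.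
    move=> mf; transitivity (\int[P]_x (cst (f 0)%:E x))%E.
      apply: ae_eq_integral => //.
      - by apply/measurable_EFinP; exact: measurableT_comp.
      - by apply: filterS L0 => x /= ->.
    by rewrite integral_cst//= probability_setT mule1.
  have sL : sqint P L.
    apply: sqint_ltP => //; by rewrite (E (fun y => y ^+ 2))// ltry.
  have LL : ip P L L = 0.
    have := integral_sqr sL; rewrite (E (fun y => y ^+ 2))//.
    by rewrite expr0n/= => -[].
  split => //.
    by rewrite /ip /Rintegral; under eq_integral do rewrite mulr1; rewrite (E id).
  move=> a c; rewrite (E (fun y => cos (a * y + c)))// LL !mul0r oppr0 expR0 mulr1.
  by rewrite mulr0 add0r.
have {}s0 : 0 < s by rewrite lt_neqAle eq_sym sn0.
have {}PL B : measurable B -> P (L @^-1` B) = normal_prob 0 s B.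
  by move=> mB; rewrite PL// (negbTE sn0).
have L2 : (\int[P]_x (L x ^+ 2)%:E = (s ^+ 2)%:E)%E.
  rewrite (law (f := fun y => y ^+ 2) s0 mL PL); [|exact: msqr|by left=> y; exact: sqr_ge0].
  rewrite -(normal_second_moment 0 s0); apply: eq_integral => y _.
  by rewrite subr0.
have sL : sqint P L by apply: sqint_ltP => //; rewrite L2 ltry.
have LL : ip P L L = s ^+ 2 by have := integral_sqr sL; rewrite L2 => -[].
have s1 : sqint P (fun=> 1).
  apply: sqint_ltP => //; under eq_integral do rewrite expr1n.
  by rewrite integral_cst//= probability_setT mul1e ltry.
split => //.
- rewrite /ip /Rintegral; under eq_integral do rewrite mulr1.
  rewrite (law (f := id) s0 mL PL)//; last first.
    right; have := integrable_mul sL s1; apply: eq_integrable => // x _ /=.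
    by rewrite mulr1.
  have := normal_mean 0 s0; under eq_integral do rewrite subr0.
  by move=> ->.
- move=> a c; rewrite LL.
  rewrite (law (f := fun y => cos (a * y + c)) s0 mL PL)//; last first.
    right; apply: (@integrable_le_cst _ _ _ _ _ 1).
      exact: measurableT_comp.
    by move=> x /=; rewrite ler_norml cos_geN1 cos_le1.
  exact: integral_cos_normal_pdf.
Qed.

Lemma gaussian_sqint L : gaussian_rv L -> sqint P L.
Proof. by move/gaussian_cases => []. Qed.

Lemma gaussian_mean L : gaussian_rv L -> ip P L (fun=> 1) = 0.
Proof. by move/gaussian_cases => []. Qed.

Lemma gaussian_cos L a c : gaussian_rv L -> (\int[P]_x (cos (a * L x + c))%:E =
  (cos c * expR (- (ip P L L * a ^+ 2 / 2)))%:E)%E.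
Proof. by move/gaussian_cases => [_ _]. Qed.

(* A joint Gaussian uncorrelated with L is independent of L, so adding a function of L
   can only increase the second moment. *)
Lemma gaussian_predictor n (Z : T -> R) (L : n.-tuple (T -> R)) (y : n.-tuple R -> R) :
  (forall a (b : nat -> R), gaussian_rv (fun x => a * Z x + \sum_(i < n) b i * tnth L i x)) ->
  (forall i, ip P Z (tnth L i) = 0) -> measurable_fun setT y ->
  (\int[P]_x (Z x ^+ 2)%:E <=
   \int[P]_x ((Z x + y (map_tuple (fun l => l x) L)) ^+ 2)%:E)%E.
Proof.
move=> G ZL my.
have gZ : gaussian_rv Z.
  have := G 1 (fun=> 0); congr gaussian_rv; apply/funext => x.
  by rewrite mul1r big1 ?addr0// => i _; rewrite mul0r.
have gL (b : nat -> R) : gaussian_rv (fun x => \sum_(i < n) b i * tnth L i x).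
  have := G 0 b; congr gaussian_rv; apply/funext => x.
  by rewrite mul0r add0r.
have gLi (i : 'I_n) : gaussian_rv (tnth L i).
  have := gL (fun j => (j == i)%:R); congr gaussian_rv; apply/funext => x.
  rewrite (bigD1 i)//= eqxx mul1r big1 ?addr0// => j ji.
  by rewrite (negbTE (_ : (j : nat) != i)) ?mul0r.
have sZ := gaussian_sqint gZ.
have [mZ _] := sZ.
pose V (x : T) := map_tuple (fun l : T -> R => l x) L.
have mV : measurable_fun setT V.
  apply/measurable_fun_tnthP => i.
  rewrite (_ : _ \o _ = tnth L i); first by case: (gLi i).
  by apply/funext => x; rewrite /= tnth_map.
(* [g] and [h] are the two factors of the joint characteristic function: for uncorrelated [Z] and
   [L] the variances of [a * Z] and of the combination of [L] add up in the exponent. *)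
pose h (b : nat -> R) := expR (- (ip P (fun x => \sum_(i < n) b i * tnth L i x)
  (fun x => \sum_(i < n) b i * tnth L i x) / 2)).
pose g (a : R) := expR (- (ip P Z Z * a ^+ 2 / 2)).
apply: (@le_integral_sqrD_indep _ _ _ P _ _ Z V mZ mV) => //; last first.
  move=> c; have s1 : sqint P (fun=> c).
    apply: sqint_ltP => //.
    by rewrite integral_cst//= probability_setT mule1 ltry.
  have s11 : sqint P (fun=> 1).
    apply: sqint_ltP => //; under eq_integral do rewrite expr1n.
    by rewrite integral_cst//= probability_setT mul1e ltry.
  rewrite !integral_sqr//; last exact: sqintD.
  have Z1 : ip P Z (fun=> c) = 0.
    rewrite (_ : (fun=> c) = (fun x : T => c * 1)); last by apply/funext => x; rewrite mulr1.
    by rewrite ipZr ?(gaussian_mean gZ) ?mulr0.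
  rewrite lee_fin ipDl//; last exact: sqintD.
  rewrite !ipDr// (ipC _ _ Z) Z1 addr0 add0r lerDl.
  exact: ip_ge0.
apply: (@independent_cos _ _ _ P n Z V mZ mV g h).
- move=> a b c.
  have := gaussian_cos 1 c (G a b).
  under eq_integral.
    move=> x _; rewrite mul1r.
    under eq_bigr do rewrite -(tnth_map (fun l : T -> R => l x)).
    over.
  move=> ->; rewrite expr1n mulr1 -mulrA -expRD; congr (_ * expR _)%:E.
  set S := fun x => \sum_(i < n) b i * tnth L i x.
  have sS : sqint P S by exact: gaussian_sqint (gL b).
  have ZS : ip P Z S = 0.
    pose F (i : nat) x := b i * nth (fun=> 0) L i x.
    have SE : S = fun x => \sum_(i < n) F i x.
      by apply/funext => x; apply: eq_bigr => i _; rewrite /F (tnth_nth (fun=> 0)).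
    rewrite SE ip_sumr//; last first.
      move=> i ni; apply: sqintZ; rewrite -(tnth_nth _ _ (Ordinal ni)).
      exact: gaussian_sqint (gLi _).
    rewrite big1// => i _; rewrite /F -tnth_nth ipZr ?ZL ?mulr0//.
    exact: gaussian_sqint (gLi _).
  rewrite ipDl//; [|exact: sqintZ|by apply: sqintD => //; exact: sqintZ].
  rewrite !ipDr//; try exact: sqintZ.
  rewrite !ipZl ?ipZr ?(ipC _ S Z) ?ZS//; try exact: sqintZ.
  by field.
- by rewrite /g expr0n/= mulr0 mul0r oppr0 expR0.
- rewrite /h /ip /Rintegral integral0_eq ?mul0r ?oppr0 ?expR0// => x _.
  by rewrite big1 ?mul0r// => i _; rewrite mul0r.
- by move=> a; rewrite /g sqrrN.
Qed.

End gaussian.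

(** * Lebesgue measure on tuples and joint measurability *)

Lemma sigma_finite_product d1 d2 (T1 : measurableType d1) (T2 : measurableType d2)
    (R : realType) (m1 : {sigma_finite_measure set T1 -> \bar R})
    (m2 : {sigma_finite_measure set T2 -> \bar R}) : sigma_finite setT (m1 \x m2)%E.
Proof.
have /sigma_finiteP[F [TF ndF Foo]] := sigma_finiteT m1.
have /sigma_finiteP[G [TG ndG Goo]] := sigma_finiteT m2.
exists (fun i => F i `*` G i).
  apply/esym; rewrite -subTset => -[x y] _.
  have [i _ Fx] : (\bigcup_i F i) x by rewrite -TF.
  have [j _ Gy] : (\bigcup_i G i) y by rewrite -TG.
  exists (maxn i j) => //; split.
  - by move: x Fx; exact/subsetPset/ndF/leq_maxl.
  - by move: y Gy; exact/subsetPset/ndG/leq_maxr.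
move=> i; have [mFi Fi] := Foo i; have [mGi Gi] := Goo i.
split; first exact: measurableX.
by rewrite product_measure1E// lte_mul_pinfty// ge0_fin_numE.
Qed.

Section sigma_finite_pushforward.
Context d1 d2 (X : measurableType d1) (Y : measurableType d2) (R : realType).
Variables (m : {measure set X -> \bar R}) (f : X -> Y) (g : Y -> X).
Hypothesis sm : sigma_finite setT m.
Hypotheses (mf : measurable_fun setT f) (mg : measurable_fun setT g).
Hypothesis fK : cancel f g.

Let pm : {measure set Y -> \bar R} :=
  measure_function_pushforward__canonical__measure_function_Measure m mf.

(** In general a pushforward loses sigma-finiteness. The left inverse [g] transports the exhausting
    sets to [Y], and their preimages under [f] are the original sets. *)
Lemma sigma_finite_pushforward : exists l : {sigma_finite_measure set Y -> \bar R},
  forall h : Y -> \bar R, measurable_fun setT h -> (forall y, 0 <= h y)%E ->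
    (\int[l]_y h y = \int[m]_x h (f x))%E.
Proof.
have sf : sigma_finite setT pm.
  have [A AT mA] := sm.
  exists (fun i => g @^-1` A i).
    by rewrite -preimage_bigcup -AT preimage_setT.
  move=> i; have [mAi Ai] := mA i; split.
    by rewrite -[X in measurable X]setTI; exact: mg.
  rewrite /pm /= /pushforward (_ : _ @^-1` _ = A i)//.
  by apply/seteqP; split => x /=; rewrite fK.
pose H1 := isSFinite.Build _ _ _ _ (sfinite_measure_sigma_finite sf).
pose H2 := isSigmaFinite.Build _ _ _ _ sf.
pose l := HB.pack_for (SigmaFiniteMeasure.type Y R) (Measure.sort pm) H1 H2.
exists l => h mh h0.
rewrite [LHS](_ : _ = \int[pushforward m f]_y h y)%E//.
rewrite ge0_integral_pushforward//.
Qed.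
End sigma_finite_pushforward.

Section lebesgue_tuple.
Context {R : realType}.

(** [intRn] is only an iterated integral; representing it by a sigma-finite measure makes Fubini,
    Tonelli and the inner product theory applicable. *)
Lemma intRn_measure n : exists l : {sigma_finite_measure set (n.-tuple R) -> \bar R},
  forall h : n.-tuple R -> \bar R, measurable_fun setT h -> (forall y, 0 <= h y)%E ->
    (\int[l]_y h y = intRn h)%E.
Proof.
elim: n => [|n [l lE]].
  exists (dirac [tuple] : {sigma_finite_measure set (0.-tuple R) -> \bar R}) => h mh h0.
  by rewrite integral_dirac// diracT mul1e.
pose f (p : measurableTypeR R * n.-tuple R) : n.+1.-tuple R := cons_tuple p.1 p.2.
pose g (t : n.+1.-tuple R) : measurableTypeR R * n.-tuple R := (thead t, [tuple of behead t]).
have mf : measurable_fun setT f.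
  exact: (@measurable_cons _ _ _ R fst n snd measurable_fst measurable_snd).
have mg : measurable_fun setT g.
  apply: measurable_fun_pair; last exact: measurable_behead.
  exact: (@measurable_tnth _ R).
have fK : cancel f g.
  by move=> [x t]; congr (_, _); apply/val_inj.
have [l' l'E] := @sigma_finite_pushforward _ _ _ _ R (@lebesgue_measure R \x l)%E f g
  (sigma_finite_product _ _) mf mg fK.
exists l' => h mh h0; rewrite l'E// fubini_tonelli1//=; last exact: measurableT_comp.
apply: eq_integral => x _; rewrite /fubini_F lE//.
by apply: measurableT_comp => //; exact: (measurableT_comp mf (measurable_pair1 _)).
Qed.

End lebesgue_tuple.

Section caratheodory.
Context {R : realType} (F : completeNormedModType R).

Lemma continuous_borel_measurable (L : F -> R) : continuous L ->
  measurable_fun [set: borel_type F] (L : borel_type F -> R).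
Proof.
move=> cL; apply: (@measurability _ _ _ _ _ _ (@RGenOInfty.G R)).
  exact: RGenOInfty.measurableE.
move=> _ [_ [x ->]] <-; rewrite setTI.
apply: sub_sigma_algebra; apply: open_comp; last exact: interval_open.
by move=> f _; exact: cL.
Qed.

Lemma separable_dense_seq : separable F ->
  exists s : nat -> F, forall (f : F) (r : R), 0 < r -> exists k, `|f - s k| < r.
Proof.
move=> [A [/countable_injP[i iA] AT]].
pose s n := xget (0 : F) [set x | A x /\ i x = n].
exists s => f r r0.
have : closure A f by rewrite AT.
move=> /(_ _ (nbhsx_ballx f r r0))[x [Ax fx]].
exists (i x); suff -> : s (i x) = x by move: fx; rewrite -ball_normE.
rewrite /s; case: xgetP => [y _ [Ay iy]|/(_ x)]; last by case; split.
by apply: iA => //; rewrite inE.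
Qed.

(** The map is a pointwise limit of maps that equal some [g (s j)] on each piece of a countable
    Borel partition of [F]. It serves for [emb], which is continuous in [f] but merely measurable in
    [x]. *)
Lemma caratheodory_measurable d (X : measurableType d) (g : F -> X -> R) :
  separable F -> (forall f, measurable_fun setT (g f)) ->
  (forall x, continuous (g ^~ x)) ->
  measurable_fun [set: (borel_type F * X)%type] (fun p => g p.1 p.2).
Proof.
move=> /separable_dense_seq[s sP] mg cg.
have ex n (f : F) : exists k, `|f - s k| < n.+1%:R^-1 by apply: sP.
pose k n f := ex_minn (ex n f).
(* [f] is replaced by the first dense point at distance less than [1 / (n + 1)]. *)
pose h n (p : borel_type F * X) := g (s (k n p.1)) p.2.
have mball n j : measurable [set f : borel_type F | `|(f : F) - s j| < n.+1%:R^-1].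
  apply: sub_sigma_algebra.
  have -> : [set f : F | `|f - s j| < n.+1%:R^-1] = ball (s j) n.+1%:R^-1.
    by rewrite -ball_normE; apply/seteqP; split => f /=; rewrite distrC.
  exact: ball_open.
have kE n j : [set f : borel_type F | k n f = j] =
    [set f : borel_type F | `|(f : F) - s j| < n.+1%:R^-1] `\`
    \bigcup_(i in [set i | (i < j)%N]) [set f : borel_type F | `|(f : F) - s i| < n.+1%:R^-1].
  apply/seteqP; split => f /=; rewrite /k; case: ex_minnP => m fm mP.
    move=> mj; rewrite -mj; split => // -[i /= im] /mP.
    by rewrite leqNgt im.
  move=> [fj nj]; apply/eqP; rewrite eqn_leq mP//= leqNgt; apply/negP => mj.
  by apply: nj; exists m.
apply: (@measurable_fun_cvg _ _ _ _ h).
  move=> n _ B mB; rewrite setTI.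
  rewrite (_ : _ @^-1` _ = \bigcup_j ([set f : borel_type F | k n f = j] `*` (g (s j) @^-1` B))).
    apply: bigcup_measurable => j _; apply: measurableX.
      by rewrite kE; apply: measurableD => //; apply: bigcup_measurable.
    by rewrite -[X in measurable X]setTI; exact: mg.
  apply/seteqP; split => -[f x] /=; first by exists (k n f).
  by rewrite /h /= => -[j _ []] /= ->.
move=> [f x] _ /=.
suff : s (k n f) @[n --> \oo] --> f by move=> /(cvg_comp _ _) /(_ (cg x f)).
apply/cvgrPdist_lt => e e0; near=> n.
rewrite /k; case: ex_minnP => m fm _; apply: lt_trans fm _.
by near: n; exact: near_infty_natSinv_lt (PosNum e0).
Unshelve. all: by end_near.
Qed.

End caratheodory.

(** * Sampling by deflation and relaxed Kaczmarz steps *)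

Section dot.
Context (R : realType) (k : nat).
Implicit Types u v w : 'cV[R]_k.

Definition dot u v := \sum_i u i 0 * v i 0.

Lemma dotE u v : (u^T *m v) 0 0 = dot u v.
Proof. by rewrite mxE; apply: eq_bigr => i _; rewrite mxE. Qed.

Lemma dotC u v : dot u v = dot v u.
Proof. by apply: eq_bigr => i _; rewrite mulrC. Qed.

Lemma dotDl u v w : dot (u + v) w = dot u w + dot v w.
Proof. by rewrite -big_split/=; apply: eq_bigr => i _; rewrite mxE mulrDl. Qed.

Lemma dotZl a u w : dot (a *: u) w = a * dot u w.
Proof. by rewrite mulr_sumr; apply: eq_bigr => i _; rewrite mxE mulrA. Qed.

Lemma dotBl u v w : dot (u - v) w = dot u w - dot v w.
Proof. by rewrite -scaleN1r dotDl dotZl mulN1r. Qed.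

Lemma dotZr a u w : dot w (a *: u) = a * dot w u.
Proof. by rewrite dotC dotZl (dotC w). Qed.

Lemma dotBr u v w : dot w (u - v) = dot w u - dot w v.
Proof. by rewrite dotC dotBl !(dotC w). Qed.

Lemma dot_ge0 u : 0 <= dot u u.
Proof. by apply: sumr_ge0 => i _; rewrite -expr2 sqr_ge0. Qed.

Lemma dot_subZ u v s :
  dot (u - s *: v) (u - s *: v) = dot u u - 2 * s * dot u v + s ^+ 2 * dot v v.
Proof. by rewrite !(dotBl, dotBr, dotZl, dotZr) (dotC v u); ring. Qed.

Lemma dotM (Q : 'M[R]_k) u v : dot (Q *m u) v = dot u (Q^T *m v).
Proof. by rewrite -!dotE trmx_mul mulmxA. Qed.

Lemma dot_CS u v : dot u v ^+ 2 <= dot u u * dot v v.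
Proof.
have [v0|v0] := eqVneq (dot v v) 0.
  have h : v = 0.
    apply/colP => i; apply/eqP; rewrite mxE.
    move/eqP: v0; rewrite psumr_eq0; last by move=> j _; rewrite -expr2 sqr_ge0.
    by move/allP => /(_ i); rewrite mem_index_enum /= mulf_eq0 orbb => /(_ isT).
  by rewrite v0 mulr0 h dotC /dot big1 ?expr0n// => i _; rewrite mxE mul0r.
have vp : 0 < dot v v by rewrite lt_neqAle eq_sym v0 dot_ge0.
have := dot_ge0 (dot v v *: u - dot u v *: v).
rewrite dotBl !dotBr !dotZl !dotZr (dotC v u) => h.
rewrite -subr_ge0 -(pmulr_rge0 _ vp); apply: le_trans h _.
by rewrite le_eqVlt; apply/orP; left; apply/eqP; ring.
Qed.

Definition sym_idem (Q : 'M[R]_k) := Q^T = Q /\ Q *m Q = Q.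

(** For an orthogonal projection the trace is the sum of the squares of the entries. *)
Lemma sym_idem_tr0 Q : sym_idem Q -> \tr Q = 0 -> Q = 0.
Proof.
move=> [QT QQ] trQ; apply/matrixP => i j; rewrite mxE.
have : \sum_i \sum_j Q i j ^+ 2 = 0.
  rewrite -[RHS]trQ -[in RHS]QQ /mxtrace; apply: eq_bigr => a _.
  rewrite mxE; apply: eq_bigr => b _; rewrite expr2; congr (_ * _).
  by rewrite -[in LHS]QT mxE.
move/eqP; rewrite psumr_eq0; last first.
  by move=> a _; apply: sumr_ge0 => b _; rewrite sqr_ge0.
move/allP => /(_ i); rewrite mem_index_enum /= => /(_ isT).
rewrite psumr_eq0; last by move=> b _; rewrite sqr_ge0.
move/allP => /(_ j); rewrite mem_index_enum /= => /(_ isT).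
by rewrite sqrf_eq0 => /eqP.
Qed.

(** For a projection [Q], the projection onto the part of its range orthogonal to [Q *m u]; the
    scalar is the inverse squared norm of [Q *m u]. *)
Definition deflate Q u := Q - (dot u (Q *m u))^-1 *: ((Q *m u) *m (Q *m u)^T).

Lemma dot_sym_idem Q u : sym_idem Q -> dot u (Q *m u) = dot (Q *m u) (Q *m u).
Proof. by move=> [QT QQ]; rewrite [RHS]dotM QT mulmxA QQ. Qed.

Let qTq Q u : sym_idem Q -> (Q *m u)^T *m (Q *m u) = (dot u (Q *m u))%:M.
Proof.
move=> sQ; rewrite dot_sym_idem//; apply/matrixP => i j.
by rewrite !ord1 dotE mxE eqxx mulr1n.
Qed.

Lemma deflate_sym_idem Q u : sym_idem Q -> dot u (Q *m u) != 0 ->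
  sym_idem (deflate Q u).
Proof.
move=> sQ K0; have [QT QQ] := sQ; rewrite /deflate.
have Tq : (Q *m u)^T *m Q = (Q *m u)^T.
  by rewrite trmx_mul QT -mulmxA QQ.
have Qq : Q *m (Q *m u) = Q *m u by rewrite mulmxA QQ.
move: (Q *m u) K0 (qTq u sQ) Tq Qq => q.
set K := dot u q => K0 qq Tq Qq.
split; first by rewrite linearB/= linearZ/= trmx_mul trmxK QT.
rewrite mulmxBl mulmxBr QQ -scalemxAr mulmxA Qq -scalemxAl mulmxBr.
rewrite -mulmxA Tq -scalemxAr mulmxA -(mulmxA q) qq mul_mx_scalar -scalemxAl.
by rewrite (scalerA K^-1 K) mulVf// scale1r subrr scaler0 subr0.
Qed.

Lemma tr_deflate Q u : sym_idem Q -> dot u (Q *m u) != 0 ->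
  \tr (deflate Q u) = \tr Q - 1.
Proof.
move=> sQ K0; rewrite /deflate linearB/= linearZ/= mxtrace_mulC qTq//.
by rewrite mxtrace_scalar mulr1n mulVf.
Qed.

(** Here [w] is the coefficient error and [g] the residual at the sample point. The step along
    [Q *m u] is such that the component of [w] in the range of [Q], over which there is no control,
    cancels: [z'] is [z - K^-1 * (g + dot z u) *: (Q *m u)]. Since [Q *m u] is orthogonal to [z],
    the squares add. *)
Lemma deflate_step Q u w (g : R) : sym_idem Q -> dot u (Q *m u) != 0 ->
  let K := dot u (Q *m u) in
  let z := w - Q *m w in
  let w' := w - (K^-1 * (g + dot w u)) *: (Q *m u) in
  let z' := w' - deflate Q u *m w' in
  dot z' z' = dot z z + K^-1 * (g + dot z u) ^+ 2.
Proof.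
move=> sQ K0 K z w' z'; have [QT QQ] := sQ.
have KE : dot (Q *m u) (Q *m u) = K by rewrite -dot_sym_idem.
have Qz : Q *m z = 0 by rewrite mulmxBr mulmxA QQ subrr.
have z'E : z' = z - (K^-1 * (g + dot z u)) *: (Q *m u).
  have Qq : Q *m (Q *m u) = Q *m u by rewrite mulmxA QQ.
  have qv v : (Q *m u)^T *m v = (dot (Q *m u) v)%:M.
    by apply/matrixP => i j; rewrite !ord1 dotE mxE eqxx mulr1n.
  have qw' : dot (Q *m u) w' = - (g + dot z u).
    rewrite /w' dotBr dotZr KE mulrAC mulVf// mul1r.
    by rewrite /z dotBl dotM QT (dotC u) ; ring.
  rewrite /z' /deflate -/K mulmxBl -scalemxAl -(mulmxA (Q *m u)) qv mul_mx_scalar qw'.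
  rewrite {1 2}/w' mulmxBr -scalemxAr Qq /z scalerA.
  move: (K^-1 * (g + dot w u) *: (Q *m u)) => y.
  rewrite mulrN scaleNr.
  move: (K^-1 * _ *: _) => t.
  by move: (Q *m w) => s; apply/colP => i; rewrite !mxE; ring.
have zq : dot z (Q *m u) = 0.
  by rewrite dotC dotM QT Qz /dot big1// => i _; rewrite mxE mulr0.
by rewrite z'E dot_subZ KE zq; field.
Qed.

End dot.

(** * Existence of a point not worse than the average *)

Section select.
Context d (T : measurableType d) (R : realType) (m : {measure set T -> \bar R}).

(** Otherwise [J] exceeds [D = K * (tot / kappa)] strictly wherever [K > 0]. As [D] has integral
    [tot], the two agree almost everywhere, so [K] vanishes almost everywhere, against
    [0 < kappa]. *)
Lemma le_average (J : T -> \bar R) (K : T -> R) (kappa tot : R) :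
  measurable_fun setT J -> (forall x, 0 <= J x)%E ->
  measurable_fun setT K -> (forall x, 0 <= K x) ->
  (\int[m]_x (K x)%:E = kappa%:E)%E -> 0 < kappa ->
  (\int[m]_x J x <= tot%:E)%E ->
  exists2 x, 0 < K x & (J x <= (K x * (tot / kappa))%:E)%E.
Proof.
move=> mJ J0 mK K0 Kk k0 Jt; apply/not_exists2P => nex.
have tot0 : 0 <= tot by rewrite -lee_fin; apply: le_trans Jt; exact: integral_ge0.
pose D x := (K x * (tot / kappa))%:E.
have D0 x : (0 <= D x)%E by rewrite lee_fin mulr_ge0// divr_ge0// ltW.
have mD : measurable_fun setT D by apply/measurable_EFinP; exact: measurable_funM.
have ID : (\int[m]_x D x = tot%:E)%E.
  rewrite /D; under eq_integral do rewrite mulrC EFinM.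
  rewrite ge0_integralZl//.
  - by rewrite Kk -EFinM divfK ?gt_eqF.
  - exact/measurable_EFinP.
  - by move=> x _; rewrite lee_fin.
  - by rewrite lee_fin divr_ge0// ltW.
have DJ x : (D x <= J x)%E.
  have [K0x|] := ltP 0 (K x); first by case: (nex x) => // /negP; rewrite -ltNge => /ltW.
  by move=> Kx; rewrite /D (_ : K x = 0) ?mul0r//; apply/eqP; rewrite eq_le Kx K0.
have iD : m.-integrable setT D.
  apply/integrableP; split => //.
  by under eq_integral do rewrite gee0_abs//; rewrite ID ltry.
have iJ : m.-integrable setT J.
  apply/integrableP; split => //; under eq_integral do rewrite gee0_abs//.
  exact: le_lt_trans Jt (ltry _).
have JD0 : (\int[m]_x (J x - D x) = 0)%E.
  apply/eqP; rewrite eq_le; apply/andP; split.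
    rewrite integralB// ID.
    have := integrable_fin_num measurableT iJ.
    move: Jt; case: (\int[m]_x J x)%E => // r; rewrite lee_fin => rt _.
    by rewrite -EFinB lee_fin subr_le0.
  by apply: integral_ge0 => x _; rewrite sube_ge0.
have mJD : measurable_fun setT (fun x => (J x - D x)%E) by exact: emeasurable_funB.
have : ae_eq m setT (fun x => (J x - D x)%E) (cst 0%E).
  apply/ae_eq_integral_abs => //.
  rewrite -[RHS]JD0; apply: eq_integral => x _.
  by rewrite gee0_abs// sube_ge0.
move=> aeJD.
have : (\int[m]_x (K x)%:E = \int[m]_x cst 0 x)%E.
  apply: ae_eq_integral => //; first exact/measurable_EFinP.
  apply: filterS aeJD => x /= /(_ I) JDx _.
  have [K0x|Kx] := ltP 0 (K x); last by congr EFin; apply/eqP; rewrite eq_le Kx K0.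
  case: (nex x) => // /negP; rewrite -ltNge -/(D x) => DJx.
  by have : (0 < J x - D x)%E; [rewrite sube_gt0|rewrite /D JDx ltxx].
rewrite Kk integral0 => -[] k00.
by rewrite k00 ltxx in k0.
Qed.

End select.

Section sampling.
Context d1 d2 (U : measurableType d1) (T : measurableType d2) (R : realType).
Variables (P : probability U R) (lam : {sigma_finite_measure set T -> \bar R}).
Variable F : U * T -> R.
Hypothesis mF : measurable_fun setT F.
Hypothesis sF : forall w, sqint lam (fun x => F (w, x)).
Variables (k : nat) (e : nat -> T -> R).
Hypothesis oe : orthonormal lam k e.

Let se i : (i < k)%N -> sqint lam (e i). Proof. by case: oe => h _; exact: h. Qed.
Let me i : (i < k)%N -> measurable_fun setT (e i). Proof. by move/se => []. Qed.

Definition evec (x : T) : 'cV[R]_k := \col_i e i x.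
Definition cvec (w : U) : 'cV[R]_k := \col_i ip lam (fun x => F (w, x)) (e i).
Definition gres (w : U) (x : T) : R := orth_res lam k e (fun x => F (w, x)) x.

(* The direction [v] need not be a multiple of [evec x]: the deflation phase steps along
   [Q *m evec x]. *)
Inductive kaczmarz : nat -> (U -> 'cV[R]_k) -> Prop :=
| kaczmarz0 : kaczmarz 0 (fun=> 0)
| kaczmarzS n a x v : dot (evec x) (evec x) != 0 -> kaczmarz n a ->
    kaczmarz n.+1 (fun w => a w + (F (w, x) - dot (a w) (evec x)) *: v).

Definition mvec d (V : measurableType d) (a : V -> 'cV[R]_k) :=
  forall i, measurable_fun setT (fun w => a w i 0).

Let measurable_dot d (V : measurableType d) (a b : V -> 'cV[R]_k) : mvec a -> mvec b ->
  measurable_fun setT (fun w => dot (a w) (b w)).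
Proof.
move=> ma mb; rewrite /dot; apply: measurable_sum => i.
by apply: measurable_funM; [exact: ma|exact: mb].
Qed.

Let mevec : mvec evec.
Proof. by move=> i; under eq_fun do rewrite mxE; exact: me. Qed.

Let mF1 x : measurable_fun setT (fun w => F (w, x)).
Proof. exact: (measurableT_comp mF (measurable_pair2 x)). Qed.

Let mcvec : mvec cvec.
Proof.
move=> i; under eq_fun do rewrite mxE.
apply: (@measurable_fine_integral _ _ _ _ _ lam (fun z => F z * e i z.2)).
by apply: measurable_funM => //; apply: measurableT_comp => //; exact: me.
Qed.

Lemma mvec_kaczmarz n a : kaczmarz n a -> mvec a.
Proof.
elim=> [i|{}n {}a x v _ _ ma i]; first by under eq_fun do rewrite mxE; exact: measurable_cst.
under eq_fun do rewrite mxE [X in _ + X]mxE.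
apply: measurable_funD => //; apply: measurable_funM => //.
by apply: measurable_funB => //; apply: measurable_dot.
Qed.

Let FE w x : F (w, x) = gres w x + dot (cvec w) (evec x).
Proof.
rewrite /gres /orth_res /dot; under [X in _ = _ + X]eq_bigr do rewrite !mxE.
by rewrite subrK.
Qed.

Let mgres : measurable_fun setT (fun z : U * T => gres z.1 z.2).
Proof.
rewrite (_ : (fun z => _) = (fun z : U * T => F z - dot (cvec z.1) (evec z.2))).
  apply: measurable_funB => //; apply: measurable_dot => i.
    exact: (measurableT_comp (mcvec i) measurable_fst).
  exact: (measurableT_comp (mevec i) measurable_snd).
by apply/funext => -[w x] /=; rewrite FE addrK.
Qed.

Let gg w := ip lam (gres w) (gres w).

Lemma measurable_ip_gres : measurable_fun setT (fun w => ip lam (gres w) (gres w)).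
Proof.
apply: (@measurable_fine_integral _ _ _ _ _ lam (fun z => gres z.1 z.2 * gres z.1 z.2)).
exact: measurable_funM.
Qed.

Let mgg : measurable_fun setT gg. Proof. exact: measurable_ip_gres. Qed.

Let gg0 w : 0 <= gg w. Proof. exact: ip_ge0. Qed.

Let nat_cV (z : 'cV[R]_k) : exists a : nat -> R, forall i : 'I_k, a i = z i 0.
Proof.
exists (fun n => oapp (fun i : 'I_k => z i 0) 0 (insub n)) => i.
by rewrite valK.
Qed.

Let dot_nat (z : 'cV[R]_k) (a : nat -> R) x : (forall i : 'I_k, a i = z i 0) ->
  dot z (evec x) = \sum_(i < k) a i * e i x.
Proof. by move=> az; apply: eq_bigr => i _; rewrite az mxE. Qed.

Let sdot (z : 'cV[R]_k) : sqint lam (fun x => dot z (evec x)).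
Proof.
have [a az] := nat_cV z; under eq_fun do rewrite (dot_nat _ az).
exact: sqint_lincomb.
Qed.

Let sgres w : sqint lam (gres w). Proof. exact: sqint_orth_res. Qed.

Let pyth w (c : R) (z : 'cV[R]_k) :
  (\int[lam]_x ((c * gres w x + dot z (evec x)) ^+ 2)%:E = (c ^+ 2 * gg w + dot z z)%:E)%E.
Proof.
have sc : sqint lam (fun x => c * gres w x) by exact: sqintZ.
rewrite integral_sqr; last exact: sqintD.
have [a az] := nat_cV z.
have -> : (fun x => c * gres w x + dot z (evec x)) =
    (fun x => c * gres w x + \sum_(i < k) a i * e i x).
  by apply/funext => x; rewrite (dot_nat _ az).
rewrite (@pythagoras _ _ _ _ _ _ a _ oe sc); last first.
  move=> j jk; rewrite ipZl//; last exact: se.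
  by rewrite (ip_orth_res oe (sF w) jk) mulr0.
rewrite ipZl// ipZr// mulrA -expr2 -/(gg w); congr (_ + _)%:E.
by apply: eq_bigr => i _; rewrite az expr2.
Qed.

(** Orthonormality says that the entries of [evec x *m (evec x)^T] integrate to the identity
    matrix. *)
Let integral_K (Q : 'M[R]_k) : (\int[lam]_x (dot (evec x) (Q *m evec x))%:E = (\tr Q)%:E)%E.
Proof.
pose G (i : 'I_k) x := e i x * dot (row i Q)^T (evec x).
have GE x : dot (evec x) (Q *m evec x) = \sum_i G i x.
  apply: eq_bigr => i _; rewrite !mxE; congr (_ * _).
  by apply: eq_bigr => j _; rewrite !mxE.
under eq_integral do rewrite GE -sumEFin.
have iG i : lam.-integrable setT (fun x => (G i x)%:E).
  by apply: integrable_mul => //; exact: se.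
rewrite integral_sum// /mxtrace -sumEFin; apply: eq_bigr => i _.
have [a aq] := nat_cV (row i Q)^T.
have := @ip_sum_orthonormal _ _ _ lam k e a i oe (ltn_ord i).
rewrite aq !mxE => <-; rewrite /ip /Rintegral fineK; last first.
  have := integrable_fin_num measurableT (iG i); congr (_ \is a _).
  by apply: eq_integral => x _; rewrite /G (dot_nat _ aq) mulrC.
by apply: eq_integral => x _; rewrite /G (dot_nat _ aq) mulrC.
Qed.

Let mK (Q : 'M[R]_k) : measurable_fun setT (fun x => dot (evec x) (Q *m evec x)).
Proof.
apply: measurable_dot => // i; under eq_fun do rewrite mxE.
by apply: measurable_sum => j; apply: measurable_funM => //; exact: mevec.
Qed.

(** Dividing [phi] by the unnormalised density cancels the density in the average over [x], leaving
    at most [tot / \tr Q]. *)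
Let good_point (phi : U * T -> R) (Q : 'M[R]_k) (tot : R) :
  measurable_fun setT phi -> (forall z, 0 <= phi z) ->
  (forall x, 0 <= dot (evec x) (Q *m evec x)) -> 0 < \tr Q ->
  (\int[P]_w \int[lam]_x (phi (w, x))%:E <= tot%:E)%E ->
  exists2 x, 0 < dot (evec x) (Q *m evec x) &
    (\int[P]_w ((dot (evec x) (Q *m evec x))^-1 * phi (w, x))%:E <= (tot / \tr Q)%:E)%E.
Proof.
move=> mphi phi0 K0 trQ Itot.
have mEp : measurable_fun setT (EFin \o phi) by exact/measurable_EFinP.
have Ep0 z : (0 <= (phi z)%:E)%E by rewrite lee_fin.
have [|x||x Kx Jx] := @le_average _ _ _ lam (fun x => \int[P]_w (phi (w, x))%:E)%E
    (fun x => dot (evec x) (Q *m evec x)) (\tr Q) tot _ _ (mK Q) K0 (integral_K Q) trQ.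
- exact: (@measurable_fun_fubini_tonelli_G _ _ _ _ _ P (EFin \o phi)).
- by apply: integral_ge0 => w _.
- by rewrite -(@fubini_tonelli _ _ _ _ _ P lam (EFin \o phi)).
exists x => //; under eq_integral do rewrite EFinM.
rewrite ge0_integralZl//; last 2 first.
- exact: (measurableT_comp mEp (measurable_pair2 x)).
- by rewrite lee_fin invr_ge0 ltW.
by rewrite muleC -lee_pdivlMr ?invr_gt0// invrK muleC -EFinM.
Qed.

Variable G : R.
Hypothesis ggG : (\int[P]_w (gg w)%:E <= G%:E)%E.

Let ggE0 w : (0 <= (gg w)%:E)%E. Proof. by rewrite lee_fin. Qed.

Let mEgg : measurable_fun setT (EFin \o gg). Proof. exact/measurable_EFinP. Qed.

Let G0 : 0 <= G.
Proof. by rewrite -lee_fin; apply: le_trans ggG; apply: integral_ge0 => w _. Qed.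

Let mvecB d (V : measurableType d) (a b : V -> 'cV[R]_k) : mvec a -> mvec b ->
  mvec (fun w => a w - b w).
Proof.
move=> ma mb i; under eq_fun do rewrite mxE [X in _ + X]mxE.
exact: measurable_funB.
Qed.

Let mvecM d (V : measurableType d) (Q : 'M[R]_k) (a : V -> 'cV[R]_k) : mvec a ->
  mvec (fun w => Q *m a w).
Proof.
move=> ma i; under eq_fun do rewrite mxE.
by apply: measurable_sum => j; apply: measurable_funM => //; exact: ma.
Qed.

Let mphi (c : R) (z : U -> 'cV[R]_k) : mvec z ->
  measurable_fun setT (fun y : U * T => (c * gres y.1 y.2 + dot (z y.1) (evec y.2)) ^+ 2).
Proof.
move=> mz; apply: measurable_funX; apply: measurable_funD.
  exact: measurable_funM.
apply: measurable_dot => i.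
  exact: (measurableT_comp (mz i) measurable_fst).
exact: (measurableT_comp (mevec i) measurable_snd).
Qed.

Let evec_neq0 (Q : 'M[R]_k) x : 0 < dot (evec x) (Q *m evec x) ->
  dot (evec x) (evec x) != 0.
Proof.
move=> K0; apply/eqP => E0; have := dot_CS (evec x) (Q *m evec x).
by rewrite E0 mul0r leNgt exprn_gt0.
Qed.

(** Only the error outside the range of [Q] is tracked. A step multiplies the bound by
    [1 + 1 / \tr Q = (k + 1 - j) / (k - j)], and these factors telescope. *)
Lemma kaczmarz_deflation j : (j <= k)%N -> exists a (Q : 'M[R]_k),
  [/\ kaczmarz j a, sym_idem Q, \tr Q = (k - j)%:R &
    let z w := (cvec w - a w) - Q *m (cvec w - a w) in
    (\int[P]_w (gg w + dot (z w) (z w))%:E <= (G * k.+1%:R / (k.+1 - j)%:R)%:E)%E].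
Proof.
elim: j => [_|j IH jk].
  exists (fun=> 0), 1%:M; split.
  - exact: kaczmarz0.
  - by split; rewrite ?trmx1 ?mulmx1.
  - by rewrite mxtrace1 subn0.
  - rewrite /= subn0 mulfK ?pnatr_eq0//.
    rewrite (_ : (fun w => _) = EFin \o gg)//; apply/funext => w /=.
    by rewrite mul1mx subrr /dot big1 ?addr0// => i _; rewrite mxE mul0r.
have [a [Q [ka sQ trQ]]] := IH (ltnW jk).
set z := (X in let z := X in _) => /= Iz.
set tot := (X in (_ <= X%:E)%E) in Iz.
have ma := mvec_kaczmarz ka.
have mw : mvec (fun w => cvec w - a w) by exact: mvecB.
have mz : mvec z by apply: mvecB => //; exact: mvecM.
have kj0 : 0 < (k - j)%:R :> R by rewrite ltr0n subn_gt0.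
pose phi (y : U * T) := (1 * gres y.1 y.2 + dot (z y.1) (evec y.2)) ^+ 2.
have Iphi : (\int[P]_w \int[lam]_x (phi (w, x))%:E <= tot%:E)%E.
  rewrite (eq_integral (fun w => (gg w + dot (z w) (z w))%:E))// => w _.
  by have := pyth w 1 (z w); rewrite expr1n mul1r.
have [||x Kx Jx] := @good_point phi Q tot (mphi 1 mz) (fun y => sqr_ge0 _) _ _ Iphi.
- by move=> x; rewrite dot_sym_idem// dot_ge0.
- by rewrite trQ.
set K := dot (evec x) (Q *m evec x) in Kx Jx.
have K0 : K != 0 by rewrite gt_eqF.
pose a' w := a w + (F (w, x) - dot (a w) (evec x)) *: (K^-1 *: (Q *m evec x)).
exists a', (deflate Q (evec x)); split.
- by apply: kaczmarzS => //; exact: evec_neq0 Kx.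
- exact: deflate_sym_idem.
- by rewrite tr_deflate// trQ -(subnSK jk) -natr1 addrK.
pose z' w := (cvec w - a' w) - deflate Q (evec x) *m (cvec w - a' w).
have z'E w : dot (z' w) (z' w) = dot (z w) (z w) + K^-1 * phi (w, x).
  rewrite /phi /= mul1r -(deflate_step (cvec w - a w) (gres w x) sQ K0).
  rewrite /z' /a' scalerA opprD addrA FE -/K.
  have -> : (gres w x + dot (cvec w) (evec x) - dot (a w) (evec x)) / K =
    K^-1 * (gres w x + dot (cvec w - a w) (evec x)).
    by rewrite dotBl mulrC addrA.
  by [].
rewrite (eq_integral (fun w => ((gg w + dot (z w) (z w))%:E + (K^-1 * phi (w, x))%:E)%E)); last first.
  by move=> w _; rewrite -EFinD; congr EFin; rewrite -[RHS]addrA -(z'E w).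
rewrite ge0_integralD//; last 4 first.
- by move=> w _; rewrite lee_fin addr_ge0// dot_ge0.
- apply/measurable_EFinP; apply: measurable_funD => //; exact: measurable_dot.
- by move=> w _; rewrite lee_fin mulr_ge0 ?sqr_ge0// invr_ge0 ltW.
- apply/measurable_EFinP; apply: measurable_funM => //.
  exact: (measurableT_comp (mphi 1 mz) (measurable_pair2 x)).
apply: (le_trans (leeD Iz Jx)); rewrite trQ -EFinD lee_fin /tot.
rewrite le_eqVlt; apply/orP; left; apply/eqP.
rewrite (_ : (k.+1 - j.+1)%N = (k - j)%N)//.
rewrite subSn; last exact: ltnW.
rewrite -natr1; field.
by rewrite !gt_eqF ?addr_gt0.
Qed.

Let integral_sqrD (z : U -> 'cV[R]_k) w : (\int[lam]_x ((gres w x + dot (z w) (evec x)) ^+ 2)%:E =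
  (gg w + dot (z w) (z w))%:E)%E.
Proof. by rewrite -[gg w]mul1r -(expr1n _ 2) -pyth; under [RHS]eq_integral do rewrite mul1r. Qed.

(** Under the density [dot (evec x) (evec x) / k] the residual is orthogonal to the span of [e] and
    enters only through [al ^+ 2 * G / k], while the relaxed step still contracts the error [y]. *)
Lemma kaczmarz_relaxation n a (p al : R) : (0 < k)%N -> 0 < al <= 1 -> kaczmarz n a ->
  (\int[P]_w (dot (cvec w - a w) (cvec w - a w))%:E <= p%:E)%E ->
  exists2 a', kaczmarz n.+1 a' &
  (\int[P]_w (dot (cvec w - a' w) (cvec w - a' w))%:E <=
     (p * (1 - al / k%:R) + al ^+ 2 * G / k%:R)%:E)%E.
Proof.
move=> k0 /andP[al0 al1] ka Ip.
have ma := mvec_kaczmarz ka.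
pose y w := cvec w - a w.
have my : mvec y by exact: mvecB.
pose E2 x := dot (evec x) (evec x).
pose L (z : U * T) := dot (y z.1) (evec z.2).
pose C (z : U * T) := - al * gres z.1 z.2 + dot ((1 - al) *: y z.1) (evec z.2).
(* [phi / E2] is the squared error after the step, written so that nonnegativity follows from
   Cauchy-Schwarz: the error orthogonal to [evec x] is kept and the component along it becomes
   [C]. *)
pose phi (z : U * T) := dot (y z.1) (y z.1) * E2 z.2 - L z ^+ 2 + C z ^+ 2.
have my' : mvec (fun w => (1 - al) *: y w).
  by move=> i; under eq_fun do rewrite mxE; apply: measurable_funM => //; exact: my.
have mL : measurable_fun setT L.
  apply: measurable_dot => i.
    exact: (measurableT_comp (my i) measurable_fst).
  exact: (measurableT_comp (mevec i) measurable_snd).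
have mE2 : measurable_fun setT E2 by apply: measurable_dot.
have myy : measurable_fun setT (fun w => dot (y w) (y w)) by exact: measurable_dot.
have mphi' : measurable_fun setT phi.
  apply: measurable_funD; last exact: (mphi (- al) my').
  apply: measurable_funB; last exact: measurable_funX.
  by apply: measurable_funM; [exact: (measurableT_comp myy measurable_fst)|
    exact: (measurableT_comp mE2 measurable_snd)].
have phi0 z : 0 <= phi z.
  by rewrite addr_ge0 ?sqr_ge0// subr_ge0 dot_CS.
have kR0 : 0 < k%:R :> R by rewrite ltr0n.
have kR1 : 1 <= k%:R :> R by rewrite ler1n.
pose c1 : R := k%:R - 1 + (1 - al) ^+ 2.
have c10 : 0 <= c1 by rewrite addr_ge0 ?sqr_ge0// subr_ge0.
have Ix w : (\int[lam]_x (phi (w, x))%:E = (c1 * dot (y w) (y w) + al ^+ 2 * gg w)%:E)%E.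
  rewrite /phi /=; under eq_integral do rewrite EFinD EFinB.
  have EI : (\int[lam]_x (dot (y w) (y w) * E2 x)%:E = (dot (y w) (y w) * k%:R)%:E)%E.
    under eq_integral do rewrite EFinM.
    rewrite ge0_integralZl//; last 3 first.
    - exact/measurable_EFinP.
    - by move=> x _; rewrite lee_fin dot_ge0.
    - by rewrite lee_fin dot_ge0.
    have := integral_K 1%:M; rewrite mxtrace1 EFinM => <-; congr (_ * _)%E.
    by apply: eq_integral => x _; rewrite mul1mx.
  have LI : (\int[lam]_x (L (w, x) ^+ 2)%:E = (dot (y w) (y w))%:E)%E.
    have := pyth w 0 (y w); rewrite expr0n/= mul0r add0r => <-.
    by apply: eq_integral => x _; rewrite mul0r add0r.
  have CI : (\int[lam]_x (C (w, x) ^+ 2)%:E = (al ^+ 2 * gg w + (1 - al) ^+ 2 * dot (y w) (y w))%:E)%E.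
    by have := pyth w (- al) ((1 - al) *: y w); rewrite sqrrN dotZl dotZr mulrA -expr2.
  have iE : lam.-integrable setT (fun x => (dot (y w) (y w) * E2 x)%:E).
    apply/integrableP; split; first by apply/measurable_EFinP; exact: measurable_funM.
    under eq_integral do rewrite gee0_abs ?lee_fin ?mulr_ge0 ?dot_ge0//.
    by rewrite EI ltry.
  have iL : lam.-integrable setT (fun x => (L (w, x) ^+ 2)%:E).
    by case: (sdot (y w)).
  have iC : lam.-integrable setT (fun x => (C (w, x) ^+ 2)%:E).
    have sg := sqintZ (- al) (sgres w).
    by have [] := sqintD sg (sdot ((1 - al) *: y w)).
  rewrite integralD//; last exact: integrableB.
  rewrite integralB// EI LI CI -EFinB -EFinD; congr EFin; rewrite /c1; ring.
pose tot : R := c1 * p + al ^+ 2 * G.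
have Itot : (\int[P]_w \int[lam]_x (phi (w, x))%:E <= tot%:E)%E.
  under eq_integral do rewrite Ix EFinD (EFinM c1) (EFinM (al ^+ 2)).
  rewrite ge0_integralD//; last 4 first.
  - by move=> w _; rewrite -EFinM lee_fin mulr_ge0// dot_ge0.
  - by apply/measurable_EFinP; exact: measurable_funM.
  - by move=> w _; rewrite -EFinM lee_fin mulr_ge0// sqr_ge0.
  - by apply/measurable_EFinP; exact: measurable_funM.
  rewrite (ge0_integralZl _ _ mEgg)//; [|by move=> w _; exact: ggE0|by rewrite lee_fin sqr_ge0].
  rewrite ge0_integralZl//; last 2 first.
  - exact/measurable_EFinP.
  - by move=> w _; rewrite lee_fin dot_ge0.
  apply: (@le_trans _ _ (c1%:E * p%:E + (al ^+ 2)%:E * G%:E)%E); last first.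
    by rewrite -!EFinM -EFinD.
  by apply: leeD; apply: lee_wpmul2l; rewrite ?lee_fin ?sqr_ge0.
have [||x Kx Jx] := @good_point phi 1%:M tot mphi' phi0 _ _ Itot.
- by move=> x; rewrite mul1mx dot_ge0.
- by rewrite mxtrace1.
rewrite mul1mx mxtrace1 in Kx Jx.
pose f w := F (w, x) - dot (a w) (evec x).
exists (fun w => a w + f w *: ((al / E2 x) *: evec x)).
  by apply: kaczmarzS => //; rewrite gt_eqF.
have E0 : E2 x != 0 by rewrite gt_eqF.
have fE w : f w = gres w x + L (w, x) by rewrite /f FE /L /= dotBl addrA.
apply: le_trans (_ : (tot / k%:R)%:E <= _)%E; last first.
  have p0 : 0 <= p.
    by rewrite -lee_fin; apply: le_trans Ip; apply: integral_ge0 => w _; rewrite lee_fin dot_ge0.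
  rewrite lee_fin -(ler_pM2r kR0) mulfVK ?gt_eqF//.
  have -> : (p * (1 - al / k%:R) + al ^+ 2 * G / k%:R) * k%:R = p * (k%:R - al) + al ^+ 2 * G.
    by field; rewrite gt_eqF.
  (* [c1 = k - 2 * al + al ^+ 2] is at most [k - al] because [al <= 1]. *)
  by rewrite lerD2r mulrC ler_wpM2l// /c1; nra.
apply: le_trans Jx.
rewrite le_eqVlt; apply/orP; left; apply/eqP; apply: eq_integral => w _; congr EFin.
rewrite opprD addrA -/(y w) scalerA dot_subZ.
rewrite -/(E2 x) /phi /C /= dotZl -/(L (w, x)) fE.
by field.
Qed.

(** [al * G] is the fixed point of the recursion of the relaxed step, so the deviation from it
    shrinks by [1 - al / k] each time. The summand 1 is the residual that no choice of coefficients
    removes. *)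
Lemma kaczmarz_bound (al : R) (j : nat) : (0 < k)%N -> 0 < al <= 1 -> exists2 a,
  kaczmarz (k + j) a &
  (\int[P]_w \int[lam]_x ((F (w, x) - dot (a w) (evec x)) ^+ 2)%:E <=
    (G * (1 + k.+1%:R * (1 - al / k%:R) ^+ j + al))%:E)%E.
Proof.
move=> k0 al01.
have kR0 : 0 < k%:R :> R by rewrite ltr0n.
suff [a ka Ia] : exists2 a, kaczmarz (k + j) a &
  (\int[P]_w (dot (cvec w - a w) (cvec w - a w))%:E <=
     (G * (k.+1%:R * (1 - al / k%:R) ^+ j + al))%:E)%E.
  exists a => //.
  under eq_integral.
    move=> w _; under eq_integral do rewrite FE -addrA -dotBl.
    rewrite (integral_sqrD (fun w => cvec w - a w)) EFinD; over.
  have my : mvec (fun w => cvec w - a w) by apply: mvecB => //; exact: mvec_kaczmarz ka.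
  rewrite ge0_integralD//; last 2 first.
  - by move=> w _; rewrite lee_fin dot_ge0.
  - by apply/measurable_EFinP; exact: measurable_dot.
  apply: le_trans (leeD ggG Ia) _; rewrite -EFinD lee_fin le_eqVlt.
  by apply/orP; left; apply/eqP; ring.
elim: j => [|j [a ka Ia]].
  have [a [Q [ka sQ trQ /=]]] := kaczmarz_deflation (leqnn k).
  (* After [k] deflations [Q] is zero, so the tracked part is the whole coefficient error. *)
  rewrite subnn in trQ; rewrite (sym_idem_tr0 sQ trQ) subSnn divr1 => Ia.
  exists a; first by rewrite addn0.
  rewrite expr0 mulr1; apply: (@le_trans _ _ (G * k.+1%:R)%:E); last first.
    by rewrite lee_fin ler_wpM2l// lerDl; case/andP: al01 => /ltW.
  apply: le_trans Ia.
  have my : mvec (fun w => cvec w - a w) by apply: mvecB => //; exact: mvec_kaczmarz ka.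
  apply: ge0_le_integral => //.
  - by move=> w _; rewrite lee_fin dot_ge0.
  - by apply/measurable_EFinP; exact: measurable_dot.
  - apply/measurable_EFinP; apply: measurable_funD => //.
    under eq_fun do rewrite mul0mx subr0.
    exact: measurable_dot.
  - by move=> w _; rewrite lee_fin mul0mx subr0 lerDr.
have [a' ka' Ia'] := kaczmarz_relaxation k0 al01 ka Ia.
exists a'; first by rewrite addnS.
apply: (le_trans Ia'); rewrite lee_fin le_eqVlt; apply/orP; left; apply/eqP.
by rewrite (exprS _ j); move: ((1 - al / k%:R) ^+ j) => r; field; rewrite gt_eqF.
Qed.

End sampling.

(** * Reduction to finite dimension *)

Section subspace.
Context (R : realType) (k : nat) (W : 'cV[R]_k -> Prop).
Hypotheses (W0 : W 0) (WD : forall u v, W u -> W v -> W (u + v))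
  (WZ : forall a u, W u -> W (a *: u)).

(* A projection [Q] whose complement maps into [W] is deflated until it vanishes. *)
Lemma subspace_total_or_orthogonal :
  (forall v, W v) \/ exists2 b, b != 0 & forall u, W u -> dot b u = 0.
Proof.
have [//|nW] := pselect (exists2 b, b != 0 & forall u, W u -> dot b u = 0); first by right.
left; suff key j : (j <= k)%N -> exists Q : 'M[R]_k,
    [/\ sym_idem Q, \tr Q = (k - j)%:R & forall v, W (v - Q *m v)].
  have [Q [sQ trQ WQ]] := key k (leqnn k) => v.
  rewrite subnn in trQ; have := WQ v.
  by rewrite (sym_idem_tr0 sQ trQ) mul0mx subr0.
elim: j => [_|j IH jk].
  exists 1%:M; split; first by split; rewrite ?trmx1 ?mulmx1.
    by rewrite mxtrace1 subn0.
  by move=> v; rewrite mul1mx subrr.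
have [Q [sQ trQ WQ]] := IH (ltnW jk); have [QT QQ] := sQ.
have Qn0 : Q != 0.
  apply/eqP => Q0; move: trQ; rewrite Q0 mxtrace0 => /esym/eqP.
  by rewrite pnatr_eq0 subn_eq0 leqNgt jk.
(* Otherwise [Q] kills all of [W], and a nonzero column of the symmetric matrix [Q] is a vector
   orthogonal to [W]. *)
have [u Wu Ku] : exists2 u, W u & dot u (Q *m u) != 0.
  apply/not_exists2P => h; apply: nW.
  have [i Qi] : exists i, col i Q != 0.
    apply: contrapT => /forallNP Qi; move/eqP: Qn0; apply; apply/matrixP => a b.
    by have /negP/negPn/eqP/colP/(_ a) := Qi b; rewrite !mxE.
  exists (col i Q) => // u Wu; case: (h u) => // /negP/negPn/eqP.
  rewrite dot_sym_idem// => /eqP; rewrite psumr_eq0; last first.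
    by move=> ? _; rewrite -expr2 sqr_ge0.
  move=> /allP Qu; have := Qu i (mem_index_enum _); rewrite /= mulf_eq0 orbb.
  move=> /eqP; rewrite mxE => <-; apply: eq_bigr => l _.
  by rewrite mxE -[in LHS]QT mxE.
exists (deflate Q u); split.
- exact: deflate_sym_idem.
- by rewrite tr_deflate// trQ -(subnSK jk) -natr1 addrK.
- move=> v; set q := Q *m u.
  have -> : v - deflate Q u *m v = (v - Q *m v) + ((dot u q)^-1 * dot q v) *: q.
    have qv : q^T *m v = (dot q v)%:M.
      by apply/matrixP => i j'; rewrite !ord1 dotE mxE eqxx mulr1n.
    rewrite /deflate -/q mulmxBl -scalemxAl -(mulmxA q) qv mul_mx_scalar scalerA.
    by rewrite opprB addrA addrAC.
  apply: WD => //; apply: WZ.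
  have -> : q = u + (-1) *: (u - q) by rewrite scaleN1r opprB addrC subrK.
  by apply: WD => //; apply: WZ.
Qed.

End subspace.

Section bessel.
Context d (T : measurableType d) (R : realType) (m : {measure set T -> \bar R}).
Variables (k : nat) (e : nat -> T -> R).
Hypothesis oe : orthonormal m k e.

Lemma orth_resB f g x : sqint m f -> sqint m g ->
  orth_res m k e (fun x => f x - g x) x = orth_res m k e f x - orth_res m k e g x.
Proof.
move=> sf sg; have [se _] := oe; rewrite /orth_res.
have -> : \sum_(j < k) ip m (fun x => f x - g x) (e j) * e j x =
    \sum_(j < k) ip m f (e j) * e j x - \sum_(j < k) ip m g (e j) * e j x.
  by rewrite -sumrB; apply: eq_bigr => j _; rewrite ipBl ?mulrBl//; exact: se.
by ring.
Qed.

Lemma orth_res_sum n (a : nat -> R) (psi : nat -> T -> R) x :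
  (forall i, (i < n)%N -> sqint m (psi i)) ->
  orth_res m k e (fun x => \sum_(i < n) a i * psi i x) x =
  \sum_(i < n) a i * orth_res m k e (psi i) x.
Proof.
move=> spsi; have [se _] := oe; rewrite /orth_res.
under [RHS]eq_bigr do rewrite mulrBr.
rewrite sumrB; congr (_ - _).
under [RHS]eq_bigr do rewrite mulr_sumr.
rewrite exchange_big; apply: eq_bigr => j _ /=.
rewrite (@ip_suml _ _ _ _ n (fun i x => a i * psi i x)); last 2 first.
- by move=> i ni; apply: sqintZ; exact: spsi.
- exact: se.
rewrite mulr_suml; apply: eq_bigr => i _.
by rewrite ipZl ?mulrA//; [exact: spsi|exact: se].
Qed.

Lemma bessel f : sqint m f -> ip m (orth_res m k e f) (orth_res m k e f) <= ip m f f.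
Proof.
move=> sf; have sr := sqint_orth_res oe sf.
have := pythagoras (fun j => ip m f (e j)) oe sr (fun j => @ip_orth_res _ _ _ _ _ _ _ j oe sf).
have -> : (fun x => orth_res m k e f x + \sum_(i < k) ip m f (e i) * e i x) = f.
  by apply/funext => x; rewrite /orth_res subrK.
by move=> ->; rewrite lerDl; apply: sumr_ge0 => i _; exact: sqr_ge0.
Qed.

End bessel.

Section dimension_reduction.
Context d1 d2 (U : measurableType d1) (T : measurableType d2) (R : realType).
Variables (P : probability U R) (lam : {sigma_finite_measure set T -> \bar R}).
Variable F : U * T -> R.
Hypothesis mF : measurable_fun setT F.
Hypothesis sF : forall w, sqint lam (fun x => F (w, x)).
Variables (n : nat) (L : n.-tuple (U -> R)).
Hypothesis FL : forall x a (b : nat -> R),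
  gaussian_rv P (fun w => a * F (w, x) + \sum_(i < n) b i * tnth L i w).

(* The best predictor of F(.,x) from L is linear, hence takes values in a space of
   dimension at most n. *)
Lemma gaussian_dimension_reduction (phi : n.-tuple R * T -> R) (G : R) :
  measurable_fun setT phi ->
  (\int[P]_w \int[lam]_x ((F (w, x) - phi (map_tuple (fun l => l w) L, x)) ^+ 2)%:E <= G%:E)%E ->
  exists k (e : nat -> T -> R), [/\ (k <= n)%N, orthonormal lam k e,
    (forall x, (forall w, F (w, x) = 0) -> forall i, (i < k)%N -> e i x = 0) &
    (\int[P]_w (ip lam (gres lam F k e w) (gres lam F k e w))%:E <= G%:E)%E].
Proof.
move=> mphi IG.
pose L' i := nth (fun=> 0) L i : U -> R.
have LL' (i : 'I_n) : tnth L i = L' i by rewrite (tnth_nth (fun=> 0)).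
have gF x : gaussian_rv P (fun w => F (w, x)).
  have := FL x 1 (fun=> 0); congr gaussian_rv; apply/funext => w.
  by rewrite mul1r big1 ?addr0// => i _; rewrite mul0r.
have sFx x : sqint P (fun w => F (w, x)) by exact: gaussian_sqint (gF x).
have gL' i : (i < n)%N -> gaussian_rv P (L' i).
  move=> ni; have := FL point 0 (fun j => (j == i)%:R); congr gaussian_rv; apply/funext => w.
  rewrite mul0r add0r (bigD1 (Ordinal ni))//= eqxx mul1r LL' big1 ?addr0// => j ji.
  by rewrite (negbTE (_ : (j : nat) != i)) ?mul0r.
have sL' i : (i < n)%N -> sqint P (L' i) by move=> ni; exact: gaussian_sqint (gL' i ni).
have [k [l [kn ol lc lr]]] := gram_schmidt sL'.
have [sl _] := ol.
have ml j : (j < k)%N -> measurable_fun setT (l j) by move=> /sl[].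
have /choice[c cE] : forall j : nat, exists c : nat -> R, (j < k)%N ->
    forall w, l j w = \sum_(i < n) c i * L' i w.
  move=> j; case: (ltnP j k) => [/lc[c cE]|_]; last by exists (fun=> 0).
  by exists c.
pose psi j x := ip P (fun w => F (w, x)) (l j).
have mpsi j : (j < k)%N -> measurable_fun setT (psi j).
  move=> jk; apply: (@measurable_fine_integral _ _ _ _ _ P (fun z : T * U => F (z.2, z.1) * l j z.2)).
  apply: measurable_funM; last by apply: measurableT_comp => //; exact: ml.
  by apply: (measurableT_comp mF); exact: measurable_fun_pair.
pose Z w x := orth_res P k l (fun w => F (w, x)) w.
have ZE w x : Z w x = F (w, x) - \sum_(j < k) psi j x * l j w by [].
have mZ : measurable_fun setT (fun z : U * T => Z z.1 z.2).
  rewrite (_ : (fun _ => _) = (fun z : U * T => F z - \sum_(j < k) psi j z.2 * l j z.1)).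
    apply: measurable_funB => //; apply: measurable_sum => j.
    apply: measurable_funM; apply: measurableT_comp => //; [exact: mpsi|exact: ml].
  by apply/funext => -[w x].
have h1 x : (\int[P]_w (Z w x ^+ 2)%:E <=
    \int[P]_w ((F (w, x) - phi (map_tuple (fun l => l w) L, x)) ^+ 2)%:E)%E.
  (* The linear predictor minus the given one: a function of the information alone, so [F - phi] is
     [Z + y]. *)
  pose y (t : n.-tuple R) := \sum_(j < k) psi j x * (\sum_(i < n) c j i * tnth t i) - phi (t, x).
  have my : measurable_fun setT y.
    apply: measurable_funB; last exact: (measurableT_comp mphi (measurable_pair2 x)).
    apply: measurable_sum => j; apply: measurable_funM => //.
    apply: measurable_sum => i; apply: measurable_funM => //.
    exact: measurable_tnth.
  rewrite [leRHS](_ : _ = (\int[P]_w ((Z w x + y (map_tuple (fun l => l w) L)) ^+ 2)%:E)%E); last first.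
    apply: eq_integral => w _; rewrite ZE /y addrA; congr ((_ - _) ^+ 2)%:E.
    rewrite -addrA addrC -[LHS]add0r; congr (_ + _); apply/esym/eqP.
    rewrite addrC subr_eq0; apply/eqP/eq_bigr => j _; rewrite cE//; congr (_ * _).
    by apply: eq_bigr => i _; rewrite tnth_map LL'.
  apply: gaussian_predictor => //.
  - move=> a b.
    have := FL x a (fun i => b i - a * \sum_(j < k) psi j x * c j i).
    congr gaussian_rv; apply/funext => w; rewrite ZE mulrBr -addrA; congr (_ + _).
    under eq_bigr do rewrite mulrBl.
    rewrite sumrB addrC; congr (_ + _).
    rewrite mulr_sumr; congr (- _).
    under eq_bigr do rewrite mulr_sumr mulr_suml.
    rewrite exchange_big; apply: eq_bigr => j _ /=; rewrite cE// !mulr_sumr.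
    by apply: eq_bigr => i _; rewrite LL'; ring.
  - move=> i; rewrite LL'.
    have sZ : sqint P (fun w => Z w x) by exact: sqint_orth_res.
    have Zl j : (j < k)%N -> ip P (fun w => Z w x) (l j) = 0.
      by move=> jk; exact: ip_orth_res.
    (* [L' i] is a null function plus a combination of the [l j], and [Z] is orthogonal to both. *)
    have -> : L' i = fun w => orth_res P k l (L' i) w + \sum_(j < k) ip P (L' i) (l j) * l j w.
      by apply/funext => w; rewrite /orth_res subrK.
    have si := sL' i (ltn_ord i).
    rewrite ipDr//; last 2 first.
    + exact: sqint_orth_res.
    + exact: (sqint_lincomb (fun j => ip P (L' i) (l j))).
    rewrite (ip_lincomb_orth (fun j => ip P (L' i) (l j)) ol sZ Zl) addr0 ipC.
    apply: ip_eq0 => //; [exact: sqint_orth_res|exact: lr].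
have mZ2 : measurable_fun setT (fun z : U * T => (Z z.1 z.2 ^+ 2)%:E).
  by apply/measurable_EFinP; exact: measurable_funX.
have Z20 (z : U * T) : (0 <= (Z z.1 z.2 ^+ 2)%:E)%E by rewrite lee_fin sqr_ge0.
have IZ : (\int[P]_w \int[lam]_x (Z w x ^+ 2)%:E <= G%:E)%E.
  apply: le_trans IG.
  have mV : measurable_fun setT (fun w => map_tuple (fun l : U -> R => l w) L).
    apply/measurable_fun_tnthP => i.
    rewrite (_ : _ \o _ = tnth L i); first by rewrite LL'; case: (gL' i (ltn_ord i)).
    by apply/funext => w; rewrite /= tnth_map.
  have mFp : measurable_fun setT (fun z : U * T =>
      ((F z - phi (map_tuple (fun l : U -> R => l z.1) L, z.2)) ^+ 2)%:E).
    apply/measurable_EFinP; apply: measurable_funX; apply: measurable_funB => //.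
    apply: measurableT_comp => //; apply: measurable_fun_pair => //.
    exact: (measurableT_comp mV measurable_fst).
  have Fp0 (z : U * T) : (0 <= ((F z - phi (map_tuple (fun l : U -> R => l z.1) L, z.2)) ^+ 2)%:E)%E.
    by rewrite lee_fin sqr_ge0.
  rewrite (fubini_tonelli _ mZ2 Z20) [leRHS](fubini_tonelli _ mFp Fp0)/=.
  apply: ge0_le_integral => //.
  - by move=> x _; apply: integral_ge0 => w _; rewrite lee_fin sqr_ge0.
  - exact: (measurable_fun_fubini_tonelli_G _ mZ2 Z20).
  - exact: (measurable_fun_fubini_tonelli_G _ mFp Fp0).
(* Only [Z] has a finite second moment over the product. The vectors whose combination of the
   [psi j] is square integrable form a subspace [W]. For almost all [w] both [F (w, _)] and [Z w]
   are square integrable, so the vector of the [l j w] lies in [W]. A nonzero [b] orthogonal to [W]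
   would make the combination of the [l j] with coefficients [b] vanish almost everywhere, against
   orthonormality. *)
have spsi j : (j < k)%N -> sqint lam (psi j).
  pose W (a : 'cV[R]_k) := sqint lam (fun x => \sum_(j < k) psi j x * a j 0).
  have mW (a : nat -> R) : measurable_fun setT (fun x => \sum_(j < k) psi j x * a j).
    by apply: measurable_sum => i; apply: measurable_funM => //; exact: mpsi.
  have [|||Wall|[b b0 bW]] := @subspace_total_or_orthogonal R k W.
  - rewrite /W (_ : (fun _ => _) = (fun=> 0)); first exact: sqint0.
    by apply/funext => x; rewrite big1// => i _; rewrite mxE mulr0.
  - move=> u v su sv; have := sqintD su sv; congr sqint; apply/funext => x.
    by rewrite -big_split; apply: eq_bigr => i _; rewrite mxE mulrDr.
  - move=> a u su; have := sqintZ a su; congr sqint; apply/funext => x.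
    by rewrite mulr_sumr; apply: eq_bigr => i _; rewrite mxE mulrCA.
  - move=> jk; have := Wall (delta_mx (Ordinal jk) 0); congr sqint; apply/funext => x.
    rewrite (bigD1 (Ordinal jk))//= mxE !eqxx mulr1 big1 ?addr0// => i ij.
    by rewrite mxE (negbTE ij) mulr0.
  exfalso.
  have aeW : {ae P, forall w, W (\col_(j < k) l j w)}.
    have mI : measurable_fun setT (fun w => \int[lam]_x (Z w x ^+ 2)%:E)%E.
      exact: (measurable_fun_fubini_tonelli_F _ mZ2 Z20).
    have iI : P.-integrable setT (fun w => \int[lam]_x (Z w x ^+ 2)%:E)%E.
      apply/integrableP; split => //.
      under eq_integral.
        move=> w _; rewrite gee0_abs; last by apply: integral_ge0 => x _; rewrite lee_fin sqr_ge0.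
        over.
      exact: le_lt_trans IZ (ltry _).
    have := integrable_ae measurableT iI; apply: filterS => w /(_ I) fw.
    have sZw : sqint lam (fun x => Z w x).
      apply: sqint_ltP; first exact: (measurableT_comp mZ (measurable_pair1 w)).
      by rewrite ltey_eq fw.
    have := sqintB (sF w) sZw; congr sqint; apply/funext => x.
    by rewrite ZE subKr; apply: eq_bigr => i _; rewrite mxE.
  pose b' (i : nat) := oapp (fun i : 'I_k => b i 0) 0 (insub i).
  have b'E (i : 'I_k) : b' i = b i 0 by rewrite /b' valK.
  have bb0 : ip P (fun w => \sum_(i < k) b' i * l i w) (fun w => \sum_(i < k) b' i * l i w) = 0.
    have sb := sqint_lincomb b' ol.
    have := integral_sqr sb => h; apply: EFin_inj; rewrite -h.
    transitivity (\int[P]_w cst 0 w)%E; last by rewrite integral0.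
    apply: ae_eq_integral => //.
      by apply/measurable_EFinP; apply: measurable_funX; case: sb.
    apply: filterS aeW => w /bW bw _ /=.
    suff -> : \sum_(i < k) b' i * l i w = 0 by rewrite expr0n.
    by rewrite -[RHS]bw; apply: eq_bigr => i _; rewrite mxE b'E.
  rewrite ip_lincomb// in bb0.
  move/eqP: b0; apply; apply/colP => i; rewrite mxE.
  move/eqP: bb0; rewrite psumr_eq0; last by move=> ? _; rewrite -expr2 sqr_ge0.
  by move=> /allP /(_ i (mem_index_enum _)) /=; rewrite mulf_eq0 orbb b'E => /eqP.
have [k' [e [k'k oe ec er]]] := gram_schmidt spsi.
exists k', e; split => //.
- exact: leq_trans kn.
- move=> x Fx0 i ik'; have [a ->] := ec i ik'.
  rewrite big1// => j _.
  rewrite /psi /ip /Rintegral integral0_eq ?mulr0// => w _.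
  by rewrite Fx0 mul0r.
apply: le_trans IZ; apply: ge0_le_integral => //.
- by move=> w _; rewrite lee_fin ip_ge0.
- by apply/measurable_EFinP; apply: measurable_ip_gres.
- exact: (measurable_fun_fubini_tonelli_F _ mZ2 Z20).
- move=> w _.
  (* [F] and [Z] differ by [v], whose residual is null since [e] exhausts the [psi j]; so both have
     residuals of equal norm, and Bessel bounds that of [Z]. *)
  pose v x := \sum_(j < k) l j w * psi j x.
  have sv : sqint lam v.
    by apply: (@sqint_sum _ _ _ _ k (fun j x => l j w * psi j x)) => j jk; apply: sqintZ; exact: spsi.
  have ZvE : (fun x => Z w x) = (fun x => F (w, x) - v x).
    by apply/funext => x; rewrite ZE; congr (_ - _); apply: eq_bigr => j _; rewrite mulrC.
  have sZw : sqint lam (fun x => Z w x) by rewrite ZvE; exact: sqintB.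
  rewrite integral_sqr// lee_fin; apply: le_trans (bessel oe sZw).
  pose rF := orth_res lam k' e (fun x => F (w, x)).
  pose rv := orth_res lam k' e v.
  have srF : sqint lam rF by exact: sqint_orth_res.
  have srv : sqint lam rv by exact: sqint_orth_res.
  have rZ : orth_res lam k' e (fun x => Z w x) = (fun x => rF x - rv x).
    by apply/funext => x; rewrite ZvE orth_resB.
  have rv0 f : sqint lam f -> ip lam rv f = 0.
    move=> sf; rewrite /rv.
    have -> : orth_res lam k' e v = (fun x => \sum_(j < k) l j w * orth_res lam k' e (psi j) x).
      by apply/funext => x; rewrite (orth_res_sum oe (fun j => l j w) x spsi).
    rewrite (@ip_suml _ _ _ _ k (fun j x => l j w * orth_res lam k' e (psi j) x))//; last first.
      by move=> j jk; apply: sqintZ; apply: sqint_orth_res => //; exact: spsi.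
    rewrite big1// => j _; have sj := spsi j (ltn_ord j).
    have srj : sqint lam (orth_res lam k' e (psi j)) by exact: sqint_orth_res.
    by rewrite ipZl// ip_eq0 ?mulr0//; exact: er.
  rewrite rZ ipBl//; last exact: sqintB.
  by rewrite rv0 ?subr0; [rewrite ipBr// (ipC _ rF rv) rv0// subr0|exact: sqintB].
Qed.

End dimension_reduction.

(** * Standard information *)

Section approximation.
Context {R : realType} (S : @avg_app_setting R) (d : nat).
Notation D := (Dom S d).
Notation F := (Fsp S d).
Notation bF := (borel_type F).

Definition dens (x : d.-tuple R) : R := (rho S d \_ D) x.
Definition wt (x : d.-tuple R) : R := Num.sqrt (dens x).
(* [emb f] as a function in the unweighted [L_2], jointly in [f] and [x]. *)
Definition wemb (p : bF * d.-tuple R) : R := wt p.2 * emb S d p.1 p.2.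

Lemma measurable_sqrtr : measurable_fun setT (@Num.sqrt R).
Proof.
by apply: continuous_measurable_fun => x; exact: sqrt_continuous.
Qed.

Lemma dens_ge0 x : 0 <= dens x.
Proof.
rewrite /dens patchE; case: ifPn => // /set_mem; exact: rho_ge0.
Qed.

Lemma sqr_wt x : wt x ^+ 2 = dens x.
Proof. by rewrite sqr_sqrtr// dens_ge0. Qed.

Lemma wtN x : ~ D x -> wt x = 0.
Proof.
by move=> xD; rewrite /wt /dens patchE memNset// sqrtr0.
Qed.

Lemma measurable_wt : measurable_fun setT wt.
Proof.
apply: measurableT_comp; first exact: measurable_sqrtr.
by apply/(measurable_restrictT _ (Dom_measurable S d)); exact: rho_measurable.
Qed.

Lemma wt_restrict (f : d.-tuple R -> R) x : wt x * f x = wt x * (f \_ D) x.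
Proof.
have [xD|xD] := pselect (D x); first by rewrite patchE mem_set.
by rewrite wtN ?mul0r.
Qed.

Lemma continuous_wemb x : continuous (fun f : F => wemb (f, x)).
Proof.
have [xD|xD] := pselect (D x).
  by move=> f; apply: cvgM; [exact: cvg_cst|exact: Defs.eval_continuous].
rewrite (_ : (fun _ => _) = (fun=> 0)); first by move=> f; exact: cvg_cst.
by apply/funext => f; rewrite /wemb /= wtN// mul0r.
Qed.

Lemma measurable_wemb : measurable_fun setT wemb.
Proof.
apply: (@caratheodory_measurable _ _ _ _ (fun f x => wt x * emb S d f x)).
- exact: Fsp_separable.
- move=> f; under eq_fun do rewrite wt_restrict.
  apply: measurable_funM; first exact: measurable_wt.
  by apply/(measurable_restrictT _ (Dom_measurable S d)); exact: emb_measurable.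
- exact: continuous_wemb.
Qed.

Lemma sqnormG_wt (h : d.-tuple R -> R) :
  sqnormG D (rho S d) h = intRn (fun x => ((wt x * h x) ^+ 2)%:E).
Proof.
rewrite /sqnormG; congr intRn; apply/funext => x; congr (_%:E).
by rewrite exprMn sqr_wt /dens patch_indic /= (mulrC (rho S d x)).
Qed.

Lemma sqint_wemb (lam : {measure set (d.-tuple R) -> \bar R}) :
  (forall h : d.-tuple R -> \bar R, measurable_fun setT h -> (forall y, 0 <= h y)%E ->
    (\int[lam]_y h y = intRn h)%E) ->
  forall f, sqint lam (fun x => wemb (f, x)).
Proof.
move=> lamE f.
have mf : measurable_fun setT (fun x => wemb (f, x)).
  exact: (measurableT_comp measurable_wemb (measurable_pair1 f)).
apply: sqint_ltP => //; rewrite lamE; last 2 first.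
- by apply/measurable_EFinP; exact: measurable_funX.
- by move=> x; rewrite lee_fin sqr_ge0.
rewrite -(sqnormG_wt (emb S d f)); have [C CP] := emb_continuous S d.
exact: le_lt_trans (CP f) (ltry _).
Qed.

Lemma linear_functional_sum n (L : n.-tuple (F -> R)) (b : nat -> R) :
  (forall i, linear_functional (tnth L i) /\ continuous (tnth L i)) ->
  linear_functional (fun f => \sum_(i < n) b i * tnth L i f) /\
  continuous (fun f => \sum_(i < n) b i * tnth L i f).
Proof.
move=> LP; split => [a f g|f].
  rewrite mulr_sumr -big_split; apply: eq_bigr => i _.
  by have [-> _] := LP i; rewrite /=; ring.
rewrite /continuous_at; elim: (index_enum _) => [|i s IH].
  by rewrite big_nil; under eq_fun do rewrite big_nil; exact: cvg_cst.
rewrite big_cons; under eq_fun do rewrite big_cons.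
apply: cvgD => //; apply: cvgM; first exact: cvg_cst.
by have [_] := LP i; exact.
Qed.

Lemma gaussian_wemb n (L : n.-tuple (F -> R)) :
  (forall i, linear_functional (tnth L i) /\ continuous (tnth L i)) ->
  forall x a (b : nat -> R),
  gaussian_rv (mu S d) (fun f => a * wemb (f, x) + \sum_(i < n) b i * tnth L i f).
Proof.
move=> LP x a b.
have [lL cL] := linear_functional_sum b LP.
pose M f := a * wemb (f, x) + \sum_(i < n) b i * tnth L i f.
have lM : linear_functional M.
  by move=> c f g; rewrite /M lL /wemb /= emb_linear; ring.
have cM : continuous M.
  move=> f; apply: cvgD; last exact: cL.
  by apply: cvgM; [exact: cvg_cst|exact: continuous_wemb].
split; first exact: (continuous_borel_measurable cM).
exact: mu_gaussian.
Qed.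

Lemma in_class_all cl L : @in_class _ S cl d L -> linear_functional L /\ continuous L.
Proof.
case: cl => //= -[x [xD ->]]; split; last exact: Defs.eval_continuous.
by move=> a f g; exact: emb_linear.
Qed.

Lemma e_avg_le cl n (L : n.-tuple (F -> R)) phi : (0 < n)%N ->
  admissible cl L phi -> (e_avg S cl n d <= err_alg L phi)%E.
Proof.
case: n L phi => // n L phi _ ad; apply: ereal_inf_lbound; by exists L, phi.
Qed.

End approximation.

Arguments dens {R} S d x.
Arguments wt {R} S d x.
Arguments wemb {R} S d p.
Arguments measurable_wt {R} S d.
Arguments measurable_wemb {R} S d.

Lemma le_esqrt {R : realType} (x y : \bar R) : (x <= y)%E -> (esqrt x <= esqrt y)%E.
Proof.
case: x => [x| |]; case: y => [y| |] //=; rewrite ?leey// ?leNye//.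
by rewrite !lee_fin; exact: ler_wsqrtr.
Qed.

Lemma esqrt_le_sqr {R : realType} (x : \bar R) (c : R) :
  (0 <= x)%E -> 0 <= c -> (esqrt x <= c%:E)%E -> (x <= (c ^+ 2)%:E)%E.
Proof.
case: x => [x| |]//=; rewrite !lee_fin => x0 c0 xc.
by rewrite -(sqr_sqrtr x0) ler_pXn2r ?nnegrE ?sqrtr_ge0.
Qed.

Section standard_algorithm.
Context {R : realType} (S : @avg_app_setting R) (d : nat).
Notation D := (Dom S d).
Notation F := (Fsp S d).
Notation bF := (borel_type F).
Variable lam : {sigma_finite_measure set (d.-tuple R) -> \bar R}.
Hypothesis lamE : forall h : d.-tuple R -> \bar R, measurable_fun setT h ->
  (forall y, 0 <= h y)%E -> (\int[lam]_y h y = intRn h)%E.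

Lemma err_algE n (L : n.-tuple (F -> R)) (phi : n.-tuple R -> d.-tuple R -> R) :
  measurable_fun [set: (n.-tuple R * d.-tuple R)%type] (fun p => phi p.1 p.2) ->
  err_alg L phi = esqrt (\int[mu S d]_f \int[lam]_x
    ((wemb S d (f, x) - wt S d x * phi (infovec L f) x) ^+ 2)%:E)%E.
Proof.
move=> mphi; congr esqrt; apply: eq_integral => f _.
rewrite sqnormG_wt lamE.
- by congr intRn; apply/funext => x; rewrite mulrBr.
- apply/measurable_EFinP; apply: measurable_funX; apply: measurable_funB.
    exact: (measurableT_comp (measurable_wemb S d) (measurable_pair1 f)).
  apply: measurable_funM; first exact: measurable_wt.
  exact: (measurableT_comp mphi (measurable_pair1 _)).
- by move=> x; rewrite lee_fin sqr_ge0.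
Qed.

Variables (k : nat) (e : nat -> d.-tuple R -> R).
Hypothesis oe : orthonormal lam k e.
Hypothesis e0 : forall x, (forall f, wemb S d (f, x) = 0) -> forall i, (i < k)%N -> e i x = 0.

Let evec0 x : wt S d x = 0 -> evec k e x = 0.
Proof.
move=> wx; apply/colP => i; rewrite !mxE; apply: e0 => // f.
by rewrite /wemb /= wx mul0r.
Qed.

Lemma kaczmarz_algorithm n (a : bF -> 'cV[R]_k) :
  kaczmarz (wemb S d) e n a ->
  exists (L : n.-tuple (F -> R)) (A : n.-tuple R -> 'cV[R]_k),
    [/\ (forall i, in_class Lstd (tnth L i)), mvec A &
        forall f, a f = A (infovec L f)].
Proof.
elim=> [|{}n {}a x v ex _ [L [A [LP mA aE]]]].
  exists [tuple], (fun=> 0); split => [[]//|i|//].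
  by under eq_fun do rewrite mxE; exact: measurable_cst.
(* Outside the domain the weight vanishes, and [evec] with it; the nonvanishing demanded by
   [kaczmarzS] thus makes every sample an admissible point evaluation. *)
have xD : D x.
  apply: contrapT => xD; move/eqP: ex; apply.
  by rewrite evec0 ?wtN// /dot big1// => i _; rewrite mxE mul0r.
exists (cons_tuple (fun f => emb S d f x) L).
pose B (t : n.+1.-tuple R) := A [tuple of behead t].
exists (fun t => B t + (wt S d x * thead t - dot (B t) (evec k e x)) *: v); split.
- move=> i; have [->|/eqP i0] := eqVneq i ord0; first by rewrite tnth0; exists x.
  by case: (unliftP ord0 i) => [j ->|//]; rewrite tnthS; exact: LP.
- have mB : mvec B.
    by move=> i; exact: (measurableT_comp (mA i) (@measurable_behead _ _ n)).
  move=> i; under eq_fun do rewrite mxE [X in _ + X]mxE.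
  apply: measurable_funD => //; apply: measurable_funM => //.
  apply: measurable_funB.
    by apply: measurable_funM => //; exact: (@measurable_tnth _ R).
  rewrite /dot; apply: measurable_sum => j.
  by apply: measurable_funM => //; exact: mB.
- move=> f; rewrite aE /B.
  have -> : [tuple of behead (infovec (cons_tuple (fun f => emb S d f x) L) f)] = infovec L f.
    exact/val_inj.
  by [].
Qed.

Lemma kaczmarz_e_avg n (a : bF -> 'cV[R]_k) : (0 < n)%N ->
  kaczmarz (wemb S d) e n a ->
  (e_avg S Lstd n d <= esqrt (\int[mu S d]_f \int[lam]_x
    ((wemb S d (f, x) - dot (a f) (evec k e x)) ^+ 2)%:E))%E.
Proof.
move=> n0 /kaczmarz_algorithm[L [A [LP mA aE]]].
(* Dividing by [wt] undoes the weight of [wemb]; where [wt] vanishes, so does [evec]. *)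
pose phi (t : n.-tuple R) x := wt S d x `^ (- 1) * dot (A t) (evec k e x).
have mphi : measurable_fun [set: (n.-tuple R * d.-tuple R)%type] (fun p => phi p.1 p.2).
  apply: measurable_funM.
    apply: (measurableT_comp (measurable_powR (- 1))).
    exact: (measurableT_comp (measurable_wt S d) measurable_snd).
  apply: measurable_sum => i; apply: measurable_funM.
    exact: (measurableT_comp (mA i) measurable_fst).
  under eq_fun do rewrite mxE.
  apply: (fun h => measurableT_comp h measurable_snd).
  by have [se _] := oe; have [] := se i (ltn_ord i).
have ad : admissible Lstd L phi by [].
apply: le_trans (e_avg_le n0 ad) _; rewrite err_algE//; apply: le_esqrt.
rewrite le_eqVlt; apply/orP; left; apply/eqP.
apply: eq_integral => f _; apply: eq_integral => x _; rewrite aE /phi.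
congr ((_ - _) ^+ 2)%:E.
have [wx|wx] := eqVneq (wt S d x) 0.
  by rewrite wx mul0r evec0// /dot big1// => i _; rewrite mxE mulr0.
by rewrite powR_inv1 ?sqrtr_ge0// mulrA mulfV// mul1r.
Qed.

End standard_algorithm.

Section std_from_all.
Context {R : realType} (S : @avg_app_setting R) (d : nat).

Lemma le_e_avg_std m (L : m.-tuple (Fsp S d -> R)) phi (E : R) :
  admissible Lall L phi -> 0 <= E -> (err_alg L phi <= E%:E)%E ->
  (e_avg S Lstd 0 d <= E%:E)%E \/
  exists k, (0 < k <= m)%N /\ forall (al : R) j, 0 < al <= 1 ->
    (e_avg S Lstd (k + j) d <=
      (E * Num.sqrt (1 + k.+1%:R * (1 - al / k%:R) ^+ j + al))%:E)%E.
Proof.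
move=> [LP mphi] E0 errE; have [lam lamE] := @intRn_measure R d.
have sF := @sqint_wemb _ S _ _ lamE.
pose p (z : m.-tuple R * d.-tuple R) := wt S d z.2 * phi z.1 z.2.
have mp : measurable_fun setT p.
  apply: measurable_funM => //.
  exact: (measurableT_comp (measurable_wt S d) measurable_snd).
have IE : (\int[mu S d]_f \int[lam]_x
    ((wemb S d (f, x) - p (map_tuple (fun l => l f) L, x)) ^+ 2)%:E <= (E ^+ 2)%:E)%E.
  apply: esqrt_le_sqr => //; last by rewrite -err_algE.
  by apply: integral_ge0 => f _; apply: integral_ge0 => x _; rewrite lee_fin sqr_ge0.
have [k [e [km oe e0 IG]]] :=
  gaussian_dimension_reduction (measurable_wemb S d) sF (gaussian_wemb LP) mp IE.
(* For [k = 0] the residual is the whole function, so the zero algorithm already has error at most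
   [E]. *)
have [k0|k0] := posnP k; [left|right].
  rewrite /e_avg (err_algE lamE)//.
  apply: (@le_trans _ _ (esqrt (E ^+ 2)%:E)); last by rewrite /= sqrtr_sqr ger0_norm.
  apply: le_esqrt; apply: le_trans IG; rewrite le_eqVlt; apply/orP; left; apply/eqP.
  apply: eq_integral => f _; rewrite -integral_sqr; last exact: sqint_orth_res.
  apply: eq_integral => x _; rewrite mulr0 subr0; congr (_ ^+ 2)%:E.
  rewrite /gres /orth_res big1 ?subr0// => -[i ik] _.
  by exfalso; rewrite k0 in ik.
exists k; rewrite k0; split => // al j al01.
have [a ka Ia] := kaczmarz_bound (measurable_wemb S d) sF oe IG j k0 al01.
apply: le_trans (kaczmarz_e_avg lamE oe e0 _ ka) _; first by rewrite addn_gt0 k0.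
apply: le_trans (le_esqrt Ia) _.
by rewrite /= lee_fin sqrtrM ?sqr_ge0// sqrtr_sqr ger0_norm.
Qed.

End std_from_all.

(** * Tractability *)

Section counting.
Context {R : realType}.

(** With [a = (2 * T)^-1], about [(k / a) * ln ((k + 1) / a)] steps push the geometric term below
    [a]; then [1 + 2 * a <= expR (2 * a)]. *)
Lemma steps_enough (T : R) (k : nat) : 1 <= T -> (0 < k)%N ->
  exists j : nat,
    1 + k.+1%:R * (1 - (2 * T)^-1 / k%:R) ^+ j + (2 * T)^-1 <= expR T^-1 /\
    j%:R <= k%:R * (2 * T) * ln (k.+1%:R * (2 * T)) + 1.
Proof.
move=> T1 k0; set y := k.+1%:R * (2 * T).
have T0 : 0 < T by lra.
have kr : 1 <= k%:R :> R by rewrite ler1n.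
have kS : k.+1%:R = k%:R + 1 :> R by rewrite -natr1.
have y1 : 1 < y by rewrite /y kS; nra.
have y0 : 0 < y by lra.
pose Q := k%:R * (2 * T) * ln y.
have Q0 : 0 <= Q.
  by rewrite /Q mulr_ge0// ?ln_ge0 ?(ltW y1)// mulr_ge0//; lra.
exists (Num.truncn Q).+1; split; last first.
  by rewrite -natr1 lerD2r; have := truncn_itv Q0 => /andP[].
have jQ : Q <= (Num.truncn Q).+1%:R by have /andP[_ /ltW] := truncn_itv Q0.
set j := (Num.truncn Q).+1 in jQ *.
set a := (2 * T)^-1.
have a0 : 0 < a by rewrite invr_gt0; lra.
have a1 : a <= 2^-1 by rewrite /a lef_pV2 ?posrE; lra.
have aT : a * (2 * T) = 1 by rewrite mulVf//; apply/eqP; lra.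
have ak : 0 <= a / k%:R by rewrite divr_ge0; lra.
have ak1 : a / k%:R <= 1 by rewrite ler_pdivrMr; lra.
have h : (1 - a / k%:R) ^+ j <= y^-1.
  apply: (@le_trans _ _ (expR (- (a / k%:R)) ^+ j)).
    rewrite lerXn2r ?nnegrE ?expR_ge0 ?subr_ge0//.
    exact: expR_ge1Dx.
  rewrite -expRM_natl -[leRHS]lnK ?posrE ?invr_gt0// ler_expR lnV ?posrE//.
  rewrite mulrN lerN2; apply: (@le_trans _ _ (Q * (a / k%:R))); last exact: ler_wpM2r.
  rewrite /Q le_eqVlt; apply/orP; left; apply/eqP.
  transitivity (ln y * (a * (2 * T)) * (k%:R / k%:R)); last by ring.
  by rewrite aT mulfV ?mulr1//; apply/eqP; lra.
have h' : k.+1%:R * (1 - a / k%:R) ^+ j <= a.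
  apply: le_trans (ler_wpM2l _ h) _; first exact: ler0n.
  have -> : y^-1 = k.+1%:R^-1 * a by rewrite /y /a invfM.
  by rewrite mulrA mulfV ?mul1r//; apply/eqP; lra.
have -> : T^-1 = 2 * a by rewrite /a invfM mulrA mulfV ?mul1r// pnatr_eq0.
by apply: le_trans (expR_ge1Dx _); rewrite -addrA lerD2l [2 * a]mulr_natl mulr2n lerD2r.
Qed.

Lemma sqr_le_expR (s x : R) : 0 < s -> 0 <= x -> x ^+ 2 <= 4 / s ^+ 2 * expR (s * x).
Proof.
move=> s0 x0; have h := expR_ge1Dx (s * x / 2).
have -> : expR (s * x) = expR (s * x / 2) ^+ 2.
  by rewrite -expRM_natl; congr expR; field.
have sx : 0 <= s * x by rewrite mulr_ge0 ?(ltW s0).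
rewrite -ler_pdivrMl; last by rewrite divr_gt0 ?exprn_gt0 ?ltr0n.
have -> : (4 / s ^+ 2)^-1 * x ^+ 2 = (s * x / 2) ^+ 2.
  by field; rewrite ?expf_neq0 ?gt_eqF.
rewrite lerXn2r ?nnegrE ?expR_ge0//; lra.
Qed.

(** Since [1 <= u], adding [T^-1] to [u] costs at most a factor [expR T^-1], and the prefactor [T]
    turns the resulting [T^-1] into 1. *)
Lemma ln_shift (u T : R) : 1 <= u -> 1 <= T ->
  T * (1 + ln (u + T^-1)) <= T * (1 + ln u) + 1.
Proof.
move=> u1 T1; have T0 : 0 < T by lra.
have iT : 0 < T^-1 by rewrite invr_gt0.
suff h : ln (u + T^-1) <= ln u + T^-1.
  have TT : T * T^-1 = 1 by rewrite mulfV//; apply/eqP; lra.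
  by have := ler_wpM2l (ltW T0) h; rewrite !mulrDr TT; lra.
rewrite -ler_expR lnK ?posrE; last lra.
rewrite expRD lnK ?posrE; last lra.
by have := expR_ge1Dx T^-1; nra.
Qed.

(** Coarse bounds in [X = T * E >= 1]: [2 * T] and the logarithm are each at most linear in [X].
    [C + 2] absorbs the additive units in [k + 1], and the last constant is
    [1 + 2 * (ln (C + 2) + 2 * t + 2)]. *)
Lemma count_bound (C t T E k : R) : 0 < C -> 0 <= t -> 1 <= T -> 1 <= E -> 0 <= k ->
  k <= C * expR (t * (T * E + 1)) + 1 ->
  k + (k * (2 * T) * ln ((k + 1) * (2 * T)) + 1) <=
  (C + 2) * expR t * (5 + 2 * ln (C + 2) + 4 * t) * (T * E) ^+ 2 * expR (t * (T * E)).
Proof.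
move=> C0 t0 T1 E1 k0 kB; set X := T * E.
have TX : T <= X by rewrite /X; nra.
have X1 : 1 <= X by lra.
set e := expR (t * (X + 1)).
have e1 : 1 <= e by rewrite -expR0 ler_expR; nra.
have eE : expR t * expR (t * X) = e by rewrite -expRD; congr expR; ring.
have kC : k + 1 <= (C + 2) * e by move: kB; rewrite -/X -/e; nra.
have l0 : 0 <= ln (C + 2) by rewrite ln_ge0; lra.
have lk : ln ((k + 1) * (2 * T)) <= ln (C + 2) + t * (X + 1) + 2 * X.
  rewrite lnM ?posrE; [|lra|lra].
  apply: lerD.
    apply: (@le_trans _ _ (ln ((C + 2) * e))); first by rewrite ler_ln ?posrE; nra.
    by rewrite lnM ?posrE ?expR_gt0 ?expRK; lra.
  rewrite -ler_expR lnK ?posrE; last lra.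
  by have := expR_ge1Dx (2 * X); lra.
have lk2 : ln ((k + 1) * (2 * T)) <= (ln (C + 2) + 2 * t + 2) * X by nra.
have lk0 : 0 <= ln ((k + 1) * (2 * T)) by rewrite ln_ge0//; nra.
have m1 : k * (2 * T) <= (C + 2) * e * (2 * X).
  by apply: ler_pM; nra.
have m2 : k * (2 * T) * ln ((k + 1) * (2 * T)) <=
    (C + 2) * e * (2 * X) * ((ln (C + 2) + 2 * t + 2) * X).
  by apply: ler_pM => //; nra.
have m3 : k + 1 <= (C + 2) * e * X ^+ 2.
  apply: le_trans kC _; rewrite -[leLHS]mulr1; apply: ler_pM => //; nra.
rewrite [leRHS](_ : _ = (C + 2) * e * X ^+ 2 +
  (C + 2) * e * (2 * X) * ((ln (C + 2) + 2 * t + 2) * X)); first lra.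
by rewrite -eE; ring.
Qed.

End counting.

Section tractability.
Context {R : realType} (S : @avg_app_setting R).

Lemma n_info_le cl cr eps d N :
  (e_avg S cl N d <= eps%:E * CRI S cr d)%E -> (n_info S cl cr eps d <= N%:R%:E)%E.
Proof. by move=> h; apply: ereal_inf_lbound; exists N. Qed.

Lemma e_avg_ge0 d : (0 <= e_avg S Lall 0 d)%E.
Proof. by rewrite /= /err_alg /esqrt; case: integral => *; rewrite ?lee_fin ?sqrtr_ge0. Qed.

Lemma CRI_NOR d : CRI S NOR d = e_avg S Lall 0 d.
Proof.
rewrite /CRI /Gamma; have := e_avg_ge0 d; case: (e_avg S Lall 0 d) => [x| |]//=.
by rewrite lee_fin => x0; rewrite -expr2 sqrtr_sqr ger0_norm.
Qed.

Lemma CRI_ge0 cr d : (0 <= CRI S cr d)%E.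
Proof. by case: cr; [rewrite lee_fin|rewrite CRI_NOR e_avg_ge0]. Qed.

Lemma e_avg_all_std n d : (e_avg S Lall n d <= e_avg S Lstd n d)%E.
Proof.
case: n => // n; apply: ereal_inf_le_tmp => _ [L [phi [[LP mphi] ->]]].
exists L, phi; split => //; split => // i.
exact: (in_class_all (LP i)).
Qed.

Lemma n_info_all_std cr eps d : (n_info S Lall cr eps d <= n_info S Lstd cr eps d)%E.
Proof.
apply: ereal_inf_le_tmp => _ [n nP <-]; exists n => //.
exact: le_trans (e_avg_all_std n d) nP.
Qed.

Lemma e_avg_lt_alg cl n d (c : R) : (e_avg S cl n d < c%:E)%E ->
  exists L phi, admissible cl L phi /\ (@err_alg _ S d n L phi <= c%:E)%E.
Proof.
case: n => [|n] /=.
  by move=> /ltW h; exists [tuple], (fun _ _ => 0); split => //; split => // -[].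
move=> /ereal_inf_lt[_ [L [phi [ad ->]]] /ltW h].
by exists L, phi.
Qed.

Lemma exp_qpt_bound_std cr C t s : 0 < C -> 0 <= t -> 0 < s ->
  exp_qpt_bound S Lall cr C t ->
  exists C', 0 < C' /\ exp_qpt_bound S Lstd cr C' (t + s).
Proof.
move=> C0 t0 s0 allC.
pose K := (C + 2) * expR t * (5 + 2 * ln (C + 2) + 4 * t).
have l0 : 0 <= ln (C + 2) by rewrite ln_ge0; lra.
have K0 : 0 < K by rewrite /K mulr_gt0// ?mulr_gt0 ?expR_gt0//; lra.
pose C' := K * (4 / s ^+ 2).
have C'0 : 0 < C' by rewrite mulr_gt0// divr_gt0// exprn_gt0.
exists C'; split => // d d0 eps /andP[eps0 eps1].
pose T : R := 1 + ln d%:R.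
have T1 : 1 <= T by rewrite lerDl ln_ge0// ler1n.
have T0 : 0 < T by lra.
have iT : 0 < T^-1 by rewrite invr_gt0.
pose u : R := 1 + ln eps^-1.
have u1 : 1 <= u by rewrite lerDl ln_ge0// invf_ge1 ?ltW.
pose E : R := 1 + ln u.
have E1 : 1 <= E by rewrite lerDl ln_ge0.
rewrite -/T -/u -/E.
have n0 : (e_avg S Lstd 0 d <= eps%:E * CRI S cr d)%E ->
    (n_info S Lstd cr eps d <= (C' * expR ((t + s) * T * E))%:E)%E.
  move=> /n_info_le /le_trans; apply; rewrite lee_fin.
  by rewrite mulr_ge0 ?expR_ge0 ?(ltW C'0).
(* Under the normalized criterion the initial error may be 0 or infinite; the zero algorithm then
   meets the demand. *)
have cases : (exists c, 0 < c /\ CRI S cr d = c%:E) \/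
    (e_avg S Lstd 0 d = 0%E \/ CRI S cr d = +oo%E).
  case: cr {n0 allC}; first by left; exists 1.
  rewrite CRI_NOR -[e_avg S Lstd 0 d]/(e_avg S Lall 0 d).
  have := e_avg_ge0 d; case: (e_avg S Lall 0 d) => [x| |]//; last by right; right.
  rewrite lee_fin le_eqVlt => /orP[/eqP <-|x0]; first by right; left.
  by left; exists x.
case: cases => [[c [c0 cE]]|[cr0|croo]]; last 2 first.
- by apply: n0; rewrite cr0 mule_ge0 ?CRI_ge0// lee_fin ltW.
- by apply: n0; rewrite croo gt0_muley ?lte_fin ?leey.
pose eps' := eps * expR (- T^-1).
have eps'0 : 0 < eps' by rewrite mulr_gt0 ?expR_gt0.
have eT1 : expR (- T^-1) < 1 by rewrite -expR0 ltr_expR; lra.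
have eps'1 : eps' < 1 by rewrite /eps'; have := expR_gt0 (- T^-1); nra.
have := allC d d0 eps'; rewrite eps'0 eps'1 => /(_ isT).
have lneps' : 1 + ln eps'^-1 = u + T^-1.
  by rewrite !lnV ?posrE// /u lnM ?posrE ?expR_gt0// expRK lnV ?posrE//; ring.
rewrite -/T lneps' => allB.
(* The added 1 gives a strict bound, so that the infimum yields an actual number [m] of
   functionals. *)
have {allB} : (n_info S Lall cr eps' d < (C * expR (t * (T * E + 1)) + 1)%:E)%E.
  apply: le_lt_trans allB _; rewrite lte_fin.
  apply: (@le_lt_trans _ _ (C * expR (t * (T * E + 1)))); last by rewrite ltrDl.
  rewrite ler_pM2l// ler_expR -mulrA; apply: ler_wpM2l => //.
  exact: ln_shift.
move=> /ereal_inf_lt[_ [m mP <-]]; rewrite lte_fin => /ltW mB.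
(* Half of the slack [T^-1] between [eps'] and [eps] gives the strict inequality that produces an
   algorithm from the infimum [e_avg]; the other half pays for the sampling factor, the square root
   of at most [expR T^-1]. *)
pose eps2 := eps * expR (- (2 * T)^-1).
have i2T : (2 * T)^-1 * 2 = T^-1 by rewrite invfM mulrAC mulVf ?mul1r.
have i2T0 : 0 < (2 * T)^-1 by rewrite invr_gt0; lra.
have iT1 : T^-1 <= 1 by rewrite invf_le1.
have lt12 : eps' * c < eps2 * c.
  by rewrite ltr_pM2r// ltr_pM2l// ltr_expR; lra.
have mlt : (e_avg S Lall m d < (eps2 * c)%:E)%E.
  by apply: le_lt_trans mP _; rewrite cE -EFinM lte_fin.
have [L [phi [ad errL]]] := e_avg_lt_alg mlt.
have eps2c0 : 0 <= eps2 * c by rewrite !mulr_ge0 ?expR_ge0 ?ltW.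
have eps2c : eps2 * c <= eps * c.
  rewrite ler_pM2r// -[leRHS]mulr1 ler_pM2l// -[leRHS]expR0 ler_expR; lra.
have [h|[k [/andP[k0 km] kP]]] := le_e_avg_std ad eps2c0 errL.
  by apply: n0; rewrite cE -EFinM (le_trans h).
have [j [jP jB]] := steps_enough T1 k0.
have al01 : 0 < (2 * T)^-1 <= 1 by apply/andP; split; lra.
have /n_info_le nkj : (e_avg S Lstd (k + j) d <= eps%:E * CRI S cr d)%E.
  apply: le_trans (kP _ j al01) _; rewrite cE -EFinM lee_fin.
  rewrite (_ : eps * c = eps2 * c * expR ((2 * T)^-1)).
    apply: ler_wpM2l => //.
    rewrite -[leRHS]ger0_norm ?expR_ge0// -sqrtr_sqr; apply: ler_wsqrtr.
    by rewrite -expRM_natr i2T.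
  by rewrite /eps2 -!mulrA (mulrCA _ c) -expRD addNr expR0 mulr1.
apply: le_trans nkj _; rewrite lee_fin natrD.
have kB : k%:R <= C * expR (t * (T * E + 1)) + 1.
  by apply: le_trans mB; rewrite ler_nat.
have := @count_bound _ C t T E k%:R C0 t0 T1 E1 (ler0n _ _) kB.
rewrite natr1 => cb.
apply: (@le_trans _ _ (K * (T * E) ^+ 2 * expR (t * (T * E)))).
  by apply: le_trans cb; rewrite lerD2l.
have -> : C' * expR ((t + s) * T * E) =
    K * (4 / s ^+ 2 * expR (s * (T * E))) * expR (t * (T * E)).
  by rewrite /C' -[(t + s) * T * E]mulrA (mulrDl t s) expRD; ring.
rewrite ler_pM2r ?expR_gt0// ler_pM2l//; apply: sqr_le_expR => //.
by rewrite mulr_ge0; lra.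
Qed.

Lemma exp_qpt_all_std cr C t : exp_qpt_bound S Lstd cr C t -> exp_qpt_bound S Lall cr C t.
Proof. by move=> h d d0 eps e01; apply: le_trans (n_info_all_std _ _ _) (h d d0 eps e01). Qed.

End tractability.

Theorem theorem5p4 (R : realType) (S : @avg_app_setting R) :
  (EXP_QPT S Lall ABS <-> EXP_QPT S Lstd ABS) /\
  (forall cr : criterion,
     EXP_QPT S Lall cr ->
     EXP_QPT S Lstd cr /\ EXP_t S Lall cr = EXP_t S Lstd cr).
Proof.
have qpt cr : EXP_QPT S Lall cr -> EXP_QPT S Lstd cr.
  move=> [C [t [C0 [t0 CP]]]].
  have [C' [C'0 C'P]] := exp_qpt_bound_std C0 t0 (@ltr01 R) CP.
  by exists C', (t + 1); rewrite addr_ge0.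
split; first split; first exact: qpt.
  move=> [C [t [C0 [t0 CP]]]]; exists C, t; split => //; split => //.
  exact: exp_qpt_all_std.
move=> cr allcr; split; first exact: qpt.
apply/eqP; rewrite eq_le; apply/andP; split.
  apply: ereal_inf_le_tmp => _ [t [t0 [C [C0 CP]]] <-].
  exists t => //; split => //; exists C; split => //.
  exact: exp_qpt_all_std.
apply: le_ereal_inf_tmp => _ [t [t0 [C [C0 CP]]] <-].
(* The loss [s] in the exponent is arbitrary, so it disappears in the infimum. *)
apply/lee_addgt0Pr => s s0; rewrite -EFinD.
have [C' [C'0 C'P]] := exp_qpt_bound_std C0 t0 s0 CP.
apply: ereal_inf_lbound; exists (t + s) => //.
by split; [rewrite addr_ge0// ltW|exists C'].
Qed.
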